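(* Let $d\ge 1$ be an integer, $b$ a prime and $v\ge 0$ an integer. Let $1\leq p<\infty$, $1\leq q\leq\infty$ and $0<r<1/p$. There exists a constant $C_{p,q,r,d,b,v}>0$ such that for every positive integer $n$ and every order $1$ digital $(v,n,d)$-net $\mathcal{P}_n^b$ over $\mathbb{F}_b$ we have \[ \left\|D_{\mathcal{P}_n^b}\,|\,S_{p,q}^rB([0,1)^d)\right\|\leq C_{p,q,r,d,b,v}\,b^{n(r-1)}\,n^{(d-1)/q}. \]
   Context: Convention: $1/q=0$ if $q=\infty$. Discrepancy function: for a finite family $\mathcal{P}$ of $N$ points in $[0,1)^d$ (points counted with multiplicity), $D_{\mathcal{P}}(x)=\frac1N\sum_{z\in\mathcal{P}}\chi_{[0,x)}(z)-x_1\cdots x_d$ for $x=(x_1,\ldots,x_d)\in[0,1)^d$, where $\chi_{[0,x)}$ is the characteristic function of $[0,x)=[0,x_1)\times\cdots\times[0,x_d)$. Digital nets: let $b$ be prime and let $\mathbb{F}_b$ be the field with $b$ elements, identified with $\{0,1,\ldots,b-1\}$ with arithmetic modulo $b$. For $s,n\in\mathbb{N}$ with $s\ge n$ let $C_1,\ldots,C_d$ be $s\times n$ matrices over $\mathbb{F}_b$. For $\nu\in\{0,\ldots,b^n-1\}$ with $b$-adic expansion $\nu=\nu_0+\nu_1b+\cdots+\nu_{n-1}b^{n-1}$ put $\bar\nu=(\nu_0,\ldots,\nu_{n-1})^\top\in\mathbb{F}_b^n$, $C_i\bar\nu=(x_{i,\nu,1},\ldots,x_{i,\nu,s})^\top\in\mathbb{F}_b^s$,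 $x_{i,\nu}=x_{i,\nu,1}b^{-1}+\cdots+x_{i,\nu,s}b^{-s}\in[0,1)$ and $x_\nu=(x_{1,\nu},\ldots,x_{d,\nu})$. The family $\mathcal{P}_n^b=\{x_0,\ldots,x_{b^n-1}\}$ of $N=b^n$ points (with multiplicity) is called a digital net over $\mathbb{F}_b$. Order $\sigma$ digital $(v,n,d)$-net: let $\sigma\in\mathbb{N}$, $s\ge\sigma n$, and let $0\le v\le\sigma n$ be an integer. Let $c_{i,1},\ldots,c_{i,s}\in\mathbb{F}_b^n$ be the rows of $C_i$. If for all choices of $0\le\eta_i\le s$ and indices $1\le\lambda_{i,\eta_i}<\cdots<\lambda_{i,1}\le s$ ($1\le i\le d$) with \[\sum_{i=1}^d\left(\lambda_{i,1}+\cdots+\lambda_{i,\min(\eta_i,\sigma)}\right)\le\sigma n-v\] the vectors $c_{1,\lambda_{1,1}},\ldots,c_{1,\lambda_{1,\eta_1}},\ldots,c_{d,\lambda_{d,1}},\ldots,c_{d,\lambda_{d,\eta_d}}$ are linearly independent over $\mathbb{F}_b$, then $\mathcal{P}_n^b$ is called an order $\sigma$ digital $(v,n,d)$-net over $\mathbb{F}_b$. Besov spaces with dominating mixed smoothness: let $\mathcal{F}$ be the Fourier transform on tempered distributions $\mathcal{S}'(\mathbb{R}^d)$. Fix $\varphi_0\in\mathcal{S}(\mathbb{R})$ with $\varphi_0(x)=1$ for $|x|\le1$ and $\varphi_0(x)=0$ for $|x|>\frac32$; put $\varphi_k(x)=\varphi_0(2^{-k}x)-\varphi_0(2^{-k+1}x)$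 for $k\in\mathbb{N}$ and $\varphi_{\bar k}(x)=\varphi_{k_1}(x_1)\cdots\varphi_{k_d}(x_d)$ for $\bar k=(k_1,\ldots,k_d)\in\mathbb{N}_0^d$. For $0<p,q\le\infty$, $r\in\mathbb{R}$, $S_{p,q}^rB(\mathbb{R}^d)$ consists of all $f\in\mathcal{S}'(\mathbb{R}^d)$ with finite quasi-norm \[\|f|S_{p,q}^rB(\mathbb{R}^d)\|=\Big(\sum_{\bar k\in\mathbb{N}_0^d}2^{r(k_1+\cdots+k_d)q}\,\|\mathcal{F}^{-1}(\varphi_{\bar k}\mathcal{F}f)|L_p(\mathbb{R}^d)\|^q\Big)^{1/q}\] (supremum if $q=\infty$). Let $\mathcal{D}'([0,1)^d)$ be the space of distributions dual to the smooth complex-valued functions on $\mathbb{R}^d$ with compact support in the interior of $[0,1)^d$. $S_{p,q}^rB([0,1)^d)$ consists of all $f\in\mathcal{D}'([0,1)^d)$ with finite quasi-norm $\|f|S_{p,q}^rB([0,1)^d)\|=\inf\{\|g|S_{p,q}^rB(\mathbb{R}^d)\|:\ g\in S_{p,q}^rB(\mathbb{R}^d),\ g|_{[0,1)^d}=f\}$. *)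

(* Defs.v *)
From HB Require Import structures.
From mathcomp Require Import all_boot all_order all_algebra.
From mathcomp Require Import all_classical all_reals all_analysis.
From mathcomp Require Import complex.

Set Implicit Arguments.
Unset Strict Implicit.
Unset Printing Implicit Defensive.
Import Order.TTheory GRing.Theory Num.Theory.
Import numFieldNormedType.Exports.
Local Open Scope classical_set_scope.
Local Open Scope ring_scope.
Local Open Scope complex_scope.

Section lebesgue_measure_tuple.
Context {R : realType}.
Local Notation RR := (measurableTypeR R).

Definition cons_pair n (x : RR * n.-tuple RR) : n.+1.-tuple RR :=
  [the n.+1.-tuple RR of x.1 :: x.2].

Lemma measurable_cons_pair n : measurable_fun setT (@cons_pair n).
Proof. exact: measurable_cons. Qed.

Section step.
Variables (n : nat) (mu : {sigma_finite_measure set (n.-tuple RR) -> \bar R}).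

Definition cons_measure : set (n.+1.-tuple RR) -> \bar R :=
  pushforward (@lebesgue_measure R \x mu)%E (@cons_pair n).

Let cons_measure0 : cons_measure set0 = 0%E.
Proof. by rewrite /cons_measure /pushforward preimage_set0 measure0. Qed.

Let cons_measure_ge0 A : (0 <= cons_measure A)%E.
Proof. by rewrite /cons_measure /pushforward measure_ge0. Qed.

Let cons_measure_sigma_additive : semi_sigma_additive cons_measure.
Proof.
move=> F mF tF mUF; rewrite /cons_measure /pushforward preimage_bigcup.
apply: measure_semi_sigma_additive.
- by move=> k; rewrite -[X in measurable X]setTI; exact: measurable_cons_pair.
- apply/trivIsetP => /= i j _ _ ij; rewrite -preimage_setI.
  by move/trivIsetP : tF => /(_ _ _ _ _ ij) ->//; rewrite preimage_set0.
- by rewrite -preimage_bigcup -[X in measurable X]setTI; exact: measurable_cons_pair.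
Qed.

HB.instance Definition _ := isMeasure.Build _ _ _ cons_measure
  cons_measure0 cons_measure_ge0 cons_measure_sigma_additive.

Lemma cons_measure_sigma_finite : sigma_finite setT cons_measure.
Proof.
have /sigma_finiteP[F [FT ndF Ffin]] := sigma_finiteT (@lebesgue_measure R).
have /sigma_finiteP[G [GT ndG Gfin]] := sigma_finiteT mu.
pose g (t : n.+1.-tuple RR) : RR * n.-tuple RR :=
  (tnth t ord0, [tuple of behead t]).
have mg : measurable_fun setT g.
  apply: measurable_fun_pair; first exact: measurable_tnth.
  exact: measurable_behead.
have gK (x : RR * n.-tuple RR) : g (cons_pair x) = x.
  by case: x => a t; congr pair; apply/val_inj.
have mFG k : measurable (F k `*` G k).
  by apply: measurableX; [exact: (Ffin k).1 | exact: (Gfin k).1].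
exists (fun k => g @^-1` (F k `*` G k)).
  rewrite -preimage_bigcup; apply/seteqP; split=> // t _.
  have : setT (g t).1 by []. rewrite FT => -[i _ Fi].
  have : setT (g t).2 by []. rewrite GT => -[j _ Gj].
  exists (maxn i j) => //; split.
    by move: Fi; exact/subsetPset/ndF/leq_maxl.
  by move: Gj; exact/subsetPset/ndG/leq_maxr.
move=> k; split; first by rewrite -[X in measurable X]setTI; exact: mg.
have -> : cons_measure (g @^-1` (F k `*` G k)) =
    (@lebesgue_measure R \x mu)%E (F k `*` G k).
  rewrite /cons_measure /pushforward; congr product_measure1.
  by rewrite -[RHS]preimage_id -[in RHS](funext gK).
rewrite product_measure1E//; [|exact: (Ffin k).1 | exact: (Gfin k).1].
have [mF Fk] := Ffin k; have [mG Gk] := Gfin k.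
by rewrite lte_mul_pinfty// ge0_fin_numE.
Qed.

HB.instance Definition _ :=
  Measure_isSigmaFinite.Build _ _ _ cons_measure cons_measure_sigma_finite.

End step.

Fixpoint lebesgue_tuple n : {sigma_finite_measure set (n.-tuple RR) -> \bar R} :=
  match n with
  | 0 => \d_([tuple] : 0.-tuple RR)
  | n'.+1 => cons_measure (lebesgue_tuple n')
  end.

End lebesgue_measure_tuple.

(* A point of R^d is a row vector for topology and derivatives, and a tuple for
   integration: only tuples carry the product sigma-algebra.  R[i] is normed
   over itself, not over R, so analysis is done on real and imaginary parts. *)
Section complex_functions.
Context {R : realType} {d : nat}.
Implicit Types (f g : 'rV[R]_d -> R[i]) (D : set 'rV[R]_d).

Definition row_of_tuple (t : d.-tuple (measurableTypeR R)) : 'rV[R]_d :=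
  \row_i tnth t i.

Definition re f (x : 'rV[R]_d) : R := complex.Re (f x).
Definition im f (x : 'rV[R]_d) : R := complex.Im (f x).

Definition modulus : R[i] -> R := @ComplexField.Normc.normc R.

Definition cmeasurable f : Prop :=
  measurable_fun setT (re f \o row_of_tuple) /\
  measurable_fun setT (im f \o row_of_tuple).

Definition cintegrable f : Prop :=
  (lebesgue_tuple d).-integrable setT (EFin \o re f \o row_of_tuple) /\
  (lebesgue_tuple d).-integrable setT (EFin \o im f \o row_of_tuple).

Definition cintegral D f : R[i] :=
  Rintegral (lebesgue_tuple d) (row_of_tuple @^-1` D) (re f \o row_of_tuple) +i*
  Rintegral (lebesgue_tuple d) (row_of_tuple @^-1` D) (im f \o row_of_tuple).

Definition pderiv (j : 'I_d) f (x : 'rV[R]_d) : R[i] :=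
  'D_(delta_mx 0 j) (re f) x +i* 'D_(delta_mx 0 j) (im f) x.

Definition iter_pderiv (s : seq 'I_d) f : 'rV[R]_d -> R[i] :=
  foldr pderiv f s.

Definition smooth f : Prop :=
  forall s : seq 'I_d, let g := iter_pderiv s f in
    [/\ continuous (re g), continuous (im g) &
        forall (j : 'I_d) (x : 'rV[R]_d),
          derivable (re g) x (delta_mx 0 j) /\
          derivable (im g) x (delta_mx 0 j)].

(* Directions are listed one by one, so size z.1 is the order of the derivative. *)
Definition schwartz_norm (N : nat) f : \bar R :=
  ereal_sup [set ((1 + `|z.2|) ^+ N * modulus (iter_pderiv z.1 f z.2))%:E
            | z in [set z : seq 'I_d * 'rV[R]_d | (size z.1 <= N)%N]].

Definition schwartz f : Prop :=
  smooth f /\ forall N, (schwartz_norm N f < +oo)%E.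

Definition dotp (x y : 'rV[R]_d) : R := \sum_i x 0 i * y 0 i.

Definition cis (t : R) : R[i] := cos t +i* sin t.

(* Unitary convention, with constant (2 pi)^(-d/2). *)
Definition fourier f (xi : 'rV[R]_d) : R[i] :=
  ((Num.sqrt (2 * pi) ^- d)%:C) *
  cintegral setT (fun x => cis (- dotp x xi) * f x).

Definition inv_fourier f (x : 'rV[R]_d) : R[i] :=
  ((Num.sqrt (2 * pi) ^- d)%:C) *
  cintegral setT (fun xi => cis (dotp x xi) * f xi).

End complex_functions.

(* A tempered distribution is a functional on all complex-valued functions of
   which only the values on Schwartz functions matter. *)
Section tempered_distributions.
Context {R : realType} {d : nat}.
Local Notation functional := (('rV[R]_d -> R[i]) -> R[i]).
Implicit Types (u : functional) (f g : 'rV[R]_d -> R[i]).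

Definition tempered u : Prop :=
  (forall (a : R[i]) f g, schwartz f -> schwartz g ->
     u (fun x => a * f x + g x) = a * u f + u g) /\
  exists (N : nat) (C : R), forall f, schwartz f ->
     ((modulus (u f))%:E <= C%:E * schwartz_norm N f)%E.

Definition dfourier u : functional := fun f => u (fourier f).
Definition dinv_fourier u : functional := fun f => u (inv_fourier f).
Definition dmul g u : functional := fun f => u (fun x => g x * f x).

Definition represents g u : Prop :=
  cmeasurable g /\
  forall f, schwartz f ->
    cintegrable (fun x => g x * f x) /\
    u f = cintegral setT (fun x => g x * f x).

(* Representing functions agree almost everywhere, so the infimum is over at
   most one value; it is +oo if u is not a function. *)
Definition dist_Lnorm (p : \bar R) u : \bar R :=
  ereal_inf
    [set Lnorm (lebesgue_tuple d) p (fun t => (modulus (g (row_of_tuple t)))%:E)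
    | g in [set g | represents g u]].

End tempered_distributions.

Section besov.
Context {R : realType}.

Definition cutoff (phi0 : R -> R[i]) : Prop :=
  [/\ schwartz (fun x : 'rV[R]_1 => phi0 (x 0 0)),
      forall x : R, `|x| <= 1 -> phi0 x = 1 &
      forall x : R, 3 / 2 < `|x| -> phi0 x = 0].

Definition dyadic (phi0 : R -> R[i]) (k : nat) (x : R) : R[i] :=
  if k is k'.+1 then phi0 (2 ^- k'.+1 * x) - phi0 (2 ^- k' * x) else phi0 x.

Definition dyadic_tensor d phi0 (k : {ffun 'I_d -> nat}) (x : 'rV[R]_d) : R[i] :=
  \prod_i dyadic phi0 (k i) (x 0 i).

Definition dyadic_block d phi0 (k : {ffun 'I_d -> nat})
    (u : ('rV[R]_d -> R[i]) -> R[i]) :=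
  dinv_fourier (dmul (dyadic_tensor phi0 k) (dfourier u)).

(* Meant for 0 < p, q <= +oo. *)
Definition besov_norm d phi0 (p q : \bar R) (r : R)
    (u : ('rV[R]_d -> R[i]) -> R[i]) : \bar R :=
  if q is q'%:E then
    ((\esum_(k in [set: {ffun 'I_d -> nat}])
        ((2 `^ (r * (\sum_i k i)%:R * q'))%:E *
         dist_Lnorm p (dyadic_block phi0 k u) `^ q')) `^ q'^-1)%E
  else
    ereal_sup [set ((2 `^ (r * (\sum_i k i)%:R))%:E *
                    dist_Lnorm p (dyadic_block phi0 k u))%E
              | k in [set: {ffun 'I_d -> nat}]].

Definition besov d phi0 (p q : \bar R) (r : R) :
    set (('rV[R]_d -> R[i]) -> R[i]) :=
  [set u | tempered u /\ (besov_norm phi0 p q r u < +oo)%E].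

Definition unit_cube d : set 'rV[R]_d := [set x | forall i, 0 <= x 0 i < 1].

Definition cube_test_function d (f : 'rV[R]_d -> R[i]) : Prop :=
  [/\ smooth f, compact (closure [set x | f x != 0]) &
      closure [set x | f x != 0] `<=` (@unit_cube d)°].

(* Equality in D'([0,1)^d) of the restriction of u with w. *)
Definition restricts_to d (u w : ('rV[R]_d -> R[i]) -> R[i]) : Prop :=
  forall f, cube_test_function f -> u f = w f.

(* The value is +oo when w has no extension in the space over R^d; a functional
   that has one is automatically a distribution on the cube. *)
Definition besov_cube_norm d phi0 (p q : \bar R) (r : R)
    (w : ('rV[R]_d -> R[i]) -> R[i]) : \bar R :=
  ereal_inf [set besov_norm phi0 p q r u
            | u in [set u | besov phi0 p q r u /\ restricts_to u w]].

Definition cube_distribution_of d (h : 'rV[R]_d -> R) :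
    ('rV[R]_d -> R[i]) -> R[i] :=
  fun f => cintegral (@unit_cube d) (fun x => (h x)%:C * f x).

End besov.

Section nets.
Context {R : realType}.

Definition discrepancy d N (P : 'I_N -> 'rV[R]_d) (x : 'rV[R]_d) : R :=
  N%:R^-1 * \sum_(m < N) [forall i, 0 <= P m 0 i < x 0 i]%:R - \prod_i x 0 i.

Definition digit_vector b n (m : nat) : 'cV['F_b]_n :=
  \col_(j < n) ((m %/ b ^ j) %% b)%N%:R.

(* For prime b, an element of 'F_b coerces to its representative in 0..b-1. *)
Definition digital_net b d s n (C : 'I_d -> 'M['F_b]_(s, n)) (m : 'I_(b ^ n)) :
    'rV[R]_d :=
  \row_i \sum_(k < s)
    ((C i *m digit_vector b n m) k 0 : nat)%:R * b%:R ^- k.+1.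

End nets.

(* Row indices run from 0, so k : 'I_s stands for lambda = k.+1; lam i lists
   lambda_(i,1) > ... > lambda_(i,eta_i), with eta_i its size. *)
Definition order_digital_net (sigma v b d s n : nat)
    (C : 'I_d -> 'M['F_b]_(s, n)) : Prop :=
  [/\ (n <= s)%N, (sigma * n <= s)%N, (v <= sigma * n)%N &
      forall lam : 'I_d -> seq 'I_s,
        (forall i, sorted (fun k l : 'I_s => (l < k)%N) (lam i)) ->
        (\sum_i \sum_(k <- take sigma (lam i)) k.+1 <= sigma * n - v)%N ->
        free [seq row k (C i) | i <- enum 'I_d, k <- lam i]].

(* 1 / q, with 1 / +oo = 0. *)
Definition recip (R : realType) (q : \bar R) : R :=
  if q is q'%:E then q'^-1 else 0.

(* Main.v *)
Require Import Defs.
From HB Require Import structures.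
From mathcomp Require Import all_boot all_order all_algebra.
From mathcomp Require Import all_classical all_reals all_analysis.
From mathcomp Require Import complex measurable_realfun zify ring lra.

(** The discrepancy is extended to R^d by G = N^-1 sum_z (x)_i chi_(z_i, z_i + 1] - (x)_i T, with T the
    tent function, so that each dyadic block of G is a difference of a mean over the net and a product
    of one-dimensional blocks.  The block of index k of chi_(z, z + 1] decays like 1 / (1 + (2^k (x - z))^2)
    around z and z + 1 and is Lipschitz in z at scale 2^-k, and the block of the tent is its mean over the
    points z = a / b^L.  Let b^(j_i) be the power of b just below 2^(k_i), J the sum of the j_i and
    m = n - v.  If J <= m, telescope in each coordinate along the b-adic scales l_i >= j_i: the net integrates
    the terms with sum l_i <= m exactly, which cancels them, and the others gain b^-(l_i - j_i) in each
    coordinate.  If J > m, bound the mean over the net and the product separately, in sup norm at a coarser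
    index with sum m and in L_1 norm at index j.  Interpolating L_p between L_1 and L_oo gives
    2^(r |k|) |block_k|_p <= C b^(m (r - 1)) rho^|J - m| with rho < 1, and the number of levels with
    given J close to m is of order m^(d - 1). *)

Set Implicit Arguments.
Unset Strict Implicit.
Unset Printing Implicit Defensive.
Import Order.TTheory GRing.Theory Num.Theory.
Import numFieldNormedType.Exports.
Local Open Scope classical_set_scope.
Local Open Scope ring_scope.
Local Open Scope complex_scope.

(** The norm on the cube is an infimum over extensions, so one extension with computable blocks is
    enough. The jumps at z_i + 1 >= 1 cannot be seen inside the cube, and the tent is the mean of
    chi_(z, z + 1] over z in [0, 1). Hence G is, on all of R^d, the error of the net as a quadrature
    rule applied to the products of the chi_(z_i, z_i + 1], and each block of G is the error for the
    products of their blocks: this is how exactness of the net on elementary boxes reaches every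
    frequency.

    The two conditions on r act on opposite sides of J = m. For J <= m, summing the terms left
    uncancelled would cost a power of m - J; a geometric loss is accepted instead, which r > 0 can
    pay for. For J > m, interpolation leaves b^((r - 1/p)(J - m)), which decays because r < 1/p. The
    resolution L is auxiliary: the net has finitely many digits and does not change with L, while
    the grid mean tends to the block of the tent as L grows. *)

(** * Complex-valued integrals *)

Notation cRe := (@complex.Re _).
Notation cIm := (@complex.Im _).

Arguments modulus : simpl never.

Section modulus.
Context {R : realType}.
Implicit Types (z : R[i]) (x : R).

Lemma cReD z1 z2 : cRe (z1 + z2) = cRe z1 + cRe z2.
Proof. by case: z1; case: z2. Qed.

Lemma cImD z1 z2 : cIm (z1 + z2) = cIm z1 + cIm z2.
Proof. by case: z1; case: z2. Qed.

Lemma cReM z1 z2 : cRe (z1 * z2) = cRe z1 * cRe z2 - cIm z1 * cIm z2.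
Proof. by case: z1; case: z2. Qed.

Lemma cImM z1 z2 : cIm (z1 * z2) = cRe z1 * cIm z2 + cIm z1 * cRe z2.
Proof. by case: z1 => a b; case: z2 => c e /=. Qed.

Lemma complexP z1 z2 : cRe z1 = cRe z2 -> cIm z1 = cIm z2 -> z1 = z2.
Proof. by case: z1; case: z2 => /= ? ? ? ? -> ->. Qed.

Lemma modulusE z : modulus z = Num.sqrt (cRe z ^+ 2 + cIm z ^+ 2).
Proof. by case: z. Qed.

Lemma modulus_ge0 z : 0 <= modulus z.
Proof. by rewrite modulusE sqrtr_ge0. Qed.

Lemma modulus0 : modulus (0 : R[i]) = 0.
Proof. exact: ComplexField.Normc.normc0. Qed.

Lemma modulus1 : modulus (1 : R[i]) = 1.
Proof. exact: ComplexField.Normc.normc1. Qed.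

Lemma modulusM z1 z2 : modulus (z1 * z2) = modulus z1 * modulus z2.
Proof. exact: ComplexField.Normc.normcM. Qed.

Lemma modulusD z1 z2 : modulus (z1 + z2) <= modulus z1 + modulus z2.
Proof. exact: le_normcD. Qed.

Lemma modulusN z : modulus (- z) = modulus z.
Proof. exact: normcN. Qed.

Lemma modulusB z1 z2 : modulus (z1 - z2) <= modulus z1 + modulus z2.
Proof. by rewrite -(modulusN z2) modulusD. Qed.

Lemma modulusC x : modulus x%:C = `|x|.
Proof. by rewrite modulusE /= expr0n addr0 sqrtr_sqr. Qed.

Lemma modulus_prod (I : finType) (F : I -> R[i]) :
  modulus (\prod_i F i) = \prod_i modulus (F i).
Proof. exact: (big_morph _ modulusM modulus1). Qed.

Lemma modulus_sum (I : Type) (s : seq I) (P : pred I) (F : I -> R[i]) :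
  modulus (\sum_(i <- s | P i) F i) <= \sum_(i <- s | P i) modulus (F i).
Proof.
elim/big_ind2: _ => [||//]; first by rewrite modulus0.
by move=> a b c e ab ce; apply: le_trans (modulusD _ _) _; exact: lerD.
Qed.

Lemma Re_le_modulus z : `|cRe z| <= modulus z.
Proof.
by rewrite modulusE -sqrtr_sqr ler_wsqrtr// lerDl sqr_ge0.
Qed.

Lemma Im_le_modulus z : `|cIm z| <= modulus z.
Proof.
by rewrite modulusE -sqrtr_sqr ler_wsqrtr// lerDr sqr_ge0.
Qed.

Lemma modulus_le_ReIm z : modulus z <= `|cRe z| + `|cIm z|.
Proof.
rewrite modulusE -[leRHS]ger0_norm ?addr_ge0// -[leRHS]sqrtr_sqr ler_wsqrtr//.
rewrite sqrrD !real_normK ?num_real// addrAC lerDl mulrn_wge0 ?mulr_ge0//.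
Qed.

Lemma modulus_cis x : modulus (cis x) = 1.
Proof. by rewrite modulusE /= cos2Dsin2 sqrtr1. Qed.

Lemma cisD x y : cis (x + y) = cis x * cis y.
Proof.
by apply: complexP; rewrite ?cReM ?cImM /= ?cosD ?sinD // addrC [X in _ + X]mulrC.
Qed.

Lemma cis0 : cis (0 : R) = 1.
Proof. by rewrite /cis cos0 sin0. Qed.

Lemma cis_sum (I : finType) (F : I -> R) : cis (\sum_i F i) = \prod_i cis (F i).
Proof. exact: (big_morph _ cisD cis0). Qed.

End modulus.

Section complex_integral.
Context d (T : measurableType d) {R : realType}.
Variable mu : {measure set T -> \bar R}.
Implicit Types (f g : T -> R[i]) (h : T -> R).

Definition cmeas f : Prop :=
  measurable_fun setT (cRe \o f) /\ measurable_fun setT (cIm \o f).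

Definition cinteg f : Prop :=
  mu.-integrable setT (EFin \o (cRe \o f)) /\
  mu.-integrable setT (EFin \o (cIm \o f)).

Definition cint f : R[i] :=
  Rintegral mu setT (cRe \o f) +i* Rintegral mu setT (cIm \o f).

Lemma cmeasD f g : cmeas f -> cmeas g -> cmeas (fun x => f x + g x).
Proof.
move=> [f1 f2] [g1 g2]; split.
  rewrite (_ : _ \o _ = (cRe \o f) \+ (cRe \o g)); first exact: measurable_funD.
  by apply/funext => x /=; rewrite cReD.
rewrite (_ : _ \o _ = (cIm \o f) \+ (cIm \o g)); first exact: measurable_funD.
by apply/funext => x /=; rewrite cImD.
Qed.

Lemma cmeasM f g : cmeas f -> cmeas g -> cmeas (fun x => f x * g x).
Proof.
move=> [f1 f2] [g1 g2]; split.
  rewrite (_ : _ \o _ = ((cRe \o f) \* (cRe \o g)) \- ((cIm \o f) \* (cIm \o g))).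
    by apply: measurable_funB; exact: measurable_funM.
  by apply/funext => x /=; rewrite cReM.
rewrite (_ : _ \o _ = ((cRe \o f) \* (cIm \o g)) \+ ((cIm \o f) \* (cRe \o g))).
  by apply: measurable_funD; exact: measurable_funM.
by apply/funext => x /=; rewrite cImM.
Qed.

Lemma cmeas_cst z : cmeas (fun=> z).
Proof. by split; exact: measurable_cst. Qed.

Lemma cmeas_real h : measurable_fun setT h -> cmeas (fun x => (h x)%:C).
Proof. by move=> mh; split => //; exact: measurable_cst. Qed.

Lemma cmeas_cis h : measurable_fun setT h -> cmeas (fun x => cis (h x)).
Proof.
move=> mh; split.
  apply: (measurableT_comp (f := cos)) => //.
  by apply: continuous_measurable_fun; exact: continuous_cos.
apply: (measurableT_comp (f := sin)) => //.
by apply: continuous_measurable_fun; exact: continuous_sin.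
Qed.

Lemma cmeas_prod (I : Type) (s : seq I) (F : I -> T -> R[i]) :
  (forall i, cmeas (F i)) -> cmeas (fun x => \prod_(i <- s) F i x).
Proof.
move=> mF; elim: s => [|i s IH].
  by rewrite (_ : (fun=> _) = fun=> 1); [exact: cmeas_cst|apply/funext => x; rewrite big_nil].
rewrite (_ : (fun=> _) = fun x => F i x * \prod_(j <- s) F j x); first exact: cmeasM.
by apply/funext => x; rewrite big_cons.
Qed.

Lemma measurable_modulus f : cmeas f -> measurable_fun setT (modulus \o f).
Proof.
move=> [f1 f2].
rewrite (_ : _ \o _ = Num.sqrt \o ((fun x => (cRe \o f) x ^+ 2) \+ (fun x => (cIm \o f) x ^+ 2))).
  apply: measurableT_comp; first by apply: continuous_measurable_fun; exact: sqrt_continuous.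
  by apply: measurable_funD; exact: measurable_funX.
by apply/funext => x /=; rewrite modulusE.
Qed.

Lemma cinteg_cmeas f : cinteg f -> cmeas f.
Proof.
move=> [f1 f2]; split; apply/measurable_EFinP.
  exact: measurable_int f1.
exact: measurable_int f2.
Qed.

Lemma cinteg_dom f h : cmeas f -> mu.-integrable setT (EFin \o h) ->
  (forall x, modulus (f x) <= h x) -> cinteg f.
Proof.
move=> [f1 f2] ih fh; split; apply: le_integrable ih => //.
- exact/measurable_EFinP.
- move=> x _ /=; rewrite lee_fin (le_trans (Re_le_modulus _))//.
  by rewrite (le_trans (fh x))// ler_norm.
- exact/measurable_EFinP.
- move=> x _ /=; rewrite lee_fin (le_trans (Im_le_modulus _))//.
  by rewrite (le_trans (fh x))// ler_norm.
Qed.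

Lemma integrable_modulus f : cinteg f -> mu.-integrable setT (EFin \o (modulus \o f)).
Proof.
move=> fi; have [f1 f2] := fi.
have /= i1 := integrable_norm f1; have /= i2 := integrable_norm f2.
have := integrableD measurableT i1 i2; apply: le_integrable => //.
  by apply/measurable_EFinP; apply: measurable_modulus; exact: cinteg_cmeas.
move=> x _ /=; rewrite lee_fin.
rewrite ger0_norm ?modulus_ge0// (le_trans (modulus_le_ReIm _))//.
by rewrite ler_norm.
Qed.

(** The factor 2 comes from bounding real and imaginary parts separately; it is absorbed in later
    constants. *)
Lemma modulus_cint_le f h : mu.-integrable setT (EFin \o h) -> cmeas f ->
  (forall x, modulus (f x) <= h x) -> modulus (cint f) <= 2 * Rintegral mu setT h.
Proof.
move=> ih mf fh; have [f1 f2] := cinteg_dom mf ih fh.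
rewrite (le_trans (modulus_le_ReIm _))// mulr_natl mulr2n lerD//=.
  apply: (le_trans (le_normr_Rintegral measurableT f1)).
  apply: le_Rintegral => //; first exact: integrable_norm f1.
  by move=> x _ /=; rewrite (le_trans (Re_le_modulus _)).
apply: (le_trans (le_normr_Rintegral measurableT f2)).
apply: le_Rintegral => //; first exact: integrable_norm f2.
by move=> x _ /=; rewrite (le_trans (Im_le_modulus _)).
Qed.

Lemma cintegD f g : cinteg f -> cinteg g -> cinteg (fun x => f x + g x).
Proof.
move=> [f1 f2] [g1 g2]; split.
  have := integrableD measurableT f1 g1; apply: eq_integrable => // x _ /=.
  by rewrite cReD.
have := integrableD measurableT f2 g2; apply: eq_integrable => // x _ /=.
by rewrite cImD.
Qed.

Lemma cintD f g : cinteg f -> cinteg g ->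
  cint (fun x => f x + g x) = cint f + cint g.
Proof.
move=> [f1 f2] [g1 g2]; apply: complexP; rewrite ?cReD ?cImD /=.
  by rewrite -RintegralD//; apply: eq_Rintegral => x _ /=; rewrite cReD.
by rewrite -RintegralD//; apply: eq_Rintegral => x _ /=; rewrite cImD.
Qed.

Lemma cintegMb f g (M : R) : cmeas g -> (forall x, modulus (g x) <= M) ->
  cinteg f -> cinteg (fun x => g x * f x).
Proof.
move=> mg gM fi.
apply: (@cinteg_dom _ (fun x => M * modulus (f x))).
- by apply: cmeasM => //; exact: cinteg_cmeas.
- exact: (integrableZl measurableT M (integrable_modulus fi)).
- by move=> x; rewrite modulusM ler_wpM2r ?modulus_ge0.
Qed.

Lemma cintegZ z f : cinteg f -> cinteg (fun x => z * f x).
Proof. by apply: (@cintegMb _ _ (modulus z)) => //; exact: cmeas_cst. Qed.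

Lemma cintZ z f : cinteg f -> cint (fun x => z * f x) = z * cint f.
Proof.
move=> [f1 f2]; apply: complexP; rewrite ?cReM ?cImM /=.
  rewrite -!RintegralZl// -RintegralB//.
  - by apply: eq_Rintegral => x _ /=; rewrite cReM.
  - exact: (integrableZl measurableT _ f1).
  - exact: (integrableZl measurableT _ f2).
rewrite -!RintegralZl// -RintegralD//.
- by apply: eq_Rintegral => x _ /=; rewrite cImM.
- exact: (integrableZl measurableT _ f2).
- exact: (integrableZl measurableT _ f1).
Qed.

Lemma cintMr z f : cinteg f -> cint (fun x => f x * z) = cint f * z.
Proof.
move=> fi; rewrite mulrC -cintZ//; congr cint.
by apply/funext => x; rewrite mulrC.
Qed.

Lemma cinteg0 : cinteg (fun=> 0).
Proof. by split; exact: integrable0. Qed.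

Lemma cint0 : cint (fun=> 0) = 0.
Proof.
rewrite -[RHS](mul0r (cint (fun=> 0))) -cintZ; last exact: cinteg0.
by congr cint; apply/funext => x; rewrite mul0r.
Qed.

Lemma cinteg_sum (I : Type) (s : seq I) (F : I -> T -> R[i]) :
  (forall i, cinteg (F i)) -> cinteg (fun x => \sum_(i <- s) F i x).
Proof.
move=> iF; elim: s => [|i s IH].
  rewrite (_ : (fun=> _) = fun=> 0); first exact: cinteg0.
  by apply/funext => x; rewrite big_nil.
rewrite (_ : (fun=> _) = fun x => F i x + \sum_(j <- s) F j x); first exact: cintegD.
by apply/funext => x; rewrite big_cons.
Qed.

Lemma cint_sum (I : Type) (s : seq I) (F : I -> T -> R[i]) :
  (forall i, cinteg (F i)) ->
  cint (fun x => \sum_(i <- s) F i x) = \sum_(i <- s) cint (F i).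
Proof.
move=> iF; elim: s => [|i s IH].
  by rewrite big_nil -[RHS]cint0; congr cint; apply/funext => x; rewrite big_nil.
rewrite big_cons -IH -cintD//; last exact: cinteg_sum.
by congr cint; apply/funext => x; rewrite big_cons.
Qed.

End complex_integral.

Lemma cmeas_comp d1 d2 (T1 : measurableType d1) (T2 : measurableType d2)
    (R : realType) (f : T2 -> R[i]) (h : T1 -> T2) :
  measurable_fun setT h -> cmeas f -> cmeas (fun x => f (h x)).
Proof.
by move=> mh [f1 f2]; split; [exact: measurableT_comp f1 mh|exact: measurableT_comp f2 mh].
Qed.

Section fubini.
Context d1 d2 (T1 : measurableType d1) (T2 : measurableType d2) {R : realType}.
Variables (m1 : {sigma_finite_measure set T1 -> \bar R})
          (m2 : {sigma_finite_measure set T2 -> \bar R}).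

(** The integrands met below are unimodular kernels times products. Domination by [A x * B y] at
    every point makes all sections integrable, not just almost all, so iterated integrals have no
    exceptional sets. *)
Section dominated.
Variables (F : T1 * T2 -> R[i]) (A : T1 -> R) (B : T2 -> R).
Hypotheses (mF : cmeas F) (iA : m1.-integrable setT (EFin \o A))
  (iB : m2.-integrable setT (EFin \o B))
  (A0 : forall x, 0 <= A x) (B0 : forall y, 0 <= B y)
  (FAB : forall x y, modulus (F (x, y)) <= A x * B y).

Lemma integrable_prod2 : (m1 \x m2)%E.-integrable setT (fun z => (A z.1 * B z.2)%:E).
Proof.
have mA : measurable_fun setT A by apply/measurable_EFinP; exact: measurable_int iA.
have mB : measurable_fun setT B by apply/measurable_EFinP; exact: measurable_int iB.
apply/integrable12ltyP.
  apply/measurable_EFinP; apply: measurable_funM.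
    exact: (measurableT_comp mA).
  exact: (measurableT_comp mB).
have -> : (\int[m1]_x \int[m2]_y `|(A x * B y)%:E| =
  \int[m1]_x ((fine (\int[m2]_y (B y)%:E))%:E * (A x)%:E))%E.
  apply: eq_integral => x _.
  rewrite fineK; last exact: integrable_fin_num iB.
  rewrite muleC -integralZl//; apply: eq_integral => y _ /=.
  by rewrite ger0_norm ?mulr_ge0.
rewrite integralZl//.
have /integrable_fin_num -/(_ measurableT) := iA => /fineK <-.
by rewrite -EFinM ltry.
Qed.

Lemma cinteg_prod : cinteg (m1 \x m2)%E F.
Proof.
by apply: cinteg_dom integrable_prod2 _ => // -[x y]; exact: FAB.
Qed.

Lemma cmeas_sec1 x : cmeas (fun y => F (x, y)).
Proof. by apply: cmeas_comp mF; exact: measurable_pair1. Qed.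

Lemma cmeas_sec2 y : cmeas (fun x => F (x, y)).
Proof. by apply: cmeas_comp mF; exact: measurable_pair2. Qed.

Lemma cinteg_sec1 x : cinteg m2 (fun y => F (x, y)).
Proof.
apply: (@cinteg_dom _ _ _ _ _ (fun y => A x * B y)) => //; first exact: cmeas_sec1.
exact: (integrableZl measurableT _ iB).
Qed.

Lemma cinteg_sec2 y : cinteg m1 (fun x => F (x, y)).
Proof.
apply: (@cinteg_dom _ _ _ _ _ (fun x => A x * B y)) => //; first exact: cmeas_sec2.
exact: (integrableZr measurableT _ iA).
Qed.

Lemma cmeas_cint2 : cmeas (fun x => cint m2 (fun y => F (x, y))).
Proof.
have [F1 F2] := cinteg_prod; split.
  have := measurable_fubini_F F1; move=> /(@measurableT_comp _ _ _ _ _ _ fine _ _) h.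
  by apply: h; exact: fine_measurable.
have := measurable_fubini_F F2; move=> /(@measurableT_comp _ _ _ _ _ _ fine _ _) h.
by apply: h; exact: fine_measurable.
Qed.

Lemma cint_prod12 :
  cint (m1 \x m2)%E F = cint m1 (fun x => cint m2 (fun y => F (x, y))).
Proof.
have [F1 F2] := cinteg_prod; apply: complexP => /=; congr fine.
  rewrite -integral12_prod_meas1//; apply: eq_integral => x _ /=.
  by rewrite fineK//; apply: integrable_fin_num => //; exact: (cinteg_sec1 x).1.
rewrite -integral12_prod_meas1//; apply: eq_integral => x _ /=.
by rewrite fineK//; apply: integrable_fin_num => //; exact: (cinteg_sec1 x).2.
Qed.

Lemma cint_prod21 :
  cint (m1 \x m2)%E F = cint m2 (fun y => cint m1 (fun x => F (x, y))).
Proof.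
have [F1 F2] := cinteg_prod; apply: complexP => /=; congr fine.
  rewrite -integral21_prod_meas1//; apply: eq_integral => x _ /=.
  by rewrite fineK//; apply: integrable_fin_num => //; exact: (cinteg_sec2 x).1.
rewrite -integral21_prod_meas1//; apply: eq_integral => x _ /=.
by rewrite fineK//; apply: integrable_fin_num => //; exact: (cinteg_sec2 x).2.
Qed.

Lemma cFubini : cint m1 (fun x => cint m2 (fun y => F (x, y))) =
  cint m2 (fun y => cint m1 (fun x => F (x, y))).
Proof. by rewrite -cint_prod12 cint_prod21. Qed.

End dominated.

End fubini.

(** * Tensor integrals and the Fourier transform *)

Section tensor_integral.
Context {R : realType}.
Local Notation RR := (measurableTypeR R).
Local Notation mu1 := (@lebesgue_measure R).

Lemma integral_cons n (f : n.+1.-tuple RR -> \bar R) :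
  measurable_fun setT f ->
  (mu1 \x lebesgue_tuple n)%E.-integrable setT (f \o @cons_pair R n) ->
  (\int[lebesgue_tuple n.+1]_t f t =
   \int[mu1 \x lebesgue_tuple n]_z f (cons_pair z))%E.
Proof.
move=> mf fi; have E := integral_pushforward (@measurable_cons_pair R n) mf fi measurableT.
rewrite preimage_setT in E; rewrite -[RHS]E.
(* The two measures are the same set function carrying different structures. *)
apply: eq_measure_integral => [|? ? mA _]; first exact: measurable_cons_pair.
exact: erefl.
Qed.

Lemma integrable_cons n (f : n.+1.-tuple RR -> \bar R) :
  measurable_fun setT f ->
  (mu1 \x lebesgue_tuple n)%E.-integrable setT (f \o @cons_pair R n) ->
  (lebesgue_tuple n.+1).-integrable setT f.
Proof.
move=> mf fi; apply/integrableP; split => //.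
have fi' := integrable_abse fi.
rewrite (@integral_cons n (abse \o f)) //; last exact: measurableT_comp.
by have /integrableP[_] := fi.
Qed.

Lemma cint_cons n (f : n.+1.-tuple RR -> R[i]) :
  cmeas f -> cinteg (mu1 \x lebesgue_tuple n)%E (f \o @cons_pair R n) ->
  cinteg (lebesgue_tuple n.+1) f /\
  cint (lebesgue_tuple n.+1) f = cint (mu1 \x lebesgue_tuple n)%E (f \o @cons_pair R n).
Proof.
move=> [m1 m2] [f1 f2]; split.
  by split; apply: integrable_cons => //; exact/measurable_EFinP.
apply: complexP => /=; congr fine; rewrite integral_cons//; exact/measurable_EFinP.
Qed.

Lemma cmeas_tensor n (f : 'I_n -> RR -> R[i]) : (forall i, cmeas (f i)) ->
  cmeas (fun t : n.-tuple RR => \prod_i f i (tnth t i)).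
Proof.
move=> mf; apply: cmeas_prod => i.
by apply: (@cmeas_comp _ _ _ _ _ (f i) (fun t : n.-tuple RR => tnth t i)) => //; exact: measurable_tnth.
Qed.

(** Induction on the dimension, starting from the Dirac mass at the empty tuple; in the step the
    modulus of the integrand is itself the dominating product. *)
Lemma cint_tensor n (f : 'I_n -> RR -> R[i]) : (forall i, cinteg mu1 (f i)) ->
  cinteg (lebesgue_tuple n) (fun t => \prod_i f i (tnth t i)) /\
  cint (lebesgue_tuple n) (fun t => \prod_i f i (tnth t i)) = \prod_i cint mu1 (f i).
Proof.
elim: n f => [|n IH] f fi.
  rewrite big_ord0.
  have -> : (fun t : 0.-tuple RR => \prod_(i < 0) f i (tnth t i)) = fun=> 1.
    by apply/funext => t; rewrite big_ord0.
  have i1 : (\d_([tuple] : 0.-tuple RR)).-integrable setT (cst 1%:E : _ -> \bar R).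
    apply/integrableP; split; first exact: measurable_cst.
    by rewrite integral_dirac//= diracT mul1e normr1 ltry.
  split; first by split => //; exact: integrable0.
  apply: complexP => /=; rewrite /Rintegral.
    by rewrite (@integral_dirac _ _ _ _ setT measurableT (cst 1%:E))// diracT mul1e.
  by rewrite integral0.
have [Ii Ie] := IH (fun i => f (lift ord0 i)) (fun i => fi _).
have mf i : cmeas (f i) by exact: cinteg_cmeas (fi i).
have mp := cmeas_tensor mf.
pose F (z : RR * n.-tuple RR) := f ord0 z.1 * \prod_(i < n) f (lift ord0 i) (tnth z.2 i).
have EF : (fun t : n.+1.-tuple RR => \prod_i f i (tnth t i)) \o @cons_pair R n = F.
  apply/funext => -[x t] /=; rewrite big_ord_recl /F /=; congr (_ * _).
  by apply: eq_bigr => i _; rewrite (tnth_nth 0) /= -tnth_nth.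
have mF : cmeas F.
  apply: cmeasM; first by apply: (cmeas_comp (f := f ord0)); [exact: measurable_fst|].
  apply: (cmeas_comp (f := fun t : n.-tuple RR => \prod_(i < n) f (lift ord0 i) (tnth t i))).
    exact: measurable_snd.
  by apply: (@cmeas_tensor n (fun i => f (lift ord0 i))) => i; exact: mf.
have dom x (t : n.-tuple RR) : modulus (F (x, t)) <=
   modulus (f ord0 x) * modulus (\prod_(i < n) f (lift ord0 i) (tnth t i)).
  by rewrite modulusM.
have iF := cinteg_prod mF (integrable_modulus (fi ord0)) (integrable_modulus Ii)
  (fun=> modulus_ge0 _) (fun=> modulus_ge0 _) dom.
have [] := cint_cons mp; rewrite EF// => iP ->; split => //.
rewrite (cint_prod12 mF (integrable_modulus (fi ord0)) (integrable_modulus Ii)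
  (fun=> modulus_ge0 _) (fun=> modulus_ge0 _) dom).
rewrite big_ord_recl -Ie -cintMr//; congr cint; apply/funext => x.
by rewrite -cintZ.
Qed.

Lemma cinteg_real (d : measure_display) (T : measurableType d)
    (mu : {measure set T -> \bar R}) (h : T -> R) :
  mu.-integrable setT (EFin \o h) -> cinteg mu (fun x => (h x)%:C).
Proof. by move=> ih; split => //; exact: integrable0. Qed.

Lemma cint_real (d : measure_display) (T : measurableType d)
    (mu : {measure set T -> \bar R}) (h : T -> R) :
  mu.-integrable setT (EFin \o h) -> cint mu (fun x => (h x)%:C) = (Rintegral mu setT h)%:C.
Proof.
move=> ih; apply: complexP => //=; rewrite /Rintegral /= integral0//.
Qed.

Lemma Rintegral_tensor n (h : 'I_n -> RR -> R) :
  (forall i, mu1.-integrable setT (EFin \o h i)) ->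
  (lebesgue_tuple n).-integrable setT (fun t => (\prod_i h i (tnth t i))%:E) /\
  Rintegral (lebesgue_tuple n) setT (fun t => \prod_i h i (tnth t i)) =
    \prod_i Rintegral mu1 setT (h i).
Proof.
move=> ih.
have [] := @cint_tensor n (fun i x => (h i x)%:C) (fun i => cinteg_real (ih i)).
have -> : (fun t : n.-tuple RR => \prod_i (h i (tnth t i))%:C) =
  (fun t => (\prod_i (h i (tnth t i)))%:C).
  by apply/funext => t; rewrite rmorph_prod.
move=> i1; have i2 : (lebesgue_tuple n).-integrable setT (fun t => (\prod_i h i (tnth t i))%:E).
  exact: i1.1.
rewrite cint_real// => E; split => //.
apply: (@complexI R); rewrite E rmorph_prod; apply: eq_bigr => i _.
by rewrite cint_real.
Qed.

End tensor_integral.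

(** * The integrable weight 1 / (1 + x^2) *)

Section weight.
Context {R : realType}.
Local Notation RR := (measurableTypeR R).
Local Notation mu1 := (@lebesgue_measure R).

(** The decay profile of all kernels below: two integrations by parts produce it, bounded
    translations change it by a bounded factor, and its primitive is [atan]. *)
Definition weight (x : R) : R := (oneDsqr x)^-1.

Lemma weight_gt0 x : 0 < weight x.
Proof. by rewrite invr_gt0 (lt_le_trans ltr01)// oneDsqr_ge1. Qed.

Lemma weight_ge0 x : 0 <= weight x. Proof. exact/ltW/weight_gt0. Qed.

Lemma weight_le1 x : weight x <= 1. Proof. exact: oneDsqrV_le1. Qed.

Lemma measurable_weight : measurable_fun setT (weight : RR -> R).
Proof. by apply: continuous_measurable_fun; exact: continuous_oneDsqrV. Qed.

Lemma integral_weight : (\int[mu1]_x (weight x)%:E = pi%:E)%E.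
Proof.
rewrite ge0_symfun_integralT.
- have -> : [set x : R | 0 <= x] = `[0, +oo[%classic.
    by apply/seteqP; split => x /=; rewrite in_itv/= andbT.
  rewrite integral0y_oneDsqr -EFinM; congr EFin.
  by rewrite mulrCA divff ?mulr1.
- exact: weight_ge0.
- exact: continuous_oneDsqrV.
- by move=> x; rewrite /weight /oneDsqr /= sqrrN.
Qed.

Lemma integrable_weight : mu1.-integrable setT (EFin \o weight).
Proof.
apply/integrableP; split.
  by apply/measurable_EFinP; exact: measurable_weight.
rewrite (_ : (fun x => _) = EFin \o weight); first by rewrite integral_weight ltry.
by apply/funext => x /=; rewrite ger0_norm ?weight_ge0.
Qed.

Definition tweight n (t : n.-tuple RR) : R := \prod_i weight (tnth t i).

Lemma tweight_gt0 n (t : n.-tuple RR) : 0 < tweight t.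
Proof. by apply: prodr_gt0 => i _; exact: weight_gt0. Qed.

Lemma integrable_tweight n : (lebesgue_tuple n).-integrable setT (EFin \o @tweight n).
Proof. by have [] := @Rintegral_tensor R n (fun=> weight) (fun=> integrable_weight). Qed.

End weight.

(** * Fourier transforms of integrable functions on R^d *)

Section fourier.
Context {R : realType} {d : nat}.
Local Notation RR := (measurableTypeR R).
Local Notation mu := (@lebesgue_tuple R d).
Implicit Types f g : 'rV[R]_d -> R[i].

Lemma cmeasurableE f : cmeasurable f <-> cmeas (f \o row_of_tuple).
Proof. by []. Qed.

Lemma cintegrableE f : cintegrable f <-> cinteg mu (f \o row_of_tuple).
Proof. by []. Qed.

Lemma cintegralE f : cintegral setT f = cint mu (f \o row_of_tuple).
Proof. by rewrite /cintegral preimage_setT. Qed.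

Lemma dotp_tuple (s t : d.-tuple RR) :
  dotp (row_of_tuple s) (row_of_tuple t) = \sum_i tnth s i * tnth t i.
Proof. by apply: eq_bigr => i _; rewrite !mxE. Qed.

Lemma dotpC (x y : 'rV[R]_d) : dotp x y = dotp y x.
Proof. by apply: eq_bigr => i _; rewrite mulrC. Qed.

Definition unit_const : R[i] := (Num.sqrt (2 * pi) ^- d)%:C.

(** The sign [e] is -1 for the transform and 1 for its inverse, so each property is proved once. *)
Definition gfourier (e : R) f (y : 'rV[R]_d) : R[i] :=
  unit_const * cintegral setT (fun x => cis (e * dotp x y) * f x).

Lemma fourierE f : fourier f = gfourier (-1) f.
Proof.
apply/funext => y; rewrite /fourier /gfourier; congr (_ * cintegral _ _).
by apply/funext => x; rewrite mulN1r.
Qed.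

Lemma inv_fourierE f : inv_fourier f = gfourier 1 f.
Proof.
apply/funext => y; rewrite /inv_fourier /gfourier; congr (_ * cintegral _ _).
by apply/funext => x; rewrite mul1r dotpC.
Qed.

Lemma measurable_dotp : measurable_fun setT
  (fun z : d.-tuple RR * d.-tuple RR => dotp (row_of_tuple z.1) (row_of_tuple z.2)).
Proof.
rewrite (_ : (fun z => _) = fun z : d.-tuple RR * d.-tuple RR => \sum_i tnth z.1 i * tnth z.2 i); last first.
  by apply/funext => -[s t]; rewrite dotp_tuple.
apply: measurable_sum => i; apply: measurable_funM.
  exact: (measurableT_comp (measurable_tnth i)).
exact: (measurableT_comp (measurable_tnth i)).
Qed.

Lemma cmeas_kernel e : cmeas (fun z : d.-tuple RR * d.-tuple RR =>
   cis (e * dotp (row_of_tuple z.1) (row_of_tuple z.2))).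
Proof. by apply: cmeas_cis; apply: measurable_funM => //; exact: measurable_dotp. Qed.

Lemma cmeas_kernel1 e y : cmeas (fun t : d.-tuple RR => cis (e * dotp (row_of_tuple t) (row_of_tuple y))).
Proof. exact: cmeas_sec2 (cmeas_kernel e) y. Qed.

Lemma row_of_tupleK (x : 'rV[R]_d) : row_of_tuple [tuple x 0 i | i < d] = x.
Proof. by apply/rowP => i; rewrite mxE tnth_mktuple. Qed.

Lemma cinteg_kernel e f (y : 'rV[R]_d) : cintegrable f ->
  cintegrable (fun x => cis (e * dotp x y) * f x).
Proof.
move=> fi; apply/cintegrableE.
apply: (@cintegMb _ _ _ _ (f \o row_of_tuple) (fun t => cis (e * dotp (row_of_tuple t) y)) 1) => //.
  by rewrite -(row_of_tupleK y); exact: cmeas_kernel1.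
by move=> t; rewrite modulus_cis.
Qed.

(** The product is a partial integral of the integrable function [F] of two variables, which yields
    measurability and integrability together. *)
Lemma cinteg_mul_gfourier e f g : cintegrable f -> cintegrable g ->
  cintegrable (fun y => f y * gfourier e g y).
Proof.
move=> fi gi; apply/cintegrableE.
pose F (z : d.-tuple RR * d.-tuple RR) :=
  f (row_of_tuple z.1) * (g (row_of_tuple z.2) * (cis (e * dotp (row_of_tuple z.1) (row_of_tuple z.2)))).
have mF : cmeas F.
  apply: cmeasM; first by apply: (cmeas_comp (f := f \o row_of_tuple)); [exact: measurable_fst|exact: cinteg_cmeas fi].
  apply: cmeasM; last exact: cmeas_kernel.
  by apply: (cmeas_comp (f := g \o row_of_tuple)); [exact: measurable_snd|exact: cinteg_cmeas gi].
have dom x y : modulus (F (x, y)) <=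
    modulus ((f \o row_of_tuple) x) * modulus ((g \o row_of_tuple) y).
  by rewrite !modulusM modulus_cis mulr1.
have -> : (fun y => f y * gfourier e g y) \o row_of_tuple =
    fun s : d.-tuple RR => unit_const * cint mu (fun t => F (s, t)).
  apply/funext => s /=; rewrite /gfourier mulrCA; congr (_ * _).
  rewrite cintegralE -cintZ; last exact: cinteg_kernel.
  congr cint; apply/funext => t /=; rewrite /F /=; congr (_ * _).
  by rewrite mulrC dotpC.
apply: cintegZ.
have if1 := integrable_modulus fi; have ig1 := integrable_modulus gi.
have [F1 F2] := cinteg_prod mF if1 ig1 (fun=> modulus_ge0 _) (fun=> modulus_ge0 _) dom.
split.
  have := integrable_fubini_F F1; apply: eq_integrable => // s _ /=.
  rewrite fineK//; apply: integrable_fin_num => //.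
  exact: (cinteg_sec1 mF ig1 dom s).1.
have := integrable_fubini_F F2; apply: eq_integrable => // s _ /=.
rewrite fineK//; apply: integrable_fin_num => //.
exact: (cinteg_sec1 mF ig1 dom s).2.
Qed.

Lemma unit_const_neq0 : unit_const != 0.
Proof.
rewrite /unit_const (_ : 0 = 0%:C)// (inj_eq (@complexI R)).
by rewrite invr_eq0 expf_neq0// gt_eqF// sqrtr_gt0 mulr_gt0 ?pi_gt0.
Qed.

Lemma cinteg_unscale (f : d.-tuple RR -> R[i]) : cinteg mu (fun t => unit_const * f t) -> cinteg mu f.
Proof.
move=> /(cintegZ unit_const^-1).
suff -> : (fun x => unit_const^-1 * (unit_const * f x)) = f by [].
by apply/funext => x; rewrite mulKf ?unit_const_neq0.
Qed.

(** The multiplication formula, by Fubini for [F]. It moves a transform from a test function to the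
    integrable function it is paired with. *)
Lemma gfourier_swap e f g : cintegrable f -> cintegrable g ->
  cintegral setT (fun y => f y * gfourier e g y) =
  cintegral setT (fun y => gfourier e f y * g y).
Proof.
move=> fi gi.
pose F (z : d.-tuple RR * d.-tuple RR) :=
  f (row_of_tuple z.1) * (g (row_of_tuple z.2) * (cis (e * dotp (row_of_tuple z.1) (row_of_tuple z.2)))).
have mF : cmeas F.
  apply: cmeasM; first by apply: (cmeas_comp (f := f \o row_of_tuple)); [exact: measurable_fst|exact: cinteg_cmeas fi].
  apply: cmeasM; last exact: cmeas_kernel.
  by apply: (cmeas_comp (f := g \o row_of_tuple)); [exact: measurable_snd|exact: cinteg_cmeas gi].
have dom x y : modulus (F (x, y)) <=
    modulus ((f \o row_of_tuple) x) * modulus ((g \o row_of_tuple) y).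
  by rewrite !modulusM modulus_cis mulr1.
have E1 : (fun y => f y * gfourier e g y) \o row_of_tuple =
    fun s : d.-tuple RR => unit_const * cint mu (fun t => F (s, t)).
  apply/funext => s /=; rewrite /gfourier mulrCA; congr (_ * _).
  rewrite cintegralE -cintZ; last exact: cinteg_kernel.
  congr cint; apply/funext => t /=; rewrite /F /=; congr (_ * _).
  by rewrite mulrC dotpC.
have E2 : (fun y => gfourier e f y * g y) \o row_of_tuple =
    fun t : d.-tuple RR => unit_const * cint mu (fun s => F (s, t)).
  apply/funext => t /=; rewrite /gfourier -mulrA; congr (_ * _).
  rewrite cintegralE -cintMr; last exact: cinteg_kernel.
  congr cint; apply/funext => s /=; rewrite /F /=.
  by ring.
have if1 := integrable_modulus fi; have ig1 := integrable_modulus gi.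
have I1 : cinteg mu (fun s => cint mu (fun t => F (s, t))).
  by apply: cinteg_unscale; rewrite -E1; exact: cinteg_mul_gfourier.
have I2 : cinteg mu (fun t => cint mu (fun s => F (s, t))).
  apply: cinteg_unscale; rewrite -E2.
  have := cinteg_mul_gfourier e gi fi.
  by under eq_fun do rewrite mulrC.
rewrite !cintegralE E1 E2.
apply: (etrans (cintZ unit_const I1)); apply: (etrans _ (esym (cintZ unit_const I2))).
apply: (congr1 ( *%R unit_const)).
exact: (cFubini mF if1 ig1 (fun=> modulus_ge0 _) (fun=> modulus_ge0 _) dom).
Qed.

End fourier.

(** * Regular tempered distributions and their dyadic blocks *)

Section row_measurable.
Context {R : realType} {d : nat}.
Local Notation RR := (measurableTypeR R).
Local Notation mu := (@lebesgue_tuple R d).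

Lemma row_norm_ge (x : 'rV[R]_d) i : `|x 0 i| <= `|x|.
Proof.
rewrite /Num.Def.normr/= mx_normrE.
exact: (le_bigmax _ (fun ij : 'I_1 * 'I_d => `|x ij.1 ij.2|) (0, i)).
Qed.

(** The sigma-algebra on tuples only knows coordinates, so [U] is written as the countable union of
    the boxes inside it with rational centre and radius 1/(m + 1). *)
Lemma measurable_row_open (U : set 'rV[R]_d) : open U ->
  measurable (row_of_tuple @^-1` U : set (d.-tuple RR)).
Proof.
move=> oU.
pose box (z : 'rV[rat]_d * nat) : set 'rV[R]_d :=
  [set x | forall i, `|x 0 i - ratr (z.1 0 i)| < z.2.+1%:R^-1].
pose F (z : 'rV[rat]_d * nat) : set (d.-tuple RR) :=
  if pselect (box z `<=` U) then row_of_tuple @^-1` (box z) else set0.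
have -> : row_of_tuple @^-1` U = \bigcup_z F z.
  apply/seteqP; split => [t Ut|t [z _]]; last first.
    by rewrite /F; case: pselect => // zU; exact: zU.
  have := oU; rewrite openE => /(_ _ Ut) /nbhs_ballP [e /= e0 eU].
  (* The point and the box are both within 1/(m + 1) of a rational centre, so the box stays within
     distance e of the point. *)
  have [m m1] : exists m : nat, m.+1%:R^-1 < e / 2.
    have e20 : 0 < e / 2 by rewrite divr_gt0.
    exists (Num.bound (e / 2)^-1); rewrite invf_plt ?posrE//.
    rewrite (lt_le_trans (archi_boundP _))// ?ler_nat//.
    by rewrite ltW// invr_gt0.
  have m0 : 0 < m.+1%:R^-1 :> R by rewrite invr_gt0.
  have /choice[q qP] : forall i : 'I_d, exists q : rat, `|tnth t i - ratr q| < m.+1%:R^-1 :> R.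
    move=> i; have [|q] := @rat_in_itvoo R (tnth t i - m.+1%:R^-1) (tnth t i + m.+1%:R^-1).
      by rewrite ltrD2l (lt_trans _ m0)// oppr_lt0.
    by rewrite in_itv/= => q12; exists q; rewrite distrC ltr_distl.
  have zU : box (\row_i q i, m) `<=` U.
    move=> x xb; apply: eU; split=> [|k i]; [exact: e0|rewrite ord1 !mxE /ball/=].
    have := xb i; have := qP i; rewrite /= !mxE.
    move: m1; move: (m.+1%:R^-1) => w; move: (ratr _ : R) (x 0 i) (tnth t i : R) => u v y.
    rewrite !ltr_norml => ? /andP[? ?] /andP[? ?]; apply/andP; split; lra.
  exists (\row_i q i, m) => //; rewrite /F.
  by case: (pselect (box (\row_i q i, m) `<=` U)) => // ? i /=; rewrite !mxE.
apply: countable_bigcupT_measurable; first exact: countableP.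
move=> z; have [->|->] : F z = row_of_tuple @^-1` box z \/ F z = set0.
- by rewrite /F; case: (pselect (box z `<=` U)) => ? /=; [left|right].
- have -> : row_of_tuple @^-1` box z = \bigcap_(i in [set: 'I_d])
      ((fun t : d.-tuple RR => tnth t i) @^-1` [set x : R | `|x - ratr (z.1 0 i)| < z.2.+1%:R^-1]).
    apply/seteqP; split=> t; first by move=> tb i _; have := tb i; rewrite mxE.
    by move=> tb i; rewrite mxE; exact: tb.
  apply: fin_bigcap_measurable => // i _.
  rewrite -[X in measurable X]setTI; apply: measurable_tnth => //.
  have -> : [set x : R | `|x - ratr (z.1 0 i)| < z.2.+1%:R^-1] = ball (ratr (z.1 0 i) : R) z.2.+1%:R^-1.
    by apply/seteqP; split=> x /=; rewrite /ball/= distrC.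
  exact: measurable_ball.
- exact: measurable0.
Qed.

Lemma measurable_row_continuous (f : 'rV[R]_d -> R) : continuous f ->
  measurable_fun setT (f \o row_of_tuple : d.-tuple RR -> R).
Proof.
move=> /continuousP cf; apply: (measurability _ (RGenOpens.measurableE R)).
move=> _ [_ [a [b ->] <-]]; rewrite setTI comp_preimage.
by apply: measurable_row_open; apply: cf; exact: interval_open.
Qed.

End row_measurable.

Section schwartz_functions.
Context {R : realType} {d : nat}.
Local Notation RR := (measurableTypeR R).
Local Notation mu := (@lebesgue_tuple R d).
Implicit Types f g : 'rV[R]_d -> R[i].

Lemma schwartz_cmeas f : schwartz f -> cmeas (f \o row_of_tuple : d.-tuple RR -> R[i]).
Proof.
move=> [/(_ [::]) [c1 c2 _] _]; split.
  exact: (measurable_row_continuous c1).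
exact: (measurable_row_continuous c2).
Qed.

Lemma schwartz_norm_ge N f x :
  (((1 + `|x|) ^+ N * modulus (f x))%:E <= schwartz_norm N f)%E.
Proof. by apply: ereal_sup_ubound; exists ([::], x). Qed.

Lemma schwartz_bound N f : schwartz f ->
  exists M, forall x, (1 + `|x|) ^+ N * modulus (f x) <= M.
Proof.
move=> [_ /(_ N)]; case E : schwartz_norm => [M||] //= _.
  by exists M => x; rewrite -lee_fin -E; exact: schwartz_norm_ge.
by exists 0 => x; have := schwartz_norm_ge N f x; rewrite E.
Qed.

Lemma schwartz_bounded f : schwartz f -> exists M, forall x, modulus (f x) <= M.
Proof.
by move=> /(schwartz_bound 0) [M fM]; exists M => x; have := fM x; rewrite expr0 mul1r.
Qed.

(** Each factor 1 + t_i^2 is at most (1 + |t|)^2. Hence the Schwartz norm of order 2d dominates a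
    function by an integrable one. *)
Lemma tweight_ge (t : d.-tuple RR) :
  1 <= (1 + `|row_of_tuple t|) ^+ (2 * d) * tweight t.
Proof.
have tw : tweight t = (\prod_(i < d) oneDsqr (tnth t i))^-1.
  by rewrite /tweight -prodfV.
rewrite tw ler_pdivlMr ?mul1r; last first.
  by apply: prodr_gt0 => i _; rewrite (lt_le_trans ltr01)// oneDsqr_ge1.
have := row_norm_ge (row_of_tuple t); move: `|row_of_tuple t| => N hN.
rewrite exprM -[leRHS](_ : \prod_(i < d) (1 + N) ^+ 2 = _); last by rewrite prodr_const card_ord.
apply: ler_prod => i _; have := hN i; rewrite mxE => h.
have h1 := normr_ge0 (tnth t i); have := real_normK (num_real (tnth t i)).
rewrite /oneDsqr => <-; apply/andP; split; nra.
Qed.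

Lemma schwartz_cintegrable f : schwartz f -> cintegrable f.
Proof.
move=> fs; have [M fM] := schwartz_bound (2 * d) fs.
apply: (@cinteg_dom _ _ _ _ _ (fun t : d.-tuple RR => M * tweight t)).
- exact: schwartz_cmeas.
- exact: (integrableZl measurableT M (integrable_tweight d)).
- move=> t /=; apply: (@le_trans _ _ ((1 + `|row_of_tuple t|) ^+ (2 * d) * tweight t * modulus (f (row_of_tuple t)))).
    by rewrite ler_peMl ?modulus_ge0// tweight_ge.
  by rewrite mulrAC ler_wpM2r// ltW// tweight_gt0.
Qed.

End schwartz_functions.

Section fourier_more.
Context {R : realType} {d : nat}.
Local Notation RR := (measurableTypeR R).
Local Notation mu := (@lebesgue_tuple R d).
Implicit Types f g : 'rV[R]_d -> R[i].

(** The product with the positive integrable [tweight] is integrable by [cinteg_mul_gfourier], hence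
    measurable; the weight is then divided out. *)
Lemma cmeas_gfourier e f : cintegrable f -> cmeas (gfourier e f \o row_of_tuple : d.-tuple RR -> R[i]).
Proof.
move=> fi.
pose W (x : 'rV[R]_d) : R[i] := (tweight [tuple x 0 i | i < d] : R)%:C.
have WE (t : d.-tuple RR) : W (row_of_tuple t) = (tweight t)%:C.
  rewrite /W; congr (tweight _)%:C; apply: eq_from_tnth => i.
  by rewrite tnth_mktuple mxE.
have iW : cintegrable W.
  apply/cintegrableE; rewrite (_ : W \o _ = fun t => (tweight t)%:C); last by apply/funext.
  by apply: cinteg_real; exact: integrable_tweight.
have /cinteg_cmeas mWf := cinteg_mul_gfourier e iW fi.
have mV : cmeas (fun t : d.-tuple RR => ((tweight t)^-1)%:C).
  apply: cmeas_real; rewrite (_ : (fun t => _) = fun t : d.-tuple RR => \prod_(i < d) oneDsqr (tnth t i)).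
    apply: measurable_prod => i _; apply: (measurableT_comp (f := oneDsqr)).
      by apply: continuous_measurable_fun; exact: continuous_oneDsqr.
    exact: measurable_tnth.
  by apply/funext => t; rewrite /tweight -prodfV; apply: eq_bigr => i _; rewrite /weight/= invrK.
have := cmeasM mV mWf; rewrite (_ : (fun x => _) = gfourier e f \o row_of_tuple) //.
apply/funext => t /=; rewrite WE mulrA -rmorphM/= mulVf ?mul1r//.
by rewrite gt_eqF// tweight_gt0.
Qed.

Lemma gfourierD e f g : cintegrable f -> cintegrable g ->
  gfourier e (fun x => f x + g x) = fun y => gfourier e f y + gfourier e g y.
Proof.
move=> fi gi; apply/funext => y; rewrite /gfourier -mulrDr; congr (_ * _).
rewrite !cintegralE -cintD; [|exact: cinteg_kernel..].
by congr cint; apply/funext => t /=; rewrite mulrDr.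
Qed.

Lemma gfourierZ e z f : cintegrable f ->
  gfourier e (fun x => z * f x) = fun y => z * gfourier e f y.
Proof.
move=> fi; apply/funext => y; rewrite /gfourier mulrCA; congr (_ * _).
rewrite !cintegralE -cintZ; last exact: cinteg_kernel.
by congr cint; apply/funext => t /=; rewrite mulrCA.
Qed.

Lemma gfourier_sum e (I : Type) (s : seq I) (F : I -> 'rV[R]_d -> R[i]) :
  (forall i, cintegrable (F i)) ->
  gfourier e (fun x => \sum_(i <- s) F i x) = fun y => \sum_(i <- s) gfourier e (F i) y.
Proof.
move=> fi; apply/funext => y; rewrite /gfourier -mulr_sumr; congr (_ * _).
rewrite !cintegralE (eq_bigr (fun i => cint mu ((fun x => cis (e * dotp x y) * F i x) \o row_of_tuple))); last first.
  by move=> i _; rewrite cintegralE.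
rewrite -(cint_sum s); last by move=> i; exact: cinteg_kernel.
by congr cint; apply/funext => t /=; rewrite mulr_sumr.
Qed.

End fourier_more.

(** * Fourier transforms of tensor products *)

Section fourier_tensor.
Context {R : realType}.
Local Notation RR := (measurableTypeR R).
Local Notation mu1 := (@lebesgue_measure R).

Definition fourier1 (e : R) (f : RR -> R[i]) (y : R) : R[i] :=
  ((Num.sqrt (2 * pi))^-1)%:C * cint mu1 (fun x => cis (e * (x * y)) * f x).

Lemma cinteg_kernel1 e (f : RR -> R[i]) y : cinteg mu1 f ->
  cinteg mu1 (fun x => cis (e * (x * y)) * f x).
Proof.
move=> fi; apply: (@cintegMb _ _ _ _ f (fun x => cis (e * (x * y))) 1) => //.
  by apply: cmeas_cis; apply: measurable_funM => //; apply: measurable_funM.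
by move=> t; rewrite modulus_cis.
Qed.

Definition tensor d (f : 'I_d -> RR -> R[i]) (x : 'rV[R]_d) : R[i] := \prod_i f i (x 0 i).

Lemma tensor_row d (f : 'I_d -> RR -> R[i]) :
  tensor f \o row_of_tuple = fun t : d.-tuple RR => \prod_i f i (tnth t i).
Proof. by apply/funext => t; apply: eq_bigr => i _; rewrite mxE. Qed.

Lemma cintegrable_tensor d (f : 'I_d -> RR -> R[i]) :
  (forall i, cinteg mu1 (f i)) -> cintegrable (tensor f).
Proof. by move=> fi; apply/cintegrableE; rewrite tensor_row; exact: (cint_tensor fi).1. Qed.

Lemma gfourier_tensor d e (f : 'I_d -> RR -> R[i]) : (forall i, cinteg mu1 (f i)) ->
  gfourier e (tensor f) = tensor (fun i => fourier1 e (f i)).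
Proof.
move=> fi; apply/funext => y; rewrite /gfourier /tensor /fourier1 big_split/=.
congr (_ * _).
  by rewrite prodr_const card_ord /unit_const -rmorphXn/= exprVn.
have [_ <-] := cint_tensor (fun i => cinteg_kernel1 e (y 0 i) (fi i)).
rewrite cintegralE; congr cint; apply/funext => t /=.
rewrite big_split/= -cis_sum; congr (cis _ * _).
  by rewrite mulr_sumr; apply: eq_bigr => i _; rewrite mxE.
by apply: eq_bigr => i _; rewrite mxE.
Qed.

End fourier_tensor.

Section regular_distributions.
Context {R : realType} {d : nat}.
Local Notation RR := (measurableTypeR R).
Local Notation mu := (@lebesgue_tuple R d).
Implicit Types f g G : 'rV[R]_d -> R[i].

Definition regular G : ('rV[R]_d -> R[i]) -> R[i] :=
  fun f => cintegral setT (fun x => G x * f x).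

Lemma cintegrable_mul_schwartz G f : cintegrable G -> schwartz f ->
  cintegrable (fun x => G x * f x).
Proof.
move=> iG fs; have [M fM] := schwartz_bounded fs.
have := @cintegMb _ _ _ _ (G \o row_of_tuple) (f \o row_of_tuple) M (schwartz_cmeas fs) (fun t => fM _) iG.
by under eq_fun do rewrite mulrC.
Qed.

Lemma tempered_regular G : cintegrable G -> tempered (regular G).
Proof.
move=> iG; split.
  move=> a f g fs gs; rewrite /regular !cintegralE.
  have if1 := cintegrable_mul_schwartz iG fs; have ig1 := cintegrable_mul_schwartz iG gs.
  rewrite -cintZ// -cintD//; last exact: cintegZ.
  by congr cint; apply/funext => t /=; rewrite mulrDr mulrCA.
(* The Schwartz norm of order 0 is the sup norm, and [G] is integrable. *)
exists 0%N, (2 * Rintegral mu setT (modulus \o (G \o row_of_tuple))) => f fs.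
have [_ /(_ 0%N)] := fs; case E : schwartz_norm => [M||] // _; last first.
  by have := schwartz_norm_ge 0 f 0; rewrite E.
rewrite lee_fin -mulrA [X in 2 * X]mulrC /regular cintegralE.
rewrite -RintegralZl; [|by []|exact: integrable_modulus iG].
apply: modulus_cint_le.
- exact: (integrableZl measurableT M (integrable_modulus iG)).
- exact: cinteg_cmeas (cintegrable_mul_schwartz iG fs).
- move=> t /=; rewrite modulusM mulrC ler_wpM2r ?modulus_ge0//.
  by rewrite -lee_fin -E -[modulus _]mul1r -(expr0 (1 + `|row_of_tuple t|)) schwartz_norm_ge.
Qed.

(** Two applications of [gfourier_swap] carry both transforms from the test function over to [G]. *)
Lemma dyadic_block_regular phi0 (k : {ffun 'I_d -> nat}) G :
  cintegrable (dyadic_tensor phi0 k) -> cintegrable G ->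
  represents (inv_fourier (fun x => dyadic_tensor phi0 k x * fourier G x))
    (dyadic_block phi0 k (regular G)).
Proof.
move=> ik iG; rewrite inv_fourierE fourierE.
have i1 := cinteg_mul_gfourier (-1) ik iG.
split; first exact: cmeas_gfourier.
move=> f fs; have fi := schwartz_cintegrable fs; split.
  have := cinteg_mul_gfourier 1 fi i1.
  by under eq_fun do rewrite mulrC.
rewrite /dyadic_block /dinv_fourier /dmul /dfourier /regular fourierE inv_fourierE.
rewrite gfourier_swap//; last exact: cinteg_mul_gfourier.
rewrite -(gfourier_swap 1 i1 fi); congr (cintegral setT _); apply/funext => x.
by rewrite mulrCA mulrA.
Qed.

End regular_distributions.

(** * Decay of oscillatory integrals *)

Section derivatives.
Context {R : realType}.
Implicit Types (f g : R -> R) (a b c x t : R).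

Lemma der_mul f g x a b : is_derive x 1 f a -> is_derive x 1 g b ->
  is_derive x 1 (fun y => f y * g y) (a * g x + f x * b).
Proof.
move=> fa gb; have h := is_deriveM fa gb.
by apply: is_derive_eq h _; rewrite /GRing.scale/= addrC mulrC.
Qed.

Lemma der_sub f g x a b : is_derive x 1 f a -> is_derive x 1 g b ->
  is_derive x 1 (fun y => f y - g y) (a - b).
Proof. by move=> fa gb; exact: is_deriveB. Qed.

Lemma der_add f g x a b : is_derive x 1 f a -> is_derive x 1 g b ->
  is_derive x 1 (fun y => f y + g y) (a + b).
Proof. by move=> fa gb; exact: is_deriveD. Qed.

Lemma der_lin x c e : is_derive x 1 (fun y : R => c * y + e) c.
Proof.
have h := der_add (der_mul (is_derive_cst c x 1) (is_derive_id x 1)) (is_derive_cst e x 1).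
by apply: is_derive_eq h _; rewrite mul0r add0r mulr1 addr0.
Qed.

Lemma der_scale f x c a : is_derive (c * x) 1 f a ->
  is_derive x 1 (fun y => f (c * y)) (c * a).
Proof.
move=> fa; have h := der_lin x c 0; rewrite -[c * x]addr0 in fa.
have := @is_derive1_comp R f (fun y => c * y + 0) x a c fa h.
rewrite mulrC (_ : _ \o _ = fun y => f (c * y))//.
by apply/funext => y /=; rewrite addr0.
Qed.

Lemma der_cos_lin x t e : is_derive x 1 (fun y => cos (t * y + e)) (- t * sin (t * x + e)).
Proof.
have := @is_derive1_comp R cos (fun y => t * y + e) x _ t (is_derive_cos _) (der_lin x t e).
by rewrite (mulrC _ t) mulrN mulNr.
Qed.

Lemma der_sin_lin x t e : is_derive x 1 (fun y => sin (t * y + e)) (t * cos (t * x + e)).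
Proof. 
have := @is_derive1_comp R sin (fun y => t * y + e) x _ t (is_derive_sin _) (der_lin x t e).
by rewrite mulrC.
Qed.

Lemma der_inv x : x != 0 -> is_derive x 1 (fun y : R => y^-1) (- x ^- 2).
Proof.
move=> x0; have h := is_deriveV x0 (is_derive_id x 1).
by apply: is_derive_eq h _; rewrite /GRing.scale/= mulr1.
Qed.

Lemma der_continuous f x a : is_derive x 1 f a -> {for x, continuous f}.
Proof.
by move=> [fd _]; apply: differentiable_continuous; exact/derivable1_diffP.
Qed.

(** Derivatives are two-sided at the end points as well, the functions being defined on the whole
    line. *)
Definition C2on a b f f1 f2 : Prop := forall x, a <= x <= b ->
  [/\ is_derive x 1 f (f1 x), is_derive x 1 f1 (f2 x) & {for x, continuous f2}].

Lemma C2on_sub a b f f1 f2 g g1 g2 : C2on a b f f1 f2 -> C2on a b g g1 g2 ->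
  C2on a b (fun x => f x - g x) (fun x => f1 x - g1 x) (fun x => f2 x - g2 x).
Proof.
move=> fC gC x xab; have [a1 a2 a3] := fC x xab; have [b1 b2 b3] := gC x xab.
by split; [exact: der_sub|exact: der_sub|exact: continuousB].
Qed.

Lemma C2on_mul a b f f1 f2 g g1 g2 : C2on a b f f1 f2 -> C2on a b g g1 g2 ->
  C2on a b (fun x => f x * g x) (fun x => f1 x * g x + f x * g1 x)
    (fun x => f2 x * g x + f1 x * g1 x + (f1 x * g1 x + f x * g2 x)).
Proof.
move=> fC gC x xab; have [a1 a2 a3] := fC x xab; have [b1 b2 b3] := gC x xab.
have c1 := der_continuous a1; have c2 := der_continuous a2.
have e1 := der_continuous b1; have e2 := der_continuous b2.
split; first exact: der_mul.
  by apply: der_add; exact: der_mul.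
by apply: continuousD; apply: continuousD; exact: continuousM.
Qed.

Lemma C2on_scale a b c f f1 f2 : 0 < c -> C2on (c * a) (c * b) f f1 f2 ->
  C2on a b (fun x => f (c * x)) (fun x => c * f1 (c * x)) (fun x => c ^+ 2 * f2 (c * x)).
Proof.
move=> c0 fC x /andP[ax xb].
have [|a1 a2 a3] := fC (c * x); first by rewrite !ler_pM2l// ax xb.
split; first exact: der_scale.
  have h := der_mul (is_derive_cst c x 1) (der_scale a2).
  by apply: is_derive_eq h _; rewrite mul0r add0r mulrA -expr2.
apply: continuousM; first exact: cvg_cst.
apply: (@continuous_comp _ _ _ ( *%R c) f2) => //.
exact: mulrl_continuous.
Qed.

Lemma C2on_inv a b : 0 < a \/ b < 0 ->
  C2on a b (fun x => x^-1) (fun x => - x ^- 2) (fun x => 2 * x ^- 3).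
Proof.
move=> ab x /andP[ax xb]; have x0 : x != 0.
  by case: ab => [a0|b0]; [rewrite gt_eqF// (lt_le_trans a0)|rewrite lt_eqF// (le_lt_trans xb)].
split; first exact: der_inv.
  have h := der_sub (is_derive_cst 0 x 1) (der_mul (der_inv x0) (der_inv x0)).
  have : is_derive x 1 (fun y : R => 0 - y^-1 * y^-1) (2 * x ^- 3).
    by apply: is_derive_eq h _; field.
  by under eq_fun do rewrite sub0r -expr2 exprVn.
apply: continuousM; first exact: cvg_cst.
apply: (@continuousV _ _ (fun y : R => y ^+ 3)); first by rewrite expf_neq0.
exact: exprn_continuous.
Qed.

Lemma continuous_itv_bounded a b f : a <= b -> (forall x, a <= x <= b -> {for x, continuous f}) ->
  exists M : R, 0 <= M /\ forall x, a <= x <= b -> `|f x| <= M.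
Proof.
move=> ab cf.
have [|c _ cP] := @EVT_max R (fun x => `|f x|) a b ab.
  apply: continuous_in_subspaceT => x; rewrite inE/= in_itv/= => xab.
  apply: (@continuous_comp _ _ _ f Num.norm); first exact: cf.
  exact: norm_continuous.
by exists `|f c|; split => // x xab; apply: cP; rewrite in_itv.
Qed.

End derivatives.

(** * Oscillatory integrals over an interval *)

Section oscillatory.
Context {R : realType}.
Local Notation mu1 := (@lebesgue_measure R).
Implicit Types (f g : R -> R) (a b c x t : R).

(** The phase lets one integral serve the cosine, with [e = 0], and the sine, with
    [e = - (pi / 2)]. *)
Definition osc a b f t e : R := \int[mu1]_(x in `[a, b]) (f x * cos (t * x + e)).

Lemma integrable_itv_continuous a b f : (forall x, a <= x <= b -> {for x, continuous f}) ->
  mu1.-integrable `[a, b] (EFin \o f).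
Proof.
move=> cf; apply: continuous_compact_integrable; first exact: segment_compact.
by apply: continuous_in_subspaceT => x; rewrite inE/= in_itv/=; exact: cf.
Qed.

Lemma cos_lin_continuous t e x : {for x, continuous (fun x : R => cos (t * x + e))}.
Proof. by exact: der_continuous (der_cos_lin x t e). Qed.

Lemma Rintegral_itv_le a b f M : a <= b -> (forall x, a <= x <= b -> {for x, continuous f}) ->
  (forall x, a <= x <= b -> `|f x| <= M) -> `|\int[mu1]_(x in `[a, b]) f x| <= M * (b - a).
Proof.
move=> ab cf fM; have fi := integrable_itv_continuous cf.
apply: (le_trans (le_normr_Rintegral _ fi)) => //.
have -> : M * (b - a) = \int[mu1]_(x in `[a, b]) (cst M x).
  rewrite Rintegral_cst//= lebesgue_measure_itv/= lte_fin.
  by case: ltgtP ab => [_ _|//|-> _] //=; rewrite subrr.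
apply: le_Rintegral => //.
- exact: integrable_norm fi.
- by apply: integrable_itv_continuous => x _; exact: cvg_cst.
Qed.

Lemma osc_bound a b f M t e : a <= b -> (forall x, a <= x <= b -> {for x, continuous f}) ->
  (forall x, a <= x <= b -> `|f x| <= M) -> `|osc a b f t e| <= M * (b - a).
Proof.
move=> ab cf fM; apply: Rintegral_itv_le => //.
  move=> x xab; apply: continuousM; [exact: cf|exact: cos_lin_continuous].
move=> x xab; rewrite normrM -[M]mulr1 ler_pM// ?fM//.
exact: cos_max.
Qed.

(* With [F x = f' x * cos (t x + e) + t * f x * sin (t x + e)] one has
   [F' x = (f'' x + t ^ 2 f x) * cos (t x + e)]. *)
Lemma osc_decay a b f f1 f2 M t e : a < b -> C2on a b f f1 f2 ->
  f a = 0 -> f b = 0 -> f1 a = 0 -> f1 b = 0 ->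
  (forall x, a <= x <= b -> `|f2 x| <= M) -> t ^+ 2 * `|osc a b f t e| <= M * (b - a).
Proof.
move=> ab fC fa fb f1a f1b fM.
pose F x := f1 x * cos (t * x + e) + t * (f x * sin (t * x + e)).
have cf x : a <= x <= b -> {for x, continuous f} by move=> /fC[/der_continuous].
have cf2 x : a <= x <= b -> {for x, continuous f2} by move=> /fC[].
have dF x : a <= x <= b -> is_derive x 1 F ((f2 x + t ^+ 2 * f x) * cos (t * x + e)).
  move=> xab; have [d1 d2 _] := fC x xab.
  have h := der_add (der_mul d2 (der_cos_lin x t e))
    (der_mul (is_derive_cst t x 1) (der_mul d1 (der_sin_lin x t e))).
  by apply: is_derive_eq h _ => /=; ring.
have ccos := @cos_lin_continuous t e.
have cg x : a <= x <= b -> {for x, continuous (fun x : R => (f2 x + t ^+ 2 * f x) * cos (t * x + e))}.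
  move=> xab; apply: continuousM; last exact: ccos.
  apply: continuousD; first exact: cf2.
  by apply: continuousM; [exact: cvg_cst|exact: cf].
have E : \int[mu1]_(x in `[a, b]) ((f2 x + t ^+ 2 * f x) * cos (t * x + e)) = 0.
  rewrite /Rintegral (@continuous_FTC2 _ _ F)//.
  - by rewrite /F fa fb f1a f1b !(mul0r, mulr0, addr0) subee.
  - apply: continuous_in_subspaceT => x; rewrite inE/= in_itv/= => xab.
    exact: cg.
  - split.
    + move=> x; rewrite in_itv/= => /andP[ax xb].
      by have [] := dF x; [rewrite !ltW|].
    + apply: cvg_at_right_filter; apply: der_continuous (dF a _).
      by rewrite lexx ltW.
    + apply: cvg_at_left_filter; apply: der_continuous (dF b _).
      by rewrite lexx ltW.
  - move=> x; rewrite in_itv/= => /andP[ax xb]; rewrite derive1E.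
    by apply: derive_val; apply: dF; rewrite !ltW.
have c1 x : a <= x <= b -> {for x, continuous (fun x => f2 x * cos (t * x + e))}.
  by move=> xab; apply: continuousM; [exact: cf2|exact: ccos].
have c2 x : a <= x <= b -> {for x, continuous (fun x => f x * cos (t * x + e))}.
  by move=> xab; apply: continuousM; [exact: cf|exact: ccos].
have i1 := integrable_itv_continuous c1; have i2 := integrable_itv_continuous c2.
have : t ^+ 2 * osc a b f t e = - \int[mu1]_(x in `[a, b]) (f2 x * cos (t * x + e)).
  apply/eqP; rewrite -addr_eq0 /osc -RintegralZl// addrC -RintegralD//; last first.
    exact: (integrableZl _ _ i2).
  by rewrite -[X in _ == X]E; apply/eqP; apply: eq_Rintegral => x _ /=; ring.
move=> h; rewrite -[t ^+ 2]ger0_norm ?sqr_ge0// -normrM h normrN.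
apply: Rintegral_itv_le => //; first exact: ltW.
move=> x xab; rewrite normrM -[M]mulr1 ler_pM// ?fM//; exact: cos_max.
Qed.

(** Adding [osc_bound] to l^2 times [osc_decay] controls (1 + (l t)^2) |osc|, which is exactly the
    decay of [weight], with a constant independent of the dilation. *)
Lemma osc_weight a b f f1 f2 : a < b -> C2on a b f f1 f2 ->
  f a = 0 -> f b = 0 -> f1 a = 0 -> f1 b = 0 ->
  exists C : R, 0 <= C /\ forall l t e : R, 0 < l ->
    `|osc (l * a) (l * b) (fun x => f (l^-1 * x)) t e| <= C * l * weight (l * t).
Proof.
move=> ab fC fa fb f1a f1b.
have [M0 [M00 fM0]] : exists M : R, 0 <= M /\ forall x, a <= x <= b -> `|f x| <= M.
  by apply: continuous_itv_bounded (ltW ab) _ => x /fC[/der_continuous].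
have [M2 [M20 fM2]] : exists M : R, 0 <= M /\ forall x, a <= x <= b -> `|f2 x| <= M.
  by apply: continuous_itv_bounded (ltW ab) _ => x /fC[].
exists ((M0 + M2) * (b - a)); split.
  by apply: mulr_ge0; [exact: addr_ge0|rewrite subr_ge0 ltW].
move=> l t e l0; have l1 : l^-1 * l = 1 by rewrite mulVf ?gt_eqF.
have lV0 : 0 < l^-1 by rewrite invr_gt0.
have sC : C2on (l * a) (l * b) (fun x => f (l^-1 * x)) (fun x => l^-1 * f1 (l^-1 * x))
    (fun x => l^-1 ^+ 2 * f2 (l^-1 * x)).
  by apply: C2on_scale => //; rewrite !mulrA l1 !mul1r.
have lab : l * a < l * b by rewrite ltr_pM2l.
have inab x : l * a <= x <= l * b -> a <= l^-1 * x <= b.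
  by rewrite -(ler_pM2l l0 a) -(ler_pM2l l0 _ b) mulrA mulfV ?gt_eqF// mul1r.
have B0 : `|osc (l * a) (l * b) (fun x => f (l^-1 * x)) t e| <= M0 * (l * b - l * a).
  apply: osc_bound (ltW lab) _ _ => x xab; first by have [/der_continuous] := sC x xab.
  exact/fM0/inab.
have B2 : t ^+ 2 * `|osc (l * a) (l * b) (fun x => f (l^-1 * x)) t e| <= l^-1 ^+ 2 * M2 * (l * b - l * a).
  apply: (@osc_decay _ _ _ _ _ _ t e lab sC); rewrite ?mulrA ?l1 ?mul1r ?fa ?fb ?f1a ?f1b ?mulr0//.
  move=> x xab; have l20 : 0 <= l^-1 ^+ 2 by rewrite exprn_ge0// ltW.
  by rewrite normrM (ger0_norm l20) ler_wpM2l//; exact/fM2/inab.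
rewrite /weight ler_pdivlMr; last by rewrite (lt_le_trans ltr01)// oneDsqr_ge1.
rewrite /oneDsqr mulrDr mulr1 exprMn.
(* The dilated interval contributes a factor l, and l^2 cancels the l^-2 of the second
   derivative. *)
have -> : (M0 + M2) * (b - a) * l = M0 * (l * b - l * a) + l ^+ 2 * (l^-1 ^+ 2 * M2 * (l * b - l * a)).
  by field; rewrite gt_eqF.
have l20 : 0 <= l ^+ 2 by rewrite exprn_ge0// ltW.
by rewrite lerD// mulrCA ler_wpM2l// mulrC.
Qed.

End oscillatory.

(** * Cutoffs and dyadic annuli *)

Section complex_oscillatory.
Context {R : realType}.
Local Notation mu1 := (@lebesgue_measure R).
Local Notation RR := (measurableTypeR R).
Implicit Types (a b c x t : R) (f g : R -> R[i]).

Definition cut_itv a b f : RR -> R[i] := fun x : R => if a <= x <= b then f x else 0.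

Lemma Re_cut_itv a b f : cRe \o cut_itv a b f = (cRe \o f) \_ `[a, b].
Proof.
apply/funext => x; rewrite patchE /cut_itv/= mem_setE in_itv/=.
by case: ifP.
Qed.

Lemma Im_cut_itv a b f : cIm \o cut_itv a b f = (cIm \o f) \_ `[a, b].
Proof.
apply/funext => x; rewrite patchE /cut_itv/= mem_setE in_itv/=.
by case: ifP.
Qed.

Lemma cinteg_cut_itv a b f :
  (forall x, a <= x <= b -> {for x, continuous (cRe \o f)}) ->
  (forall x, a <= x <= b -> {for x, continuous (cIm \o f)}) ->
  cinteg mu1 (cut_itv a b f).
Proof.
move=> f1 f2; split.
  rewrite Re_cut_itv -restrict_EFin -integrable_mkcond//.
  exact: integrable_itv_continuous.
rewrite Im_cut_itv -restrict_EFin -integrable_mkcond//.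
exact: integrable_itv_continuous.
Qed.

Lemma cint_cut_itv a b f : cint mu1 (cut_itv a b f) =
  (\int[mu1]_(x in `[a, b]) cRe (f x)) +i* (\int[mu1]_(x in `[a, b]) cIm (f x)).
Proof. by apply: complexP => /=; rewrite ?Re_cut_itv ?Im_cut_itv -Rintegral_mkcond. Qed.

(** Vanishing of [f] and its derivative at both ends removes the boundary terms of two integrations
    by parts. *)
Definition good a b (f : R -> R) : Prop := exists f1 f2 : R -> R,
  [/\ C2on a b f f1 f2, f a = 0, f b = 0, f1 a = 0 & f1 b = 0].

Lemma good_continuous a b (f : R -> R) x : good a b f -> a <= x <= b -> {for x, continuous f}.
Proof. by move=> [f1 [f2 [fC _ _ _ _]]] /fC[/der_continuous]. Qed.

Definition cgood a b f := good a b (cRe \o f) /\ good a b (cIm \o f).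

Lemma cint_osc a b f : a < b -> cgood a b f -> exists C : R, 0 <= C /\
  forall l t : R, 0 < l ->
   cinteg mu1 (cut_itv (l * a) (l * b) (fun x => cis (t * x) * f (l^-1 * x))) /\
   modulus (cint mu1 (cut_itv (l * a) (l * b) (fun x => cis (t * x) * f (l^-1 * x))))
     <= C * l * weight (l * t).
Proof.
move=> ab [g1 g2].
have [u1 [u2 [uC ua ub u1a u1b]]] := g1; have [v1 [v2 [vC va vb v1a v1b]]] := g2.
have [Cu [Cu0 uP]] := osc_weight ab uC ua ub u1a u1b.
have [Cv [Cv0 vP]] := osc_weight ab vC va vb v1a v1b.
exists (Cu + Cv + (Cu + Cv)); split; first by rewrite !addr_ge0.
move=> l t l0; have lV0 : 0 < l^-1 by rewrite invr_gt0.
pose F (x : R) := cis (t * x) * f (l^-1 * x).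
have inab x : l * a <= x <= l * b -> a <= l^-1 * x <= b.
  by rewrite -(ler_pM2l l0 a) -(ler_pM2l l0 _ b) mulrA mulfV ?gt_eqF// mul1r.
have cs (h : R -> R) : good a b h -> forall x, l * a <= x <= l * b -> {for x, continuous (fun y => h (l^-1 * y))}.
  move=> hg x xab; apply: (@continuous_comp _ _ _ ( *%R l^-1) h).
    exact: mulrl_continuous.
  by apply: good_continuous hg _; exact: inab.
have cc e x : {for x, continuous (fun y => cos (t * y + e))} by exact: cos_lin_continuous.
have ReF : cRe \o F = fun x => (cRe \o f) (l^-1 * x) * cos (t * x + 0) -
    (cIm \o f) (l^-1 * x) * cos (t * x + - (pi / 2)).
  by apply/funext => x; rewrite -[LHS]/(cRe (cis (t * x) * f (l^-1 * x))) cReM /= addr0 cosBpihalf; ring.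
have ImF : cIm \o F = fun x => (cIm \o f) (l^-1 * x) * cos (t * x + 0) +
    (cRe \o f) (l^-1 * x) * cos (t * x + - (pi / 2)).
  by apply/funext => x; rewrite -[LHS]/(cIm (cis (t * x) * f (l^-1 * x))) cImM /= addr0 cosBpihalf; ring.
have cp (h : R -> R) e : good a b h -> forall x, l * a <= x <= l * b ->
    {for x, continuous (fun y => h (l^-1 * y) * cos (t * y + e))}.
  by move=> hg x xab; apply: continuousM; [exact: cs hg _ xab|exact: cc].
split.
  apply: cinteg_cut_itv => x xab.
    by rewrite -/F ReF; apply: continuousB; exact: cp.
  by rewrite -/F ImF; apply: continuousD; exact: cp.
rewrite cint_cut_itv (le_trans (modulus_le_ReIm _))//=.
have ip (h : R -> R) e (hg : good a b h) := integrable_itv_continuous (cp h e hg).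
have -> : \int[mu1]_(x in `[l * a, l * b]) cRe (cis (t * x) * f (l^-1 * x)) =
    osc (l * a) (l * b) (fun x => (cRe \o f) (l^-1 * x)) t 0 -
    osc (l * a) (l * b) (fun x => (cIm \o f) (l^-1 * x)) t (- (pi / 2)).
  rewrite -[X in Rintegral _ _ X]/(cRe \o F) ReF RintegralB//; exact: ip.
have -> : \int[mu1]_(x in `[l * a, l * b]) cIm (cis (t * x) * f (l^-1 * x)) =
    osc (l * a) (l * b) (fun x => (cIm \o f) (l^-1 * x)) t 0 +
    osc (l * a) (l * b) (fun x => (cRe \o f) (l^-1 * x)) t (- (pi / 2)).
  rewrite -[X in Rintegral _ _ X]/(cIm \o F) ImF RintegralD//; exact: ip.
have := uP l t 0 l0; have := uP l t (- (pi / 2)) l0.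
have := vP l t 0 l0; have := vP l t (- (pi / 2)) l0 => A1 A2 A3 A4.
have -> : (Cu + Cv + (Cu + Cv)) * l * weight (l * t) =
  (Cu * l * weight (l * t) + Cv * l * weight (l * t)) + (Cu * l * weight (l * t) + Cv * l * weight (l * t)).
  by ring.
apply: lerD.
  by apply: (le_trans (ler_normB _ _)); exact: lerD.
by apply: (le_trans (ler_normD _ _)); rewrite addrC; exact: lerD.
Qed.

End complex_oscillatory.

Section cutoff.
Context {R : realType}.
Local Notation mu1 := (@lebesgue_measure R).
Local Notation RR := (measurableTypeR R).
Implicit Types (a b c x t : R).

(** Smoothness of the cutoff is assumed on ['rV[R]_1]; [const_mx] carries it over to the line. *)
Lemma line_derive (h : 'rV[R]_1 -> R) (x : R) (j : 'I_1) :
  derivable h (const_mx x) (delta_mx 0 j) ->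
  is_derive x 1 (fun t : R => h (const_mx t)) ('D_(delta_mx 0 j) h (const_mx x)).
Proof.
have E : (fun e : R => e^-1 *: ((h \o shift (const_mx x)) (e *: delta_mx 0 j) - h (const_mx x))) =
   (fun e : R => e^-1 *: (((fun t : R => h (const_mx t)) \o shift x) (e *: 1) - h (const_mx x))).
  apply/funext => e; congr (_ *: (h _ - _)).
  apply/rowP => i; rewrite !mxE !ord1 !eqxx mulr1n /=; by rewrite /GRing.scale/=.
rewrite /derivable E => hd; split => //.
by rewrite /derive E.
Qed.

Lemma const_mx_continuous : continuous (fun t : R => const_mx t : 'rV[R]_1).
Proof.
move=> x; apply/cvgrPdist_lt => e e0; near=> t.
have -> : `|const_mx x - const_mx t : 'rV[R]_1| = `|x - t|.
  have -> : const_mx x - const_mx t = const_mx (x - t) :> 'rV[R]_1 by apply/rowP => i; rewrite !mxE.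
  apply/eqP; rewrite eq_le; apply/andP; split; last first.
    by have := row_norm_ge (const_mx (x - t) : 'rV[R]_1) 0; rewrite mxE.
  rewrite /Num.Def.normr/= mx_normrE; apply/bigmax_leP; split=> [|i _]; [exact: normr_ge0|by rewrite mxE].
near: t; exact: (@cvgr_dist_lt _ _ _ _ _ id x cvg_id).
Unshelve. all: by end_near. Qed.

Lemma cutoff_C2 (phi0 : R -> R[i]) : cutoff phi0 -> exists u1 u2 v1 v2, forall a b,
  C2on a b (cRe \o phi0) u1 u2 /\ C2on a b (cIm \o phi0) v1 v2.
Proof.
move=> [[sm _] _ _]; pose F (x : 'rV[R]_1) := phi0 (x 0 0).
pose G n := iter_pderiv (nseq n (0 : 'I_1)) F.
have d1 n x : is_derive x 1 (fun t => cRe (G n (const_mx t))) (cRe (G n.+1 (const_mx x))).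
  by have [_ _ /(_ 0 (const_mx x))[h _]] := sm (nseq n 0); exact: line_derive h.
have d2 n x : is_derive x 1 (fun t => cIm (G n (const_mx t))) (cIm (G n.+1 (const_mx x))).
  by have [_ _ /(_ 0 (const_mx x))[_ h]] := sm (nseq n 0); exact: line_derive h.
have E0 : phi0 = fun t => G 0%N (const_mx t).
  by apply/funext => t; rewrite /G /= /F mxE.
exists (fun x => cRe (G 1%N (const_mx x))), (fun x => cRe (G 2%N (const_mx x))).
exists (fun x => cIm (G 1%N (const_mx x))), (fun x => cIm (G 2%N (const_mx x))).
move=> a b; split=> x _; split.
- by rewrite E0; exact: d1 0%N x.
- exact: d1 1%N x.
- have [c _ _] := sm (nseq 2 0).
  apply: (@continuous_comp _ _ _ (fun t : R => const_mx t : 'rV[R]_1) (re (G 2%N))).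
    exact: const_mx_continuous.
  exact: c.
- by rewrite E0; exact: d2 0%N x.
- exact: d2 1%N x.
- have [_ c _] := sm (nseq 2 0).
  apply: (@continuous_comp _ _ _ (fun t : R => const_mx t : 'rV[R]_1) (im (G 2%N))).
    exact: const_mx_continuous.
  exact: c.
Qed.

Lemma der_locally0 (f : R -> R) x a : is_derive x 1 f a -> (\near x, f x = 0) -> a = 0.
Proof.
move=> [_ <-] f0; have h : is_derive x 1 f 0.
  by apply: (near_eq_is_derive _ (is_derive_cst 0 x 1)); apply: filterS f0 => y ->.
by rewrite (derive_val (is_derive := h)).
Qed.

Lemma C2on_good a b (f f1 f2 : R -> R) : a <= b -> C2on a b f f1 f2 ->
  (\near a, f a = 0) -> (\near b, f b = 0) -> good a b f.
Proof.
move=> ab fC fa fb; have [|da _ _] := fC a; first by rewrite lexx.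
have [|db _ _] := fC b; first by rewrite lexx ab.
exists f1, f2; split => //.
- exact: nbhs_singleton fa.
- exact: nbhs_singleton fb.
- exact: der_locally0 da fa.
- exact: der_locally0 db fb.
Qed.

(** The common profile of all dyadic pieces of positive index. It vanishes for |x| <= 1 and for |x|
    > 3, so division by x is harmless. *)
Definition annulus (phi0 : R -> R[i]) (x : R) : R[i] := phi0 (2^-1 * x) - phi0 x.

Lemma dyadicS (phi0 : R -> R[i]) k x : dyadic phi0 k.+1 x = annulus phi0 ((2 ^+ k)^-1 * x).
Proof. by rewrite /dyadic /annulus mulrA -invfM -exprS. Qed.

Lemma annulus0 (phi0 : R -> R[i]) x : cutoff phi0 -> `|x| <= 1 \/ 3 < `|x| -> annulus phi0 x = 0.
Proof.
move=> [_ p1 p0]; rewrite /annulus.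
have hx : `|2^-1 * x| = `|x| / 2 by rewrite normrM ger0_norm ?invr_ge0// mulrC.
case=> x1; first by rewrite !p1 ?subrr// hx; lra.
by rewrite !p0 ?subrr// ?hx; lra.
Qed.

Lemma annulus_near0 (phi0 : R -> R[i]) a : cutoff phi0 -> `|a| < 1 \/ 3 < `|a| -> \near a, annulus phi0 a = 0.
Proof.
move=> pc [a1|a3].
  near=> x; apply: annulus0 => //; left.
  near: x; apply: (@cvgr_norm_le _ _ _ _ _ id a cvg_id) => //.
near=> x; apply: annulus0 => //; right.
near: x; apply: (@cvgr_norm_gt _ _ _ _ _ id a cvg_id) => //.
Unshelve. all: by end_near. Qed.

Lemma annulus_C2 (phi0 : R -> R[i]) : cutoff phi0 -> exists u1 u2 v1 v2, forall a b,
  C2on a b (cRe \o annulus phi0) u1 u2 /\ C2on a b (cIm \o annulus phi0) v1 v2.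
Proof.
move=> /cutoff_C2[u1 [u2 [v1 [v2 C]]]].
have h0 : 0 < 2^-1 :> R by rewrite invr_gt0.
exists (fun x => 2^-1 * u1 (2^-1 * x) - u1 x), (fun x => 2^-1 ^+ 2 * u2 (2^-1 * x) - u2 x).
exists (fun x => 2^-1 * v1 (2^-1 * x) - v1 x), (fun x => 2^-1 ^+ 2 * v2 (2^-1 * x) - v2 x).
move=> a b; split.
  have -> : cRe \o annulus phi0 = fun x => (cRe \o phi0) (2^-1 * x) - (cRe \o phi0) x.
    by apply/funext => x /=; rewrite /annulus; case: (phi0 _); case: (phi0 _).
  by apply: C2on_sub; [apply: C2on_scale => //|]; apply: (C _ _).1.
have -> : cIm \o annulus phi0 = fun x => (cIm \o phi0) (2^-1 * x) - (cIm \o phi0) x.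
  by apply/funext => x /=; rewrite /annulus; case: (phi0 _); case: (phi0 _).
by apply: C2on_sub; [apply: C2on_scale => //|]; apply: (C _ _).2.
Qed.

Lemma cgood_phi0 (phi0 : R -> R[i]) : cutoff phi0 -> cgood (- 2) 2 phi0.
Proof.
move=> pc; have [_ _ p0] := pc; have [u1 [u2 [v1 [v2 C]]]] := cutoff_C2 pc.
have n0 (a : R) : `|a| = 2 -> \near a, phi0 a = 0.
  move=> a2; near=> x; apply: p0; near: x.
  by apply: (@cvgr_norm_gt _ _ _ _ _ id a cvg_id); rewrite a2; lra.
have a1 : `|-2| = 2 :> R by rewrite normrN ger0_norm.
have a2 : `|2| = 2 :> R by rewrite ger0_norm.
split.
  apply: (C2on_good _ (C _ _).1); first by lra.
    by apply: filterS (n0 _ a1) => x /= ->.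
  by apply: filterS (n0 _ a2) => x /= ->.
apply: (C2on_good _ (C _ _).2); first by lra.
  by apply: filterS (n0 _ a1) => x /= ->.
by apply: filterS (n0 _ a2) => x /= ->.
Unshelve. all: by end_near. Qed.

(** The second function is included because the Fourier transform of an indicator contributes a
    factor 1/x. *)
Lemma cgood_annulus (phi0 : R -> R[i]) a b : cutoff phi0 -> a < b ->
  `|a| < 1 \/ 3 < `|a| -> `|b| < 1 \/ 3 < `|b| -> 0 < a \/ b < 0 ->
  cgood a b (annulus phi0) /\ cgood a b (fun x => annulus phi0 x * (x^-1)%:C).
Proof.
move=> pc ab a1 b1 ab0; have [u1 [u2 [v1 [v2 C]]]] := annulus_C2 pc.
have na := annulus_near0 pc a1; have nb := annulus_near0 pc b1.
have [Cu Cv] := C a b; have Ci := C2on_inv ab0.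
split; split.
- apply: (C2on_good (ltW ab) Cu); [apply: filterS na|apply: filterS nb] => x /= -> //.
- apply: (C2on_good (ltW ab) Cv); [apply: filterS na|apply: filterS nb] => x /= -> //.
- have -> : cRe \o (fun x => annulus phi0 x * (x^-1)%:C) = fun x => (cRe \o annulus phi0) x * x^-1.
    by apply/funext => x; rewrite -[LHS]/(cRe (annulus phi0 x * (x^-1)%:C)) cReM /= mulr0 subr0.
  apply: (C2on_good (ltW ab) (C2on_mul Cu Ci)); [apply: filterS na|apply: filterS nb] => x /= ->;
  by rewrite mul0r.
- have -> : cIm \o (fun x => annulus phi0 x * (x^-1)%:C) = fun x => (cIm \o annulus phi0) x * x^-1.
    by apply/funext => x; rewrite -[LHS]/(cIm (annulus phi0 x * (x^-1)%:C)) cImM /= mulr0 add0r.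
  apply: (C2on_good (ltW ab) (C2on_mul Cv Ci)); [apply: filterS na|apply: filterS nb] => x /= ->;
  by rewrite mul0r.
Qed.

End cutoff.

(** * Kernels of the one-dimensional blocks *)

Section weight_lemmas.
Context {R : realType}.
Implicit Types (s t c : R).

(** From t^2 <= 2 s^2 + 2 (s - t)^2, which is (2 s - t)^2 >= 0. *)
Lemma weight_shift s t c : `|s - t| <= c -> weight s <= (2 + 2 * c ^+ 2) * weight t.
Proof.
move=> st; rewrite /weight -[X in X <= _]mul1r ler_pdivrMr; last by rewrite (lt_le_trans ltr01)// oneDsqr_ge1.
rewrite mulrAC ler_pdivlMr; last by rewrite (lt_le_trans ltr01)// oneDsqr_ge1.
have h : (s - t) ^+ 2 <= c ^+ 2.
  by rewrite -[leLHS]real_normK ?num_real// lerXn2r ?nnegrE// (le_trans _ st).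
rewrite mul1r /oneDsqr; have := sqr_ge0 s; have := sqr_ge0 c; have := sqr_ge0 (s + (s - t)); nra.
Qed.

Lemma weight_half s : weight (2^-1 * s) <= 4 * weight s.
Proof.
rewrite /weight -[X in X <= _]mul1r ler_pdivrMr; last by rewrite (lt_le_trans ltr01)// oneDsqr_ge1.
rewrite mulrAC ler_pdivlMr; last by rewrite (lt_le_trans ltr01)// oneDsqr_ge1.
rewrite mul1r /oneDsqr exprMn exprVn; lra.
Qed.

End weight_lemmas.

Section kernels.
Context {R : realType}.
Local Notation mu1 := (@lebesgue_measure R).
Local Notation RR := (measurableTypeR R).
Variable phi0 : R -> R[i].
Hypothesis pc : cutoff phi0.
Implicit Types (a b c x t : R).

(** The Littlewood-Paley kernel, up to the normalising constant. *)
Definition lpkernel (k : nat) (t : R) : R[i] :=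
  cint mu1 (fun xi : RR => cis (t * xi) * dyadic phi0 k xi).

(** Formally a primitive of i times [lpkernel], so that the block of an interval becomes a
    difference of two of its values. *)
Definition lpprim (k : nat) (t : R) : R[i] :=
  cint mu1 (fun xi : RR => cis (t * xi) * (dyadic phi0 k xi * (xi^-1)%:C)).

(** The ends 1/2 and 4 lie strictly off the region 1 <= |x| <= 3 where [annulus] lives, so it
    vanishes near them and each half is [cgood]. *)
Lemma dyadic_cut_itv k (h : R -> R[i]) : (fun xi : RR => h xi * dyadic phi0 k.+1 xi) =
  (fun xi => cut_itv (2 ^+ k * 2^-1) (2 ^+ k * 4) (fun x => h x * dyadic phi0 k.+1 x) xi +
    cut_itv (2 ^+ k * - 4) (2 ^+ k * - 2^-1) (fun x => h x * dyadic phi0 k.+1 x) xi).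
Proof.
apply/funext => x; rewrite /cut_itv; have k0 : 0 < 2 ^+ k :> R by rewrite exprn_gt0.
have [u xu] : exists u, x = 2 ^+ k * u by exists ((2 ^+ k)^-1 * x); rewrite mulrA mulfV ?mul1r ?gt_eqF.
rewrite xu !ler_pM2l//.
case: ifPn => [/andP[u1 u2]|n1]; case: ifPn => [/andP[u3 u4]|n2]; rewrite ?addr0 ?add0r//.
  by exfalso; lra.
rewrite dyadicS annulus0 ?mulr0// mulrA mulVf ?gt_eqF// mul1r.
move: n1 n2; rewrite !negb_and -!ltNge.
case: (lerP 0 u) => u0.
  by rewrite ger0_norm// => /orP[h1|h1] _; [left|right]; lra.
by rewrite ltr0_norm// => _ /orP[h1|h1]; [right|left]; lra.
Qed.

(** Used twice: with [h = 1], [s = 1] for the kernel, and with h = 1/xi, s = 2^-k for its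
    primitive. *)
Lemma cint_annulus (f : R -> R[i]) (h : nat -> RR -> R[i]) (s : nat -> R) :
  cgood 2^-1 4 f -> cgood (- 4) (- 2^-1) f ->
  (forall k xi, h k xi * dyadic phi0 k.+1 xi = (s k)%:C * f ((2 ^+ k)^-1 * xi)) ->
  exists C : R, 0 <= C /\ forall k t,
    cinteg mu1 (fun xi : RR => cis (t * xi) * (h k xi * dyadic phi0 k.+1 xi)) /\
    modulus (cint mu1 (fun xi : RR => cis (t * xi) * (h k xi * dyadic phi0 k.+1 xi))) <=
      C * `|s k| * 2 ^+ k * weight (2 ^+ k * t).
Proof.
move=> g1 g2 hf.
have l1 : 2^-1 < 4 :> R by lra. have l2 : - 4 < - 2^-1 :> R by lra.
have [C1 [C10 P1]] := cint_osc l1 g1; have [C2 [C20 P2]] := cint_osc l2 g2.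
exists (C1 + C2); split; first exact: addr_ge0.
move=> k t; have k0 : 0 < 2 ^+ k :> R by rewrite exprn_gt0.
have [i1 b1] := P1 _ t k0; have [i2 b2] := P2 _ t k0.
pose c1 := cut_itv (2 ^+ k * 2^-1) (2 ^+ k * 4) (fun x => cis (t * x) * f ((2 ^+ k)^-1 * x)).
pose c2 := cut_itv (2 ^+ k * - 4) (2 ^+ k * - 2^-1) (fun x => cis (t * x) * f ((2 ^+ k)^-1 * x)).
have E : (fun xi : RR => cis (t * xi) * (h k xi * dyadic phi0 k.+1 xi)) =
    fun xi => (s k)%:C * (c1 xi + c2 xi).
  under eq_fun do rewrite mulrA; rewrite (dyadic_cut_itv k (fun xi => cis (t * xi) * h k xi)).
  apply/funext => xi; rewrite /c1 /c2 /cut_itv [RHS]mulrDr.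
  by congr (_ + _); case: ifP => _; rewrite ?mulr0// -mulrA hf mulrCA.
rewrite E; split; first by apply: cintegZ; exact: cintegD.
rewrite cintZ; last exact: cintegD.
rewrite cintD// modulusM modulusC -!mulrA mulrCA ler_wpM2l// (le_trans (modulusD _ _))//.
by rewrite mulrDl lerD// mulrA.
Qed.

Lemma kernel_bound : exists C : R, 0 <= C /\ forall k t,
  cinteg mu1 (fun xi : RR => cis (t * xi) * dyadic phi0 k xi) /\
  modulus (lpkernel k t) <= C * 2 ^+ k * weight (2 ^+ k * t).
Proof.
have l0 : - 2 < 2 :> R by lra.
have [C0 [C00 P0]] := cint_osc l0 (cgood_phi0 pc).
have [g1 _] : cgood 2^-1 4 (annulus phi0) /\ cgood 2^-1 4 (fun x => annulus phi0 x * (x^-1)%:C).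
  apply: cgood_annulus => //; first by lra.
  - by left; rewrite ger0_norm; lra.
  - by right; rewrite ger0_norm; lra.
  - by left; lra.
have [g2 _] : cgood (- 4) (- 2^-1) (annulus phi0) /\ cgood (- 4) (- 2^-1) (fun x => annulus phi0 x * (x^-1)%:C).
  apply: cgood_annulus => //; first by lra.
  - by right; rewrite normrN ger0_norm; lra.
  - by left; rewrite normrN ger0_norm; lra.
  - by right; lra.
have [|C1 [C10 P1]] := @cint_annulus _ (fun _ _ => 1) (fun _ => 1) g1 g2.
  by move=> k xi; rewrite dyadicS.
(* [C0] treats index 0. The factor 4 is the price, by [weight_half], of stating at scale 2^(k + 1) a
   decay obtained at scale 2^k. *)
exists (C0 + 4 * C1); split; first by rewrite addr_ge0// mulr_ge0.
move=> [|k] t; last first.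
  have [] := P1 k t; rewrite normr1 mulr1.
  under eq_fun do rewrite mul1r.
  move=> i1 b1; split => //; apply: (le_trans b1).
  have k0 : 0 <= 2 ^+ k :> R by rewrite exprn_ge0.
  have := @weight_half R (2 ^+ k.+1 * t); rewrite exprS -!mulrA mulKf//.
  have := weight_ge0 (2 * (2 ^+ k * t)).
  move: (2 ^+ k) k0 => K K0; move: (weight (2 * (K * t))) (weight (K * t)) => w w' w0 ww.
  have : C1 * (K * w') <= C1 * (K * (4 * w)) by rewrite ler_wpM2l// ler_wpM2l.
  have : 0 <= C1 * (K * w) by rewrite mulr_ge0// mulr_ge0.
  have : 0 <= C0 * (K * w) by rewrite mulr_ge0// mulr_ge0.
  lra.
have [] := P0 1 t ltr01; rewrite !(mul1r, mulr1, expr0).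
have -> : cut_itv (- 2) 2 (fun x => cis (t * x) * phi0 (1^-1 * x)) = (fun xi : RR => cis (t * xi) * phi0 xi).
  apply/funext => x; rewrite /cut_itv invr1 mul1r; case: ifPn => // n1.
  have [_ _ p0] := pc; rewrite p0 ?mulr0//.
  move: n1; rewrite negb_and -!ltNge; case: (lerP 0 (x : R)) => u0.
    by rewrite ger0_norm// => /orP[h1|h1]; lra.
  by rewrite ltr0_norm// => /orP[h1|h1]; lra.
move=> i1 b1; split => //; apply: (le_trans b1).
by rewrite ler_wpM2r ?weight_ge0// lerDl mulr_ge0.
Qed.

(** Dividing by xi, of size 2^k on the annulus, cancels the factor 2^k of [kernel_bound]. Index 0 is
    left out because [dyadic phi0 0] equals 1 near 0. *)
Lemma pkernel_bound : exists C : R, 0 <= C /\ forall k t,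
  cinteg mu1 (fun xi : RR => cis (t * xi) * (dyadic phi0 k.+1 xi * (xi^-1)%:C)) /\
  modulus (lpprim k.+1 t) <= C * weight (2 ^+ k.+1 * t).
Proof.
have [_ g1] : cgood 2^-1 4 (annulus phi0) /\ cgood 2^-1 4 (fun x => annulus phi0 x * (x^-1)%:C).
  apply: cgood_annulus => //; first by lra.
  - by left; rewrite ger0_norm; lra.
  - by right; rewrite ger0_norm; lra.
  - by left; lra.
have [_ g2] : cgood (- 4) (- 2^-1) (annulus phi0) /\ cgood (- 4) (- 2^-1) (fun x => annulus phi0 x * (x^-1)%:C).
  apply: cgood_annulus => //; first by lra.
  - by right; rewrite normrN ger0_norm; lra.
  - by left; rewrite normrN ger0_norm; lra.
  - by right; lra.
have [|C1 [C10 P1]] := @cint_annulus _ (fun _ xi => ((xi : R)^-1)%:C) (fun k => (2 ^+ k)^-1) g1 g2.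
  move=> k xi; rewrite dyadicS mulrC mulrCA; congr (_ * _).
  by rewrite -rmorphM/= invfM invrK mulrA mulVf ?mul1r// expf_neq0.
exists (4 * C1); split; first by rewrite mulr_ge0.
move=> k t; have [] := P1 k t.
have k0 : 0 < 2 ^+ k :> R by rewrite exprn_gt0.
have kV : `|(2 ^+ k)^-1| * 2 ^+ k = 1 :> R by rewrite gtr0_norm ?invr_gt0// mulVf ?gt_eqF.
rewrite -(mulrA C1) kV mulr1 /lpprim.
have -> : (fun xi : RR => cis (t * xi) * (((xi : R)^-1)%:C * dyadic phi0 k.+1 xi)) =
  (fun xi : RR => cis (t * xi) * (dyadic phi0 k.+1 xi * ((xi : R)^-1)%:C)).
  by apply/funext => xi; rewrite [X in _ * X]mulrC.
move=> i1 b1; split => //; apply: (le_trans b1).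
rewrite -mulrA mulrCA ler_wpM2l//.
by have := @weight_half R (2 ^+ k.+1 * t); rewrite exprS -!mulrA mulKf.
Qed.

Lemma cinteg_dyadic k : cinteg mu1 (dyadic phi0 k : RR -> R[i]).
Proof.
have [C [_ P]] := kernel_bound; have [h _] := P k 0; move: h.
suff -> : (fun xi : RR => cis (0 * xi) * dyadic phi0 k xi) = dyadic phi0 k by [].
by apply/funext => x; rewrite mul0r cis0 mul1r.
Qed.

Definition block1 (k : nat) (g : RR -> R[i]) (x : R) : R[i] :=
  fourier1 1 (fun xi => dyadic phi0 k xi * fourier1 (-1) g xi) x.

Definition unit_const1 : R[i] := ((Num.sqrt (2 * pi))^-1)%:C.

(** Fubini turns the transform, multiplier and inverse transform into a convolution with the
    kernel. *)
Lemma block1E k (g : RR -> R[i]) x : cinteg mu1 g ->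
  cinteg mu1 (fun xi : RR => dyadic phi0 k xi * fourier1 (-1) g xi) /\
  cinteg mu1 (fun y : RR => g y * lpkernel k (x - y)) /\
  block1 k g x = unit_const1 * unit_const1 * cint mu1 (fun y : RR => g y * lpkernel k (x - y)).
Proof.
move=> gi; have di := cinteg_dyadic k.
(* At [t = x] the two iterated integrals are the block and the convolution; at [t = 0] the inner
   integral over y is the transform of g times the multiplier, whose integrability is claimed
   first. *)
pose H (t : R) (z : RR * RR) := cis (t * z.1) * (cis (- (z.2 * z.1)) * (dyadic phi0 k z.1 * g z.2)).
have mH t : cmeas (H t).
  apply: cmeasM.
    by apply: cmeas_cis; apply: measurable_funM => //; exact: measurable_fst.
  apply: cmeasM.
    apply: cmeas_cis; apply: measurable_funN.
    by apply: measurable_funM; [exact: measurable_snd|exact: measurable_fst].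
  apply: cmeasM.
    by apply: (cmeas_comp (f := dyadic phi0 k : RR -> R[i])); [exact: measurable_fst|exact: cinteg_cmeas di].
  by apply: (cmeas_comp (f := g)); [exact: measurable_snd|exact: cinteg_cmeas gi].
have dom t (xi y : RR) : modulus (H t (xi, y)) <= modulus (dyadic phi0 k xi) * modulus (g y).
  by rewrite !modulusM !modulus_cis !mul1r.
have id := integrable_modulus di; have ig := integrable_modulus gi.
have E1 t : (fun xi : RR => cint mu1 (fun y => H t (xi, y))) =
    fun xi : RR => cis (t * xi) * (dyadic phi0 k xi * cint mu1 (fun y => cis (-1 * (y * xi)) * g y)).
  apply/funext => xi; rewrite -cintZ; last exact: cinteg_kernel1.
  rewrite -cintZ; last by apply: cintegZ; exact: cinteg_kernel1.
  by congr cint; apply/funext => y; rewrite /H /= mulN1r; congr (_ * _); rewrite mulrCA.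
have E2 t : (fun y : RR => cint mu1 (fun xi => H t (xi, y))) =
    fun y : RR => g y * lpkernel k (t - y).
  apply/funext => y; rewrite /lpkernel -cintZ; last first.
    by have [C [_ P]] := kernel_bound; have [] := P k (t - y).
  congr cint; apply/funext => xi; rewrite /H /= mulrBl cisD.
  by rewrite -!mulrA [RHS]mulrCA; congr (_ * _); rewrite [RHS]mulrCA; congr (_ * _); rewrite mulrC.
have iH := cinteg_prod (mH x) id ig (fun=> modulus_ge0 _) (fun=> modulus_ge0 _) (dom x).
have iH0 := cinteg_prod (mH 0) id ig (fun=> modulus_ge0 _) (fun=> modulus_ge0 _) (dom 0).
have I1 t : cinteg mu1 (fun xi : RR => cint mu1 (fun y => H t (xi, y))).
  have [F1 F2] := cinteg_prod (mH t) id ig (fun=> modulus_ge0 _) (fun=> modulus_ge0 _) (dom t).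
  split.
    have := integrable_fubini_F F1; apply: eq_integrable => // s _ /=.
    rewrite fineK//; apply: integrable_fin_num => //.
    exact: (cinteg_sec1 (mH t) ig (dom t) s).1.
  have := integrable_fubini_F F2; apply: eq_integrable => // s _ /=.
  rewrite fineK//; apply: integrable_fin_num => //.
  exact: (cinteg_sec1 (mH t) ig (dom t) s).2.
have I2 : cinteg mu1 (fun y : RR => g y * lpkernel k (x - y)).
  have [C [C0 P]] := kernel_bound.
  apply: (@cinteg_dom _ _ _ _ _ (fun y => (C * 2 ^+ k) * modulus (g y))).
  (* Measurability of the convolution integrand is that of a partial integral, with the two
     variables exchanged. *)
  - rewrite -E2; apply: (cmeas_cint2 (m1 := mu1) (F := fun z : RR * RR => H x (z.2, z.1)) (A := fun y => modulus (g y)) (B := fun xi => modulus (dyadic phi0 k xi)) _ ig id).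
    + apply: (cmeas_comp (f := H x) (h := fun z : RR * RR => (z.2, z.1))) => //.
      by apply: measurable_fun_pair; [exact: measurable_snd|exact: measurable_fst].
    + by move=> *; exact: modulus_ge0.
    + by move=> *; exact: modulus_ge0.
    + by move=> y xi; rewrite mulrC; exact: dom.
  - exact: (integrableZl measurableT _ ig).
  - move=> y; rewrite modulusM mulrC ler_wpM2r ?modulus_ge0//.
    have [_ h] := P k (x - y); apply: (le_trans h).
    by rewrite ler_piMr ?weight_le1// mulr_ge0// exprn_ge0.
have E0 : (fun xi : RR => dyadic phi0 k xi * fourier1 (-1) g xi) =
    fun xi => unit_const1 * cint mu1 (fun y => H 0 (xi, y)).
  apply/funext => xi; have /= -> := congr1 (fun F => F xi) (E1 0); rewrite mul0r cis0 mul1r /fourier1 mulrCA.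
  by [].
split; first by rewrite E0; exact: cintegZ.
split; first exact: I2.
rewrite /block1 {1}/fourier1 -/unit_const1 -mulrA; congr (_ * _).
rewrite -E2 -(cFubini (mH x) id ig (fun=> modulus_ge0 _) (fun=> modulus_ge0 _) (dom x)).
rewrite -cintZ//; congr cint; apply/funext => xi.
have /= -> := congr1 (fun F => F xi) (E1 x).
rewrite mul1r [xi * x]mulrC /fourier1 -/unit_const1.
by rewrite [RHS]mulrCA; congr (_ * _); rewrite mulrCA.
Qed.

End kernels.

(** * Blocks of intervals and of the tent *)

Lemma eq_ler (R : numDomainType) (x y : R) : x = y -> x <= y.
Proof. by move=> ->. Qed.

Section tent.
Context {R : realType}.
Local Notation mu1 := (@lebesgue_measure R).
Local Notation RR := (measurableTypeR R).
Implicit Types (a b c x y z t : R).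

Definition ind (i : interval R) : RR -> R := \1_[set` i].

Lemma indE (i : interval R) (y : R) : ind i y = (y \in i)%:R.
Proof. by rewrite /ind indicE mem_setE. Qed.

Lemma ind_ge0 i (y : R) : 0 <= ind i y.
Proof. by rewrite indE. Qed.

Lemma integrable_ind (b0 b1 : bool) a b : mu1.-integrable setT (EFin \o ind (Interval (BSide b0 a) (BSide b1 b))).
Proof. exact: integrable_indic_itv. Qed.

Lemma Rintegral_ind_cc a b : a <= b -> Rintegral mu1 setT (ind `[a, b]) = b - a.
Proof.
move=> ab; rewrite /Rintegral /ind integral_indic//= setIT lebesgue_measure_itv/= lte_fin.
by case: ltgtP ab => [_ _|//|-> _] //=; rewrite subrr.
Qed.

(** An integrable substitute for the indicator of y > z: for z >= 0 the two agree on [0, 1). *)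
Definition chi z : RR -> R[i] := fun y => (ind `]z, z + 1] y)%:C.

Lemma cinteg_chi z : cinteg mu1 (chi z).
Proof. by apply: cinteg_real; exact: integrable_ind. Qed.

Definition clamp y : R := Num.min (Num.max y 0) 1.

(** The length of the set of z in [0, 1) with z < y <= z + 1, that is, the mean of [chi z y] over
    these z. *)
Definition tent y : R := clamp y - clamp (y - 1).

Lemma clampP y : [/\ y <= 0 -> clamp y = 0, 0 <= y <= 1 -> clamp y = y & 1 <= y -> clamp y = 1].
Proof.
rewrite /clamp; split=> [y0|/andP[y0 y1]|y1].
- by rewrite max_r// min_l.
- by rewrite max_l// min_l.
- by rewrite max_l ?min_r// (le_trans _ y1).
Qed.

Lemma measurable_clamp : measurable_fun setT (clamp : RR -> R).
Proof. by apply: measurable_minr => //; apply: measurable_maxr. Qed.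

Lemma tent_unit y : 0 <= y < 1 -> tent y = y.
Proof.
move=> /andP[y0 y1]; rewrite /tent; have [_ c1 _] := clampP y; have [c2 _ _] := clampP (y - 1).
by rewrite c1 ?c2 ?subr0//; [lra|rewrite y0 ltW].
Qed.

Lemma tent_bounds y : 0 <= tent y <= ind `[0, 2] y.
Proof.
rewrite indE in_itv/= /tent; have [a1 a2 a3] := clampP y; have [b1 b2 b3] := clampP (y - 1).
case: (ltP y 0) => y0; first by rewrite a1 ?b1 /=; lra.
case: (ltP y 1) => y1.
  rewrite a2 ?b1; [|lra|lra]; rewrite (_ : y <= 2) /=; lra.
case: (leP y 2) => y2 /=; first by rewrite a3 ?b2; lra.
by rewrite a3 ?b3; lra.
Qed.

Lemma integrable_tent : mu1.-integrable setT (EFin \o (tent : RR -> R)).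
Proof.
apply: (le_integrable measurableT _ _ (@integrable_ind true false 0 2)).
  apply/measurable_EFinP; apply: measurable_funB; first exact: measurable_clamp.
  by apply: (measurableT_comp measurable_clamp); exact: measurable_funB.
move=> y _ /=; rewrite lee_fin; have /andP[t0 t1] := tent_bounds y.
by rewrite (ger0_norm t0) (le_trans t1)// ler_norm.
Qed.

(** Taken at s = y B and divided by B, this is a Riemann sum for [clamp y] with error at most
    1/B. *)
Definition step_count (B : nat) (s : R) : R := \sum_(a < B) (a%:R < s)%R%:R.

Lemma step_countP (B : nat) (s : R) : [/\ s <= 0 -> step_count B s = 0,
  0 <= s <= B%:R -> s <= step_count B s <= s + 1 & B%:R <= s -> step_count B s = B%:R].
Proof.
elim: B => [|B [IH1 IH2 IH3]].
  by rewrite /step_count; split=> [_|s0|_]; rewrite big_ord0//; apply/andP; split; lra.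
have E : step_count B.+1 s = step_count B s + (B%:R < s)%R%:R by rewrite /step_count big_ord_recr.
have B0 : 0 <= B%:R :> R by [].
rewrite E -natr1; case: (ltP B%:R s) => Bs /=; split.
- by move=> ?; lra.
- by move=> /andP[? ?]; rewrite (IH3 (ltW Bs)); apply/andP; split; lra.
- by move=> _; rewrite IH3 ?ltW.
- by move=> ?; rewrite IH1// addr0.
- by move=> ?; rewrite addr0; apply: IH2; lra.
- by move=> ?; lra.
Qed.

Lemma step_count_clamp B y : (0 < B)%N -> `|clamp y - B%:R^-1 * step_count B (y * B%:R)| <= B%:R^-1.
Proof.
move=> B0; have b0 : 0 < B%:R :> R by rewrite ltr0n.
have [a1 a2 a3] := clampP y; have [s1 s2 s3] := step_countP B (y * B%:R).
have bV : B%:R^-1 * B%:R = 1 :> R by rewrite mulVf ?gt_eqF.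
have bV0 : 0 < B%:R^-1 :> R by rewrite invr_gt0.
case: (ltP y 0) => y0.
  have yB : y * B%:R <= 0 by rewrite pmulr_lle0// ltW.
  by rewrite (a1 (ltW y0)) (s1 yB) mulr0 subr0 normr0 ltW.
case: (ltP y 1) => y1; last first.
  have Bs : B%:R <= y * B%:R by rewrite -[leLHS]mul1r ler_pM2r.
  by rewrite a3// (s3 Bs) bV subrr normr0 ltW.
rewrite a2; last by rewrite y0 ltW.
have /s2 : 0 <= y * B%:R <= B%:R by rewrite mulr_ge0//= -[leRHS]mul1r ler_pM2r// ltW.
move: (step_count _ _) => S /andP[S1 S2].
have : y <= B%:R^-1 * S by rewrite mulrC ler_pdivlMr.
have : B%:R^-1 * S <= y + B%:R^-1.
  by rewrite mulrC ler_pdivrMr// mulrDl bV.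
by move=> ? ?; rewrite ler_norml; apply/andP; split; lra.
Qed.

Lemma tent_approx B y : (0 < B)%N ->
  `|tent y - B%:R^-1 * \sum_(a < B) ind `]a%:R / B%:R, a%:R / B%:R + 1] y| <= 2 / B%:R * ind `[0, 2] y.
Proof.
move=> B0; have b0 : 0 < B%:R :> R by rewrite ltr0n.
(* The point a/B satisfies a/B < y <= a/B + 1 when a is counted for y B but not for (y - 1) B. *)
have E : \sum_(a < B) ind `]a%:R / B%:R, a%:R / B%:R + 1] y =
    step_count B (y * B%:R) - step_count B ((y - 1) * B%:R).
  rewrite /step_count -sumrB; apply: eq_bigr => a _; rewrite indE in_itv/=.
  rewrite -!ltr_pdivrMr// ltrBrDr; case: (ltP _ y) => h1; case: leP => h2 /=; lra.
have aB (a : 'I_B) : 0 <= (a%:R / B%:R : R) < 1.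
  by rewrite divr_ge0//= ltr_pdivrMr// mul1r ltr_nat ltn_ord.
rewrite indE in_itv/=; case: (boolP (0 <= y <= 2)) => [_|y02].
  rewrite mulr1 E; have := step_count_clamp y B0; have := step_count_clamp (y - 1) B0.
  rewrite /tent mulrBr; move: (_ * step_count _ _) (_ * step_count _ _) => u v h1 h2.
  rewrite (_ : _ - _ - _ = (clamp y - u) - (clamp (y - 1) - v)); last by ring.
  apply: (le_trans (ler_normB _ _)); rewrite mulrDl mul1r; exact: lerD.
have /andP[t0 t1] := tent_bounds y.
have -> : tent y = 0 by apply/eqP; rewrite eq_le t0 andbT (le_trans t1)// indE in_itv/= (negbTE y02).
rewrite big1 ?mulr0 ?subrr ?normr0// => a _; rewrite indE in_itv/=.
have := aB a; move: y02; rewrite negb_and -!ltNge; case: (boolP (_ < y <= _)) => //.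
by move=> /andP[? ?] /orP[?|?] /andP[? ?]; exfalso; lra.
Qed.

End tent.

Section theta.
Context {R : realType}.
Local Notation mu1 := (@lebesgue_measure R).
Local Notation RR := (measurableTypeR R).
Variable phi0 : R -> R[i].
Hypothesis pc : cutoff phi0.
Implicit Types (a b c x y z t : R).

Definition theta (k : nat) z x : R[i] := block1 phi0 k (chi z) x.

Lemma chi_hat z (xi : R) : xi != 0 ->
  cint mu1 (fun y : RR => cis (-1 * (y * xi)) * chi z y) =
  (0 +i* 1) * (xi^-1)%:C * (cis (- (z + 1) * xi) - cis (- z * xi)).
Proof.
move=> xi0; have zz : z < z + 1 by rewrite ltrDl.
have cc e := fun (y : R) (_ : z <= y <= z + 1) => @cos_lin_continuous R xi e y.
(* Phase 0 gives the real part; phase pi/2 turns the cosine into minus the sine and gives the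
   imaginary part. *)
have FTC e : \int[mu1]_(y in `]z, z + 1]) cos (xi * y + e) =
    xi^-1 * (sin (xi * (z + 1) + e) - sin (xi * z + e)).
  have D (y : R) : is_derive y 1 (fun y => xi^-1 * sin (xi * y + e)) (cos (xi * y + e)).
    have h := der_mul (is_derive_cst xi^-1 y 1) (der_sin_lin y xi e).
    by apply: is_derive_eq h _; rewrite mul0r add0r mulrA mulVf ?mul1r.
  rewrite (@Rintegral_itv_obnd_cbnd _ _ _ (fun y => cos (xi * y + e))); last first.
    apply: integrableS (integrable_itv_continuous (cc e)) => //.
    by apply: subset_itvr; rewrite bnd_simp.
  rewrite /Rintegral (@continuous_FTC2 _ _ (fun y => xi^-1 * sin (xi * y + e)))//.
  - by rewrite -EFinB/= mulrBr.
  - by apply: continuous_in_subspaceT => y; rewrite inE/= in_itv/=; exact: cc.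
  - split.
    + by move=> y _; have [] := D y.
    + by apply: cvg_at_right_filter; exact: der_continuous (D z).
    + by apply: cvg_at_left_filter; exact: der_continuous (D (z + 1)).
  - by move=> y _; rewrite derive1E; apply: derive_val; exact: D.
apply: complexP; rewrite !(cReM, cImM)/=.
  transitivity (\int[mu1]_(y in `]z, z + 1]) cos (xi * y + 0)).
    rewrite [RHS]Rintegral_mkcond; apply: eq_Rintegral => y _.
    rewrite -[LHS]/(cRe (cis (-1 * (y * xi)) * chi z y)) cReM patchE mem_setE /= mulr0 subr0 addr0 mulN1r cosN [xi * y]mulrC indE.
    by case: ifP => _; rewrite ?mulr1 ?mulr0.
  rewrite FTC !addr0 !mulNr !sinN [xi * z]mulrC [xi * (z + 1)]mulrC; ring.
transitivity (\int[mu1]_(y in `]z, z + 1]) cos (xi * y + pi / 2)).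
  rewrite [RHS]Rintegral_mkcond; apply: eq_Rintegral => y _.
  rewrite -[LHS]/(cIm (cis (-1 * (y * xi)) * chi z y)) cImM patchE mem_setE /= mulr0 add0r cosDpihalf mulN1r sinN [xi * y]mulrC indE.
  by case: ifP => _; rewrite ?mulr1 ?mulr0.
rewrite FTC !sinDpihalf !mulNr !cosN [xi * z]mulrC [xi * (z + 1)]mulrC; ring.
Qed.

Lemma thetaS k z x : theta k.+1 z x = unit_const1 * unit_const1 * (0 +i* 1) *
  (lpprim phi0 k.+1 (x - (z + 1)) - lpprim phi0 k.+1 (x - z)).
Proof.
have [C [_ P]] := pkernel_bound pc; have [i1 _] := P k (x - (z + 1)); have [i2 _] := P k (x - z).
rewrite /theta /block1 {1}/fourier1 -/unit_const1 -2!mulrA; congr (_ * _).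
rewrite /lpprim -[X in _ + X]mulN1r -cintZ// -cintD//; last exact: cintegZ.
rewrite -cintZ; last by apply: cintegD => //; exact: cintegZ.
rewrite -cintZ; last by apply: cintegZ; apply: cintegD => //; exact: cintegZ.
congr cint; apply/funext => xi; rewrite mul1r /fourier1 -/unit_const1.
(* At xi = 0, where [chi_hat] is silent, the dyadic factor vanishes. *)
have [->|xi0] := eqVneq (xi : R) 0.
  rewrite dyadicS mulr0 annulus0 ?normr0//; last by left.
  by rewrite !(mul0r, mulr0, add0r).
rewrite (chi_hat z xi0) !mulrBl !cisD [xi * x]mulrC !mulNr; ring.
Qed.

(** Integrating [kernel_bound] over the interval would give no decay between the two jumps, so
    positive indices go through [thetaS], which concentrates the block at the jumps. At index 0 the
    interval is as short as the kernel is wide, and the direct estimate is enough. *)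
Lemma theta_bound : exists C : R, 0 <= C /\ forall k z x,
  modulus (theta k z x) <= C * (weight (2 ^+ k * (x - z)) + weight (2 ^+ k * (x - z - 1))).
Proof.
have [C1 [C10 P1]] := kernel_bound pc; have [C2 [C20 P2]] := pkernel_bound pc.
pose u := modulus (@unit_const1 R * unit_const1); have u0 : 0 <= u by exact: modulus_ge0.
exists (u * (8 * C1 + C2)); split; first by rewrite mulr_ge0 ?addr_ge0 ?mulr_ge0.
have w0 := @weight_ge0 R.
move=> [|k] z x; last first.
  rewrite thetaS !modulusM -modulusM -/u -mulrA -mulrA ler_wpM2l//.
  have -> : modulus (0 +i* 1 : R[i]) = 1 by rewrite modulusE /= expr0n expr1n add0r sqrtr1.
  rewrite mul1r (le_trans (modulusB _ _))//.
  have [_ h1] := P2 k (x - (z + 1)); have [_ h2] := P2 k (x - z).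
  rewrite opprD addrA in h1.
  have := w0 (2 ^+ k.+1 * (x - z)); have := w0 (2 ^+ k.+1 * (x - z - 1)).
  rewrite opprD addrA; move: h1 h2; move: (weight _) (weight _) (modulus _) (modulus _) => w w' m m'; nra.
rewrite expr0 !mul1r /theta; have [_ [_ ->]] := block1E pc 0 x (cinteg_chi z).
rewrite modulusM -/u -mulrA ler_wpM2l//.
have i := @integrable_ind R false false z (z + 1).
pose A := C1 * (4 * weight (x - z)).
have A0 : 0 <= A by rewrite mulr_ge0// mulr_ge0.
apply: (@le_trans _ _ (2 * Rintegral mu1 setT (fun y => A * ind `]z, z + 1] y))).
  apply: modulus_cint_le.
  - exact: (integrableZl measurableT A i).
  - by have [_ [h _]] := block1E pc 0 x (cinteg_chi z); exact: cinteg_cmeas h.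
  - move=> y; rewrite modulusM modulusC ger0_norm ?ind_ge0// mulrC indE in_itv/=.
    case: (boolP (z < y <= z + 1)) => [/andP[y1 y2]|_]; last by rewrite !mulr0.
    rewrite !mulr1; have [_ h] := P1 0%N (x - y); apply: (le_trans h).
    rewrite expr0 mulr1 mul1r ler_wpM2l//.
    apply: (le_trans (@weight_shift _ (x - y) (x - z) 1 _)).
      by rewrite ler_norml; apply/andP; split; lra.
    by rewrite expr1n mulr1 ler_wpM2r//; lra.
rewrite RintegralZl//.
have -> : Rintegral mu1 setT (ind `]z, z + 1]) = 1.
  rewrite /Rintegral /ind integral_indic//= setIT lebesgue_measure_itv/= lte_fin ltrDl ltr01.
  by rewrite -EFinB/= addrAC subrr add0r.
have := w0 (x - z); have := w0 (x - z - 1); rewrite /A; nra.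
Qed.

(** With e = |z - z'|, the two indicators differ only within e of z and of z + 1. The kernel bound
    is integrated over these two intervals of length 2e, on which 2^k e <= c lets [weight_shift]
    freeze the weight. *)
Lemma theta_lip c : 0 <= c -> exists C : R, 0 <= C /\ forall k z z' x,
  2 ^+ k * `|z - z'| <= c ->
  modulus (theta k z x - theta k z' x) <=
    C * (2 ^+ k * `|z - z'|) * (weight (2 ^+ k * (x - z)) + weight (2 ^+ k * (x - z - 1))).
Proof.
move=> c0; have [C1 [C10 P1]] := kernel_bound pc.
pose u := modulus (@unit_const1 R * unit_const1); have u0 : 0 <= u by exact: modulus_ge0.
have w0 := @weight_ge0 R.
exists (u * (4 * C1 * (2 + 2 * c ^+ 2))); split.
  by rewrite !mulr_ge0// addr_ge0// mulr_ge0// sqr_ge0.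
move=> k z z' x; set e := `|z - z'| => ec.
have e0 : 0 <= e by exact: normr_ge0.
have K0 : 0 <= 2 ^+ k :> R by rewrite exprn_ge0.
have [_ [i1 E1]] := block1E pc k x (cinteg_chi z).
have [_ [i2 E2]] := block1E pc k x (cinteg_chi z').
rewrite /theta E1 E2 -mulrBr modulusM -/u -!mulrA ler_wpM2l//.
rewrite -[X in _ + X]mulN1r -cintZ// -cintD//; last exact: cintegZ.
pose w1 := weight (2 ^+ k * (x - z)); pose w2 := weight (2 ^+ k * (x - z - 1)).
pose A := C1 * 2 ^+ k * (2 + 2 * c ^+ 2).
have A0 : 0 <= A by rewrite !mulr_ge0// addr_ge0// mulr_ge0// sqr_ge0.
have j1 := @integrable_ind R true false (z - e) (z + e).
have j2 := @integrable_ind R true false (z + 1 - e) (z + 1 + e).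
have k1 := integrableZl measurableT (A * w1) j1; have k2 := integrableZl measurableT (A * w2) j2.
apply: (@le_trans _ _ (2 * Rintegral mu1 setT (fun y => A * w1 * ind `[z - e, z + e] y +
    A * w2 * ind `[z + 1 - e, z + 1 + e] y))); last first.
  rewrite RintegralD; [|by []|exact: k1|exact: k2].
  rewrite RintegralZl// RintegralZl// !Rintegral_ind_cc; [|lra|lra].
  rewrite /A -/w1 -/w2; apply: eq_ler; ring.
apply: modulus_cint_le.
- exact: (integrableD measurableT k1 k2).
- by apply: cmeasD; [exact: cinteg_cmeas i1|apply: (@cinteg_cmeas _ _ _ mu1); exact: cintegZ].
move=> y; rewrite mulN1r -mulrBl modulusM.
have -> : chi z y - chi z' y = (ind `]z, z + 1] y - ind `]z', z' + 1] y)%:C by rewrite [RHS]rmorphB.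
rewrite modulusC.
have [_ h] := P1 k (x - y); rewrite !indE !in_itv/=.
have he1 : z - z' <= e by exact: ler_norm.
have he2 : z' - z <= e by rewrite /e distrC; exact: ler_norm.
have W t : `|y - t| <= e -> modulus (lpkernel phi0 k (x - y)) <= A * weight (2 ^+ k * (x - t)).
  move=> yt; apply: (le_trans h); rewrite /A -(mulrA (C1 * 2 ^+ k)); apply: ler_wpM2l; first exact: mulr_ge0.
  apply: weight_shift; rewrite -mulrBr normrM (ger0_norm K0) (le_trans _ ec)//.
  by rewrite ler_wpM2l// (_ : x - y - (x - t) = - (y - t)) ?normrN//; ring.
have W1 := W z.
have W2 : `|y - (z + 1)| <= e -> modulus (lpkernel phi0 k (x - y)) <= A * w2.
  by move=> /W; rewrite opprD addrA.
have m0 := modulus_ge0 (lpkernel phi0 k (x - y)).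
have Aw1 : 0 <= A * w1 by apply: mulr_ge0 => //; exact: w0.
have Aw2 : 0 <= A * w2 by apply: mulr_ge0 => //; exact: w0.
have sub (a b : R) : `|a - b| <= 1 -> modulus (lpkernel phi0 k (x - y)) * `|a - b| <= modulus (lpkernel phi0 k (x - y)).
  by move=> ?; rewrite ler_piMr.
have b01 (b1 b2 : bool) : `|b1%:R - b2%:R| <= 1 :> R.
  by case: b1; case: b2; rewrite /= ?subrr ?normr0 ?subr0 ?sub0r ?normrN ?normr1.
rewrite [leLHS]mulrC.
case: (boolP (z - e <= y <= z + e)) => [/andP[y1 y2]|n1].
  apply: (le_trans (sub _ _ (b01 _ _))); rewrite mulr1.
  apply: (@le_trans _ _ (A * w1)); last by rewrite lerDl mulr_ge0.
  by apply: W1; rewrite ler_norml; apply/andP; split; lra.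
case: (boolP (z + 1 - e <= y <= z + 1 + e)) => [/andP[y1 y2]|n2].
  apply: (le_trans (sub _ _ (b01 _ _))); rewrite mulr1 mulr0 add0r.
  by apply: W2; rewrite ler_norml; apply/andP; split; lra.
have -> : (z < y <= z + 1) = (z' < y <= z' + 1).
  move: n1 n2; rewrite !negb_and -!ltNge => /orP[] ? /orP[] ?; apply/idP/idP => /andP[? ?]; apply/andP; split; lra.
by rewrite subrr normr0 !mulr0 addr0.
Qed.

Definition theta_tent k x : R[i] := block1 phi0 k (fun y => (tent y)%:C) x.

(** The kernel is bounded and [tent_approx] is small in L_1. The constant may depend on [k] and [x],
    as only the limit of large [B] matters. *)
Lemma theta_tent_approx k x : exists C : R, forall B : nat, (0 < B)%N ->
  modulus (theta_tent k x - (B%:R^-1)%:C * \sum_(a < B) theta k (a%:R / B%:R) x) <= C / B%:R.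
Proof.
have [C1 [C10 P1]] := kernel_bound pc.
pose u := modulus (@unit_const1 R * unit_const1); have u0 : 0 <= u by exact: modulus_ge0.
exists (u * (8 * (C1 * 2 ^+ k))) => B B0.
have [_ [it Et]] := block1E pc k x (cinteg_real integrable_tent).
have ic z := (block1E pc k x (cinteg_chi z)).2.1.
have Ec z := (block1E pc k x (cinteg_chi z)).2.2.
rewrite /theta_tent Et (eq_bigr (fun a : 'I_B => unit_const1 * unit_const1 *
  cint mu1 (fun y : RR => chi (a%:R / B%:R) y * lpkernel phi0 k (x - y)))); last first.
  by move=> a _; rewrite /theta Ec.
rewrite -mulr_sumr mulrCA -mulrBr modulusM -/u -mulrA ler_wpM2l//.
rewrite -cint_sum; last by move=> a; exact: ic.
have iS : cinteg mu1 (fun y : RR => \sum_(a < B) chi (a%:R / B%:R) y * lpkernel phi0 k (x - y)).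
  by apply: cinteg_sum => a; exact: ic.
rewrite -mulNr -cintZ// -cintD//; last exact: cintegZ.
pose A := C1 * 2 ^+ k * (2 / B%:R).
have K0 : 0 <= 2 ^+ k :> R by rewrite exprn_ge0.
have j1 := @integrable_ind R true false 0 2.
apply: (@le_trans _ _ (2 * Rintegral mu1 setT (fun y => A * ind `[0, 2] y))); last first.
  rewrite RintegralZl// Rintegral_ind_cc// /A; apply: eq_ler; ring.
apply: modulus_cint_le.
- exact: (integrableZl measurableT A j1).
- by apply: cmeasD; [exact: cinteg_cmeas it|apply: (@cinteg_cmeas _ _ _ mu1); exact: cintegZ].
move=> y; rewrite -mulr_suml mulrA -mulrDl modulusM.
have -> : (tent y)%:C + - (B%:R^-1)%:C * \sum_(a < B) chi (a%:R / B%:R) y =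
   (tent y - B%:R^-1 * \sum_(a < B) ind `]a%:R / B%:R, a%:R / B%:R + 1] y)%:C.
  by rewrite [RHS]rmorphB/= [X in _ = _ - X]rmorphM/= rmorph_sum/= mulNr.
rewrite modulusC mulrC /A -mulrA; apply: ler_pM.
- exact: modulus_ge0.
- exact: normr_ge0.
- have [_ h] := P1 k (x - y); apply: (le_trans h).
  by rewrite ler_piMr ?weight_le1// mulr_ge0.
- exact: tent_approx.
Qed.

End theta.

(** * Discrepancy of uniform point families *)

Section averages.
Variable F : numFieldType.
Implicit Types (g h : nat -> F).

Definition avg (n : nat) g : F := n%:R^-1 * \sum_(c < n) g c.

Lemma sum_divn g P Q : (0 < Q)%N ->
  \sum_(a < P * Q) g (a %/ Q)%N = Q%:R * \sum_(c < P) g c.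
Proof.
move=> Q0; rewrite -(big_mkord xpredT (fun a => g (a %/ Q)%N)).
elim: P => [|P IH]; first by rewrite mul0n big_geq// big_ord0 mulr0.
rewrite (@big_cat_nat _ _ _ (P * Q)) ?leq_mul2r ?leqnSn ?orbT//= IH big_ord_recr/= mulrDr.
congr (_ + _); rewrite -{1}[(P * Q)%N]add0n mulSn big_addn addnK.
rewrite (eq_big_nat _ _ (F2 := fun=> g P)).
  by rewrite big_const_nat subn0 iter_addr_0 mulr_natl.
by move=> a /andP[_ aQ]; rewrite divnDMl// divn_small// add0n.
Qed.

(** Each c < b^l is the quotient of exactly b^(L - l) numbers a < b^L. *)
Lemma avg_divn g b L l : (0 < b)%N -> (l <= L)%N ->
  avg (b ^ L) (fun a => g (a %/ b ^ (L - l))%N) = avg (b ^ l) g.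
Proof.
move=> b0 lL; rewrite /avg.
have -> : \sum_(a < b ^ L) g (a %/ b ^ (L - l))%N = (b ^ (L - l))%:R * \sum_(c < b ^ l) g c.
  by rewrite -sum_divn ?expn_gt0 ?b0// -expnD subnKC.
have bU e : (b ^ e)%:R != 0 :> F by rewrite pnatr_eq0 expn_eq0; case: b b0.
rewrite mulrA; congr (_ * _).
by rewrite -{1}(subnK lL) expnD natrM invfM mulrAC mulVf ?mul1r.
Qed.

End averages.

Section net.
Context {d N : nat}.

(** Exactness on elementary boxes: [A v i] encodes L digits of a coordinate, and the quotient keeps
    the leading [l i]. The field varies because both complex block values and real majorants are
    averaged. *)
Definition net_uniform (b L m : nat) (A : 'I_N -> 'I_d -> nat) : Prop :=
  forall (F : numFieldType) (l : 'I_d -> nat) (h : 'I_d -> nat -> F),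
    (\sum_i l i <= m)%N ->
    N%:R^-1 * \sum_v \prod_i h i (A v i %/ b ^ (L - l i))%N =
      \prod_i avg (b ^ l i) (h i).

End net.

Section telescoping.
Context {R : realType}.
Variables (b L : nat).
Hypothesis b1 : (1 < b)%N.
Implicit Types (h : nat -> R[i]) (W : nat -> R) (j l a : nat).

Definition coarse h l a : R[i] := h (a %/ b ^ (L - l) * b ^ (L - l))%N.

(** Levels coarser than [j] bring no decay, so they are merged into the term at [j]; the value 0
    below [j] lets all coordinates share one index range. *)
Definition detail j h l a : R[i] :=
  if (l < j)%N then 0 else if l == j then coarse h l a
  else coarse h l a - coarse h l.-1 a.

Lemma sum_detail j h a : (j <= L)%N -> \sum_(l < L.+1) detail j h l a = h a.
Proof.
move=> jL; have E n : \sum_(l < n.+1) detail j h l a = if (n < j)%N then 0 else coarse h n a.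
  elim: n => [|n IH].
    rewrite big_ord_recl big_ord0 addr0 /detail/=.
    by case: ltnP => //; rewrite leqn0 => /eqP ->.
  rewrite big_ord_recr/= IH /detail; case: (ltngtP n.+1 j) => nj.
  - by rewrite addr0.
  - by rewrite /= subrKC.
  - by rewrite -?nj ?ltnSn add0r.
by rewrite E ltnNge jL/= /coarse subnn expn0 divn1 muln1.
Qed.

Definition detail_fun j h l (c : nat) : R[i] :=
  if (l < j)%N then 0 else if l == j then h (c * b ^ (L - l))%N
  else h (c * b ^ (L - l))%N - h (c %/ b * b ^ (L - l.-1))%N.

Lemma detail_funE j h l a : (l <= L)%N -> detail j h l a = detail_fun j h l (a %/ b ^ (L - l))%N.
Proof.
move=> lL; rewrite /detail /detail_fun /coarse; case: ltnP => // jl; case: eqP => // lj.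
congr (_ - h (_ * _)%N); rewrite -divnMA -expnSr; congr (_ %/ b ^ _)%N; lia.
Qed.

Lemma avg_detail j h l : (l <= L)%N ->
  avg (b ^ L) (detail j h l) = avg (b ^ l) (detail_fun j h l).
Proof.
move=> lL; rewrite -(avg_divn _ (ltnW b1) lL) /avg; congr (_ * _).
by apply: eq_bigr => a _; rewrite detail_funE.
Qed.

Lemma modulus_avg n h W : (forall a, (a < n)%N -> modulus (h a) <= W a) ->
  modulus (avg n h) <= avg n W.
Proof.
move=> hW; rewrite /avg modulusM.
have -> : modulus (n%:R^-1 : R[i]) = n%:R^-1.
  have -> : (n%:R^-1 : R[i]) = (n%:R^-1 : R)%:C by rewrite fmorphV rmorph_nat.
  by rewrite modulusC ger0_norm// invr_ge0.
apply: ler_wpM2l; first by rewrite invr_ge0.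
by apply: (le_trans (modulus_sum _ _ _)); apply: ler_sum => a _; exact: hW.
Qed.

(** * Comparison of the net with the full grid *)

Section estimate.
Variables (d N m : nat) (A : 'I_N -> 'I_d -> nat) (j : 'I_d -> nat)
  (h : 'I_d -> nat -> R[i]) (W : 'I_d -> nat -> R) (K beta : R).
Hypotheses (mL : (m <= L)%N) (AL : forall v i, (A v i < b ^ L)%N)
  (NU : net_uniform b L m A) (jm : (\sum_i j i <= m)%N)
  (K0 : 0 <= K) (W0 : forall i c, 0 <= W i c)
  (betab : b%:R^-1 <= beta) (beta1 : beta < 1)
  (hW : forall i l a, (j i <= l <= L)%N -> (a < b ^ L)%N ->
    modulus (detail (j i) (h i) l a) <= K * b%:R^-1 ^+ (l - j i) * W i (a %/ b ^ (L - j i))%N).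

Let b0 : 0 < b%:R^-1 :> R. Proof. by rewrite invr_gt0 ltr0n ltnW. Qed.
Let beta0 : 0 < beta. Proof. exact: lt_le_trans betab. Qed.

Let jL i : (j i <= L)%N.
Proof. by rewrite (leq_trans _ mL)// (leq_trans _ jm)// (bigD1 i)//= leq_addr. Qed.

Let q i (l : nat) : R := if (l < j i)%N then 0 else K * b%:R^-1 ^+ (l - j i).

Let q0 i l : 0 <= q i l.
Proof. by rewrite /q; case: ifP => // _; rewrite mulr_ge0// exprn_ge0// ltW. Qed.

Let detail_le i l a : (l <= L)%N -> (a < b ^ L)%N ->
  modulus (detail (j i) (h i) l a) <= q i l * W i (a %/ b ^ (L - j i))%N.
Proof.
move=> lL aL; rewrite /q; case: ltnP => jl; last by rewrite hW// jl.
by rewrite /detail jl modulus0 mul0r.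
Qed.

(** The mean of the product of majorants. It is the same for the net and for the grid, as the
    majorants see only [j i] leading digits and [\sum_i j i <= m]. *)
Let G : R := \prod_i avg (b ^ j i) (W i).

Let G0 : 0 <= G.
Proof.
apply: prodr_ge0 => i _; rewrite /avg mulr_ge0 ?invr_ge0//.
by apply: sumr_ge0 => c _; exact: W0.
Qed.

Let uniform_part (l : {ffun 'I_d -> 'I_L.+1}) :
  modulus (\prod_i avg (b ^ L) (detail (j i) (h i) (l i))) <= (\prod_i q i (l i)) * G.
Proof.
rewrite modulus_prod /G -big_split/=; apply: ler_prod => i _.
rewrite modulus_ge0/= -(avg_divn (W i) (ltnW b1) (jL i)).
rewrite [leRHS](_ : _ = avg (b ^ L) (fun a => q i (l i) * W i (a %/ b ^ (L - j i))%N)).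
  by apply: modulus_avg => a aL; apply: detail_le => //; rewrite -ltnS.
by rewrite /avg mulrCA -mulr_sumr.
Qed.

Let net_part (l : {ffun 'I_d -> 'I_L.+1}) :
  modulus (N%:R^-1 * \sum_v \prod_i detail (j i) (h i) (l i) (A v i)) <= (\prod_i q i (l i)) * G.
Proof.
rewrite /G -(NU W jm) modulusM mulrCA.
have -> : modulus (N%:R^-1 : R[i]) = N%:R^-1.
  have -> : (N%:R^-1 : R[i]) = (N%:R^-1 : R)%:C by rewrite fmorphV rmorph_nat.
  by rewrite modulusC ger0_norm// invr_ge0.
apply: ler_wpM2l; first by rewrite invr_ge0.
apply: (le_trans (modulus_sum _ _ _)); rewrite mulr_sumr; apply: ler_sum => v _.
rewrite modulus_prod -big_split/=; apply: ler_prod => i _.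
by rewrite modulus_ge0/= detail_le// -ltnS.
Qed.

Let cancel (l : {ffun 'I_d -> 'I_L.+1}) : (\sum_i l i <= m)%N ->
  N%:R^-1 * \sum_v \prod_i detail (j i) (h i) (l i) (A v i) =
  \prod_i avg (b ^ L) (detail (j i) (h i) (l i)).
Proof.
move=> lm; have lL i : (l i <= L)%N by rewrite -ltnS.
rewrite (eq_bigr (fun v => \prod_i detail_fun (j i) (h i) (l i) (A v i %/ b ^ (L - l i))%N)); last first.
  by move=> v _; apply: eq_bigr => i _; rewrite detail_funE.
rewrite (NU (l := fun i => l i) (fun i => detail_fun (j i) (h i) (l i)))//.
by apply: eq_bigr => i _; rewrite avg_detail.
Qed.

Let p i (l : nat) : R := if (l < j i)%N then 0 else K * beta ^+ (l - j i).

Let p0 i l : 0 <= p i l.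
Proof. by rewrite /p; case: ifP => // _; rewrite mulr_ge0// exprn_ge0// ltW. Qed.

(* [1 / b <= beta] trades the constraint [m < sum l] for a geometric factor. *)
Let chernoff (l : {ffun 'I_d -> 'I_L.+1}) : (m < \sum_i l i)%N ->
  \prod_i q i (l i) <= (b%:R^-1 / beta) ^+ (m - \sum_i j i) * \prod_i p i (l i).
Proof.
move=> ml; have g0 : 0 <= b%:R^-1 / beta by rewrite divr_ge0 ?ltW.
have g1 : b%:R^-1 / beta <= 1 by rewrite ler_pdivrMr// mul1r.
case: (pselect (forall i, j i <= l i)%N) => [jl|].
  rewrite (eq_bigr (fun i => (b%:R^-1 / beta) ^+ (l i - j i) * p i (l i))); last first.
    move=> i _; rewrite /q /p ltnNge jl/= mulrCA -exprMn divfK// gt_eqF//.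
  rewrite big_split/= ler_wpM2r ?prodr_ge0//.
  rewrite -expr_sum; have -> : (\sum_i (l i - j i) = \sum_i l i - \sum_i j i)%N by rewrite sumnB.
  by apply: ler_wiXn2l => //; rewrite leq_sub2r// ltnW.
move=> /existsNP[i /negP]; rewrite -ltnNge => li.
rewrite (bigD1 i)//= {1}/q li mul0r mulr_ge0 ?exprn_ge0//.
by apply: prodr_ge0 => k _; exact: p0.
Qed.

Let sum_p i : \sum_(l < L.+1) p i l <= K / (1 - beta).
Proof.
have geo n : \sum_(l < n) beta ^+ l <= (1 - beta)^-1.
  have h1 : 0 < 1 - beta by rewrite subr_gt0.
  have E := subrX1 beta n; rewrite -[leRHS]mul1r ler_pdivlMr// mulrC.
  have -> : (1 - beta) * \sum_(l < n) beta ^+ l = 1 - beta ^+ n by rewrite -opprB mulNr -E opprB.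
  by rewrite lerBlDr lerDl exprn_ge0// ltW.
apply: (@le_trans _ _ (K * \sum_(l < L.+1) beta ^+ l)); last by rewrite ler_wpM2l.
rewrite -!(big_mkord xpredT).
rewrite (@big_cat_nat _ _ _ (j i)) ?leqW//= big_nat_cond big1 ?add0r; last first.
  by move=> l; rewrite andbT /p => /andP[_ ->].
rewrite -{1}[j i]add0n big_addn mulr_sumr.
rewrite [leRHS](@big_cat_nat _ _ _ (L.+1 - j i)) ?leq_subr//=.
rewrite -[leLHS]addr0; apply: lerD; last first.
  by apply: sumr_ge0 => l _; rewrite mulr_ge0// exprn_ge0// ltW.
by apply: ler_sum => l _; rewrite /p ltnNge leq_addl/= addnK.
Qed.

(** Expanding both products over all level vectors l gives a sum of errors. Those of total level at
    most m vanish by [cancel]; in the others net and grid are bounded separately, whence the factor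
    2. *)
Lemma discrepancy_bound :
  modulus (N%:R^-1 * \sum_v \prod_i h i (A v i) - \prod_i avg (b ^ L) (h i)) <=
  2 * (K / (1 - beta)) ^+ d * (b%:R^-1 / beta) ^+ (m - \sum_i j i) * G.
Proof.
pose T (l : {ffun 'I_d -> 'I_L.+1}) :=
  N%:R^-1 * (\sum_v \prod_i detail (j i) (h i) (l i) (A v i)) -
  \prod_i avg (b ^ L) (detail (j i) (h i) (l i)).
have -> : N%:R^-1 * \sum_v \prod_i h i (A v i) - \prod_i avg (b ^ L) (h i) = \sum_l T l.
  rewrite /T sumrB -mulr_sumr exchange_big/=; congr (_ * _ - _).
    apply: eq_bigr => v _.
    rewrite -(bigA_distr_bigA (fun i (l : 'I_L.+1) => detail (j i) (h i) l (A v i))).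
    by apply: eq_bigr => i _; rewrite sum_detail.
  rewrite -(bigA_distr_bigA (fun i (l : 'I_L.+1) => avg (b ^ L) (detail (j i) (h i) l))).
  apply: eq_bigr => i _; rewrite /avg -mulr_sumr exchange_big/=; congr (_ * _).
  by apply: eq_bigr => a _; rewrite sum_detail.
apply: (le_trans (modulus_sum _ _ _)).
have g0 : 0 <= b%:R^-1 / beta by rewrite divr_ge0 ?ltW.
(* The condition on the total level now sits in a constant factor, so the sum over all l splits into
   d geometric series. *)
apply: (@le_trans _ _ (\sum_(l : {ffun 'I_d -> 'I_L.+1})
    (2 * (b%:R^-1 / beta) ^+ (m - \sum_i j i) * G) * \prod_i p i (l i))).
  apply: ler_sum => l _; case: (leqP (\sum_i l i) m) => ml.
    rewrite /T cancel// subrr modulus0 mulr_ge0//; last by apply: prodr_ge0 => *; exact: p0.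
    by rewrite !mulr_ge0// exprn_ge0.
  apply: (le_trans (modulusB _ _)).
  have h1 := net_part l; have h2 := uniform_part l; have h3 := ler_wpM2r G0 (chernoff ml).
  apply: (le_trans (lerD h1 h2)).
  have -> : 2 * (b%:R^-1 / beta) ^+ (m - \sum_i j i) * G * (\prod_i p i (l i)) =
    (b%:R^-1 / beta) ^+ (m - \sum_i j i) * (\prod_i p i (l i)) * G +
    (b%:R^-1 / beta) ^+ (m - \sum_i j i) * (\prod_i p i (l i)) * G by ring.
  exact: lerD.
rewrite -mulr_sumr -(bigA_distr_bigA (fun i (l : 'I_L.+1) => p i l)).
have -> : 2 * (K / (1 - beta)) ^+ d * (b%:R^-1 / beta) ^+ (m - \sum_i j i) * G =
  2 * (b%:R^-1 / beta) ^+ (m - \sum_i j i) * G * (K / (1 - beta)) ^+ d by ring.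
apply: ler_wpM2l; first by rewrite !mulr_ge0// exprn_ge0.
rewrite -[X in _ ^+ X]card_ord -prodr_const; apply: ler_prod => i _.
by rewrite sum_p andbT sumr_ge0.
Qed.

End estimate.

End telescoping.

(** * Digital nets *)

Section digits.
Variable b : nat.
Hypothesis b1 : (1 < b)%N.
Implicit Types (f g : nat -> nat) (s l k : nat).

(** Digit 0 is the most significant one, as in expansions of numbers in [0, 1), so truncation is
    division by a power of [b]. *)
Fixpoint digits_value s f : nat :=
  if s is s'.+1 then (digits_value s' f * b + f s')%N else 0%N.

Lemma digits_value_sum s f :
  digits_value s f = (\sum_(k < s) f k * b ^ (s - k.+1))%N.
Proof.
elim: s => [|s IH] /=; first by rewrite big_ord0.
rewrite big_ord_recr/= subnn expn0 muln1 IH big_distrl/=; congr (_ + _)%N.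
by apply: eq_bigr => k _; rewrite -mulnA -expnSr; congr (_ * b ^ _)%N; have := ltn_ord k; lia.
Qed.

Lemma digits_value_lt s f : (forall k, (f k < b)%N) -> (digits_value s f < b ^ s)%N.
Proof.
move=> fb; elim: s => [|s IH] //=; rewrite expnSr.
apply: (@leq_trans (digits_value s f * b + b)); first by rewrite ltn_add2l.
by rewrite -mulSnr leq_mul2r IH orbT.
Qed.

Lemma digits_value_div s l f : (forall k, (f k < b)%N) -> (l <= s)%N ->
  (digits_value s f %/ b ^ (s - l) = digits_value l f)%N.
Proof.
move=> fb; elim: s => [|s IH]; first by rewrite leqn0 => /eqP ->; rewrite divn1.
rewrite leq_eqVlt => /orP[/eqP ->|ls]; first by rewrite subnn divn1.
rewrite subSn// expnS divnMA /= divnMDl; last by rewrite ltnW.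
by rewrite (divn_small (fb s)) addn0 IH.
Qed.

Lemma digits_value_inj s f g : (forall k, (f k < b)%N) -> (forall k, (g k < b)%N) ->
  digits_value s f = digits_value s g -> forall k, (k < s)%N -> f k = g k.
Proof.
move=> fb gb; elim: s => [|s IH] //= E.
have E1 : f s = g s.
  by move: (congr1 (modn^~ b) E); rewrite !modnMDl !modn_small.
move=> k; rewrite ltnS leq_eqVlt => /orP[/eqP -> //|ks]; apply: IH => //.
apply/eqP; move/eqP: E; rewrite E1 eqn_add2r eqn_pmul2r//; exact: ltnW.
Qed.

Lemma eq_digits_value s f g : (forall k, (k < s)%N -> f k = g k) ->
  digits_value s f = digits_value s g.
Proof.
elim: s => [|s IH] //= fg; rewrite IH; first by rewrite fg.
by move=> k ks; apply: fg; rewrite ltnW.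
Qed.

End digits.

Section digital.
Variable b : nat.
Hypothesis pb : prime b.
Let b1 : (1 < b)%N := prime_gt1 pb.

Definition coord_digit s (y : 'cV['F_b]_s) (k : nat) : nat :=
  if insub k is Some k' then y k' 0 else 0%N.

Lemma Fb_lt (x : 'F_b) : (x < b)%N.
Proof. by have := ltn_ord x; rewrite [in X in (_ < X)%N](pdiv_id pb) (Zp_cast b1). Qed.

Lemma coord_digit_lt s (y : 'cV['F_b]_s) k : (coord_digit y k < b)%N.
Proof. by rewrite /coord_digit; case: insub => [k'|]; [exact: Fb_lt|rewrite ltnW]. Qed.

Lemma coord_digitE s (y : 'cV['F_b]_s) (k : 'I_s) : coord_digit y k = y k 0.
Proof. by rewrite /coord_digit valK. Qed.

(** This is b^s times the number in [0, 1) whose base b digits are the entries of [y]. *)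
Definition column_value s (y : 'cV['F_b]_s) : nat := digits_value b s (coord_digit y).

Lemma column_value_lt s (y : 'cV['F_b]_s) : (column_value y < b ^ s)%N.
Proof. exact/digits_value_lt/coord_digit_lt. Qed.

Lemma card_column s : #|'cV['F_b]_s| = (b ^ s)%N.
Proof. by rewrite card_mx muln1 card_Fp. Qed.

Lemma sum_column (F : numFieldType) s (g : nat -> F) :
  \sum_(y : 'cV['F_b]_s) g (column_value y) = \sum_(a < b ^ s) g a.
Proof.
pose V (y : 'cV['F_b]_s) : 'I_(b ^ s) := Ordinal (column_value_lt y).
have Vinj : injective V.
  move=> y z /(congr1 val) /= E; apply/matrixP => k j; rewrite ord1.
  apply/val_inj; rewrite /= -!coord_digitE.
  by apply: (digits_value_inj b1 _ _ E) => // i; exact: coord_digit_lt.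
have Vbij : bijective V by apply: inj_card_bij => //; rewrite card_ord card_column.
rewrite [RHS](reindex V)//=; exact: onW_bij.
Qed.

Lemma digit_vector_inj n : injective (fun v : 'I_(b ^ n) => digit_vector b n v).
Proof.
move=> v w /matrixP E; apply/val_inj => /=.
have E1 j : (j < n)%N -> (v %/ b ^ j %% b = w %/ b ^ j %% b)%N.
  move=> jn; have := E (Ordinal jn) 0; rewrite !mxE /= => /(congr1 val).
  by rewrite /= !val_Fp_nat// !modn_mod.
move: (ltn_ord v) (ltn_ord w) E1; move: (v : nat) (w : nat) => {E}v {}w.
elim: n v w => [|n IH] v w; first by rewrite expn0 !ltnS !leqn0 => /eqP -> /eqP ->.
move=> vn wn E; rewrite (divn_eq v b) (divn_eq w b).
have := E 0%N (ltn0Sn _); rewrite expn0 !divn1 => ->; congr (_ * _ + _)%N.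
have b0 : (0 < b)%N by exact: ltnW.
apply: IH; [by rewrite ltn_divLR// -expnSr|by rewrite ltn_divLR// -expnSr|].
by move=> j jn; rewrite -!divnMA -expnS E.
Qed.

Lemma sum_digit_vector (F : numFieldType) n (g : 'cV['F_b]_n -> F) :
  \sum_(v < b ^ n) g (digit_vector b n v) = \sum_w g w.
Proof.
rewrite [RHS](reindex (fun v : 'I_(b ^ n) => digit_vector b n v))//.
apply: onW_bij; apply: inj_card_bij; first exact: digit_vector_inj.
by rewrite card_ord card_column.
Qed.

(** A matrix with independent rows has a right inverse [B], and [w] is [B] times the prescribed
    column. *)
Lemma free_solve n (X : seq 'rV['F_b]_n) (c : nat -> 'F_b) : free X ->
  exists w : 'cV['F_b]_n, forall t, (t < size X)%N -> (X`_t *m w) 0 0 = c t.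
Proof.
move=> fX; pose A := \matrix_(t < size X) X`_t.
have /row_freeP[B AB] : row_free A.
  apply: inj_row_free => u uA; apply/rowP => t; rewrite mxE.
  have /freeP/(_ (fun t => u 0 t)) := (fX : free (in_tuple X)); apply.
  rewrite -[RHS]uA mulmx_sum_row; apply: eq_bigr => i _.
  by rewrite rowK.
exists (B *m \col_t c t) => t tX.
have := congr1 (fun D => (D *m \col_(t < size X) c t) (Ordinal tX) 0) AB.
rewrite /= mul1mx -mulmxA [RHS]mxE => <-.
rewrite [LHS]mxE [RHS]mxE; apply: eq_bigr => i _.
by congr (_ * _); rewrite mxE.
Qed.

Section net.
Variables (d s n v : nat) (M : 'I_d -> 'M['F_b]_(s, n)).
Hypothesis net : order_digital_net 1 v M.

(** The net condition makes the leading [l i] rows of all matrices jointly independent, so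
    [free_solve] prescribes leading digits in all coordinates at once. *)
Lemma net_solve (l : 'I_d -> nat) (e : 'I_d -> 'cV['F_b]_s) :
  (\sum_i l i <= n - v)%N ->
  exists w : 'cV['F_b]_n, forall i (k : 'I_s), (k < l i)%N -> (M i *m w) k 0 = e i k 0.
Proof.
case: net => ns _ _ fr ln.
(* Reversed, because [order_digital_net] lists row indices in decreasing order. *)
pose lam i := rev [seq k : 'I_s <- enum 'I_s | (k < l i)%N].
pose S := [seq (i, k) | i <- enum 'I_d, k <- lam i].
have lamS i (k : 'I_s) : (k < l i)%N -> (i, k) \in S.
  move=> ki; apply/allpairsPdep; exists i, k; split => //; first by rewrite mem_enum.
  by rewrite mem_rev mem_filter ki mem_enum.
have val_lam i : map val (lam i) = rev (iota 0 (minn (l i) s)).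
  rewrite /lam map_rev -(filter_map val (fun k => k < l i)%N) val_enum_ord; congr rev.
  case: (leqP (l i) s) => lis.
    rewrite -{1}(subnKC lis) iotaD filter_cat add0n.
    rewrite (all_filterP _); last by apply/allP => k; rewrite mem_iota add0n => /andP[].
    rewrite (eq_in_filter (a2 := pred0)) ?filter_pred0 ?cats0// => k.
    by rewrite mem_iota => /andP[]; rewrite leqNgt => /negbTE.
  apply/all_filterP/allP => k; rewrite mem_iota add0n => /andP[_ ks].
  exact: ltn_trans ks lis.
have sorted_lam i : sorted (fun k l : 'I_s => (l < k)%N) (lam i).
  have := @sorted_map _ _ (val : 'I_s -> nat) (fun k l => l < k)%N (lam i).
  rewrite val_lam rev_sorted; move=> h; rewrite -[sorted _ _]h; exact: iota_ltn_sorted.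
have fS : free [seq row x.2 (M x.1) | x <- S].
  rewrite map_allpairs; apply: fr => //.
  (* For order 1 only the largest index of each coordinate enters the sum, and [k < l i] bounds its
     one-based value by [l i]. *)
  rewrite mul1n; apply: leq_trans ln; apply: leq_sum => i _.
  have : (forall k : 'I_s, k \in lam i -> k < l i)%N.
    by move=> k; rewrite mem_rev mem_filter => /andP[].
  case: (lam i) => [|k t] h; first by rewrite big_nil.
  by rewrite /= take0 big_seq1 h// mem_head.
have [w ww] := free_solve (fun t => if insub t is Some t' then
    (e (tnth (in_tuple S) t').1 (tnth (in_tuple S) t').2 0 : 'F_b) else 0) fS.
exists w => i k ki.
have xS := lamS i k ki; have tS : (index (i, k) S < size S)%N by rewrite index_mem.
have := ww (index (i, k) S); rewrite size_map => /(_ tS).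
rewrite (nth_map (i, k))// nth_index//= insubT /= (tnth_nth (i, k)) nth_index//=.
by move=> <-; rewrite !mxE; apply: eq_bigr => j _; rewrite !mxE.
Qed.

(** The s digits of the coordinate, padded with zeros to L digits. *)
Definition net_digits (L : nat) (m : 'I_(b ^ n)) (i : 'I_d) : nat :=
  (column_value (M i *m digit_vector b n m) * b ^ (L - s))%N.

Lemma net_digits_lt L m i : (s <= L)%N -> (net_digits L m i < b ^ L)%N.
Proof.
move=> sL; rewrite -[X in (_ < b ^ X)%N](subnKC sL) expnD ltn_pmul2r ?column_value_lt//.
by rewrite expn_gt0 ltnW.
Qed.

Lemma digital_netE (R : realType) L m i : (s <= L)%N ->
  digital_net M m 0 i = (net_digits L m i)%:R / (b ^ L)%:R :> R.
Proof.
move=> sL; have bU e : (b%:R ^+ e : R) != 0 by rewrite expf_neq0// pnatr_eq0 -lt0n ltnW.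
rewrite mxE /net_digits -[X in (b ^ X)%:R^-1](subnKC sL) expnD !natrM invfM mulrACA.
rewrite divff; last by rewrite natrX.
rewrite natrX mulr1 /column_value digits_value_sum// natr_sum mulr_suml.
apply: eq_bigr => k _; rewrite coord_digitE natrM natrX -mulrA; congr (_ * _).
rewrite -[X in _ / _ ^+ X](subnK (ltn_ord k)) exprD invfM mulrA divff ?mul1r//.
Qed.

(** By [net_solve], any shift e of the image columns agrees on the relevant leading digits with a
    translation of w, so the sum over w is invariant under e. Averaging over all e replaces the
    columns by independent uniform ones. *)
Lemma net_uniform_digits L : (s <= L)%N -> net_uniform b L (n - v) (net_digits L).
Proof.
move=> sL F l h ln.
have ls i : (l i <= s)%N.
  case: net => ns _ _ _; apply: leq_trans ns; apply: leq_trans (leq_subr v n).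
  by apply: leq_trans ln; rewrite (bigD1 i)//= leq_addr.
pose g i (y : 'cV['F_b]_s) := h i (digits_value b (l i) (coord_digit y)).
have digE m i : (net_digits L m i %/ b ^ (L - l i))%N =
    digits_value b (l i) (coord_digit (M i *m digit_vector b n m)).
  have -> : (L - l i = L - s + (s - l i))%N by have := ls i; lia.
  rewrite expnD divnMA /net_digits mulnK ?expn_gt0 ?(ltnW b1)//.
  by rewrite digits_value_div//; exact: coord_digit_lt.
transitivity ((b ^ n)%:R^-1 * \sum_(w : 'cV['F_b]_n) \prod_i g i (M i *m w)).
  congr (_ * _); rewrite -sum_digit_vector; apply: eq_bigr => m _.
  by apply: eq_bigr => i _; rewrite digE.
pose T := {ffun 'I_d -> 'cV['F_b]_s}.
have shift (e : T) : \sum_(w : 'cV['F_b]_n) \prod_i g i (M i *m w) =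
    \sum_(w : 'cV['F_b]_n) \prod_i g i (M i *m w + e i).
  have [w0 w0E] := net_solve e ln.
  rewrite (reindex_inj (addIr w0)); apply: eq_bigr => w _; apply: eq_bigr => i _.
  congr (h i _); apply: eq_digits_value => k kl.
  have ks : (k < s)%N := leq_trans kl (ls i).
  rewrite -[k]/(val (Ordinal ks)) !coord_digitE mulmxDr [in LHS]mxE [in RHS]mxE.
  by rewrite (w0E i (Ordinal ks) kl).
have cT : #|T|%:R != 0 :> F.
  by rewrite card_ffun card_column pnatr_eq0 !expn_eq0; case: b b1.
have cb e : (b ^ e)%:R != 0 :> F by rewrite pnatr_eq0 expn_eq0; case: b b1.
apply: (mulfI cT); rewrite mulrCA mulr_natl -[in LHS]sumr_const.
rewrite (eq_bigr _ (fun (e : T) _ => shift e)).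
rewrite exchange_big/=.
rewrite (eq_bigr (fun=> \prod_i \sum_(y : 'cV['F_b]_s) g i y)); last first.
  move=> w _; rewrite bigA_distr_bigA [RHS](reindex_inj (addrI [ffun i => M i *m w])).
  by apply: eq_bigr => e _; apply: eq_bigr => i _; rewrite !ffunE.
rewrite big_const iter_addr_0 card_column -[X in _ * X = _]mulr_natl mulKf ?cb//.
rewrite card_ffun card_column natrX -prodr_const -big_split/=.
apply: eq_bigr => i _; rewrite -(avg_divn (h i) (ltnW b1) (ls i)) /avg mulVKf ?cb//.
rewrite -(@sum_column F s (fun a => h i (a %/ b ^ (s - l i))%N)); apply: eq_bigr => y _.
by rewrite digits_value_div//; exact: coord_digit_lt.
Qed.

End net.

End digital.

(** * Sums of translated weights *)

Lemma Rintegral_scale_sum d (T : measurableType d) (R : realType)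
    (mu : {measure set T -> \bar R}) (I : Type) (s : seq I) (a : R) (h : I -> T -> R) :
  (forall i, mu.-integrable setT (EFin \o h i)) ->
  mu.-integrable setT (EFin \o (fun x => a * \sum_(i <- s) h i x)) /\
  Rintegral mu setT (fun x => a * \sum_(i <- s) h i x) = a * \sum_(i <- s) Rintegral mu setT (h i).
Proof.
move=> ih.
have [si sE] : mu.-integrable setT (EFin \o (fun x => \sum_(i <- s) h i x)) /\
    Rintegral mu setT (fun x => \sum_(i <- s) h i x) = \sum_(i <- s) Rintegral mu setT (h i).
  elim: s => [|i s [IH1 IH2]].
    rewrite (_ : (fun x => _) = fun=> 0); last by apply/funext => x; rewrite big_nil.
    by rewrite big_nil; split; [exact: integrable0|by rewrite /Rintegral integral0].
  rewrite (_ : (fun x => _) = fun x => h i x + \sum_(j <- s) h j x).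
    rewrite big_cons -IH2 RintegralD//; split => //.
    exact: (integrableD measurableT (ih i) IH1).
  by apply/funext => x; rewrite big_cons.
by rewrite -sE RintegralZl//; split => //; exact: (integrableZl measurableT a si).
Qed.

Section twin.
Context {R : realType}.
Local Notation mu1 := (@lebesgue_measure R).
Local Notation RR := (measurableTypeR R).
Implicit Types (l x y z t : R).

Lemma weightN t : weight (- t) = weight t.
Proof. by rewrite /weight /oneDsqr sqrrN. Qed.

Lemma le_weight (s t : R) : `|t| <= `|s| -> weight s <= weight t.
Proof.
move=> ts; rewrite /weight lef_pV2 ?posrE ?(lt_le_trans ltr01)//.
by rewrite lerD2l -(real_normK (num_real t)) -(real_normK (num_real s)) lerXn2r ?nnegrE.
Qed.

(** Each term is at most 4 times an increment of [atan], by the mean value theorem and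
    [weight_shift] with c = 1; the increments telescope to less than pi. *)
Lemma sum_weight n y : \sum_(c < n) weight (y - c%:R) <= 4 * pi.
Proof.
have h c : weight (y - c%:R) <= 4 * (atan (c.+1%:R - y) - atan (c%:R - y)).
  have lt1 : c%:R - y < c.+1%:R - y by rewrite ltrD2r ltr_nat.
  have [xi xiI ->] := MVT lt1 (fun x _ => is_derive1_atan x)
    (continuous_subspaceT (@continuous_atan R)).
  have -> : c.+1%:R - y - (c%:R - y) = 1 by rewrite -natr1; ring.
  rewrite mulr1 -weightN opprB.
  apply: (le_trans (@weight_shift _ _ xi 1 _)).
    move: xiI; rewrite in_itv/= -natr1 => /andP[h1 h2].
    by rewrite ler_norml; apply/andP; split; lra.
  by rewrite expr1n mulr1 (_ : 2 + 2 = 4) //; lra.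
apply: (@le_trans _ _ (\sum_(c < n) 4 * (atan (c.+1%:R - y) - atan (c%:R - y)))).
  by apply: ler_sum => c _; exact: h.
rewrite -mulr_sumr ler_pM2l// -(big_mkord xpredT (fun c => atan (c.+1%:R - y) - atan (c%:R - y))).
rewrite telescope_sumr//.
have := atan_ltpi2 (n%:R - y); have := atan_gtNpi2 (0%:R - y); lra.
Qed.

Lemma integral_weight_affine l z : 0 < l ->
  (\int[mu1]_x (weight (l * (x - z)))%:E = (pi / l)%:E)%E.
Proof.
move=> l0; pose F x : R := l * x + - (l * z).
have dF (x : R) : is_derive x 1 F l by exact: der_lin.
have F' : derive1 F = cst l by apply/funext => x; rewrite derive1E derive_val.
have cw : continuous (weight : R -> R) by exact: continuous_oneDsqrV.
have FN : F x @[x --> -oo%R] --> -oo%R.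
  apply/cvgrNyPle => M; exists ((M + l * z) / l); split=> [|x xM]; first exact: num_real.
  by rewrite /F lerBlDr mulrC -ler_pdivlMr// ltW.
have FP : F x @[x --> +oo%R] --> +oo%R.
  apply/cvgryPge => M; exists ((M + l * z) / l); split=> [|x xM]; first exact: num_real.
  by rewrite /F lerBrDr (mulrC l x) -ler_pdivrMr// ltW.
have E : (\int[mu1]_x (weight x)%:E = \int[mu1]_x (((weight \o F) * derive1 F)%R x)%:E)%E.
  apply: increasing_ge0_integration_by_substitutionT => //.
  - by move=> x y xy; rewrite /F ltrD2r ltr_pM2l.
  - by rewrite F' => x; exact: cst_continuous.
  - by rewrite F'; exact: is_cvg_cst.
  - by rewrite F'; exact: is_cvg_cst.
  - by move=> x; exact: weight_ge0.
have mF : measurable_fun setT (fun x : RR => (weight (l * (x - z)))%:E).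
  apply/measurable_EFinP; apply: (measurableT_comp measurable_weight).
  by apply: measurable_funM => //; exact: measurable_funB.
have : (l%:E * \int[mu1]_x (weight (l * (x - z)))%:E = pi%:E)%E.
  rewrite -integral_weight E -ge0_integralZl//.
  - by apply: eq_integral => x _; rewrite F' /= -EFinM mulrC /F mulrBr.
  - by move=> x _; rewrite lee_fin weight_ge0.
  - by rewrite lee_fin ltW.
move=> /(congr1 (fun u => (l^-1)%:E * u)%E); rewrite muleA -!EFinM mulVf ?gt_eqF// mul1e => ->.
by rewrite mulrC.
Qed.

(** The profile of [theta] at scale l: one bump at each jump of [chi z]. *)
Definition twin l x z := weight (l * (x - z)) + weight (l * (x - z - 1)).

Lemma twin_ge0 l x z : 0 <= twin l x z.
Proof. by rewrite addr_ge0 ?weight_ge0. Qed.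

Lemma integrable_weight_affine l z : 0 < l ->
  mu1.-integrable setT (EFin \o (fun x : RR => weight (l * (x - z)))).
Proof.
move=> l0; apply/integrableP; split.
  apply/measurable_EFinP; apply: (measurableT_comp measurable_weight).
  by apply: measurable_funM => //; exact: measurable_funB.
rewrite (_ : (fun x => _) = (fun x => (weight (l * (x - z)))%:E)).
  by rewrite integral_weight_affine// ltry.
by apply/funext => x /=; rewrite ger0_norm ?weight_ge0.
Qed.

Lemma integrable_twin l z : 0 < l ->
  mu1.-integrable setT (EFin \o (fun x : RR => twin l x z)).
Proof.
move=> l0; have := integrableD measurableT (integrable_weight_affine z l0)
  (integrable_weight_affine (z + 1) l0).
by apply: eq_integrable => // x _ /=; rewrite /twin opprD addrA.
Qed.

Lemma Rintegral_twin l z : 0 < l -> Rintegral mu1 setT (fun x : RR => twin l x z) = 2 * pi / l.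
Proof.
move=> l0; have i0 := integrable_weight_affine z l0.
have i1 := integrable_weight_affine (z + 1) l0.
rewrite (_ : (fun x : RR => twin l x z) = (fun x => weight (l * (x - z)) + weight (l * (x - (z + 1)))));
  last by apply/funext => x; rewrite /twin opprD addrA.
rewrite RintegralD// /Rintegral !integral_weight_affine//=; ring.
Qed.

(** Widening the bumps only enlarges them, and moving them by at most their new width costs the
    factor 4 of [weight_shift]. *)
Lemma twin_le l l' x z z' : 0 <= l' <= l -> l' * `|z - z'| <= 1 ->
  twin l x z <= 4 * twin l' x z'.
Proof.
move=> /andP[l'0 l'l] zz; rewrite /twin [leRHS]mulrDr.
have h e : weight (l * (x - z - e)) <= 4 * weight (l' * (x - z' - e)).
  apply: (@le_trans _ _ (weight (l' * (x - z - e)))).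
    by apply: le_weight; rewrite !normrM ler_wpM2r// !ger0_norm// (le_trans l'0).
  apply: (le_trans (@weight_shift _ _ (l' * (x - z' - e)) 1 _)).
    rewrite -mulrBr normrM (ger0_norm l'0) (_ : _ - _ = - (z - z')) ?normrN//; ring.
  by rewrite expr1n mulr1 (_ : 2 + 2 = 4) //; lra.
by apply: lerD; [have := h 0; rewrite !subr0|exact: h].
Qed.

(** Bumps of width 1/n spaced 1/n apart overlap boundedly, so their mean is of order 1/n both in sup
    norm and in integral. *)
Definition comb (n : nat) x : R := avg n (fun c => twin n%:R x (c%:R / n%:R)).

Lemma comb_ge0 n x : 0 <= comb n x.
Proof. by rewrite mulr_ge0 ?invr_ge0// sumr_ge0// => c _; exact: twin_ge0. Qed.

Lemma comb_le n x : (0 < n)%N -> comb n x <= 8 * pi / n%:R.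
Proof.
move=> n0; have nU : n%:R != 0 :> R by rewrite pnatr_eq0 -lt0n.
rewrite /comb /avg mulrC ler_wpM2r ?invr_ge0// /twin.
have E (e : R) (c : 'I_n) : n%:R * (x - c%:R / n%:R - e) = n%:R * (x - e) - c%:R by field.
rewrite (eq_bigr (fun c : 'I_n => weight (n%:R * (x - 0) - c%:R) + weight (n%:R * (x - 1) - c%:R))).
  have := sum_weight n (n%:R * (x - 0)); have := sum_weight n (n%:R * (x - 1)).
  rewrite big_split/=; lra.
by move=> c _; rewrite -!E subr0.
Qed.

Lemma Rintegral_comb n : (0 < n)%N -> mu1.-integrable setT (EFin \o (comb n : RR -> R)) /\
  Rintegral mu1 setT (comb n : RR -> R) = 2 * pi / n%:R.
Proof.
move=> n0; have n0' : 0 < n%:R :> R by rewrite ltr0n.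
have [i1 E] := Rintegral_scale_sum (index_enum 'I_n) n%:R^-1
  (fun c : 'I_n => integrable_twin (c%:R / n%:R) n0').
split => //; rewrite /comb /avg E.
rewrite (eq_bigr (fun=> 2 * pi / n%:R)); last by move=> c _; rewrite Rintegral_twin.
by rewrite sumr_const card_ord -[X in _ * X = _]mulr_natl mulKf// gt_eqF.
Qed.

End twin.

(** * Blocks in base-b cells *)

Section levels.
Context {R : realType}.
Variables (phi0 : R -> R[i]) (b : nat).
Hypothesis pc : cutoff phi0.
Hypothesis b1 : (1 < b)%N.
Implicit Types (x y z : R) (k j l L a : nat).

Let bX0 e : 0 < (b ^ e)%:R :> R.
Proof. by rewrite ltr0n expn_gt0 ltnW. Qed.

Let bXU e : (b ^ e)%:R != 0 :> R.
Proof. by rewrite gt_eqF. Qed.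

Let natb0 : (0 < b)%N := ltnW b1.

Definition level k := trunc_log b (2 ^ k).

Lemma level_bounds k : (b ^ level k <= 2 ^ k < b ^ (level k).+1)%N.
Proof. by rewrite trunc_logP ?expn_gt0// trunc_log_ltn. Qed.

(** Discretisation errors disappear as L grows, whatever the size of [C]. *)
Lemma le_eps_expn (u v C : R) L0 :
  (forall L, (L0 <= L)%N -> u <= v + C / (b ^ L)%:R) -> u <= v.
Proof.
move=> h; rewrite leNgt; apply/negP => vu; have uv0 : 0 < u - v by rewrite subr_gt0.
have [t tC] : exists t : nat, C / (u - v) < t%:R.
  by exists (Num.truncn (C / (u - v))).+1; rewrite truncnS_gt.
have := h (maxn L0 t) (leq_maxl _ _); rewrite -lerBlDl ler_pdivlMr// leNgt.
rewrite mulrC -ltr_pdivrMr//; apply/negP; rewrite negbK; apply: (lt_le_trans tC).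
rewrite ler_nat; apply: (leq_trans (leq_maxr L0 t)); exact: ltnW (ltn_expl _ b1).
Qed.

Definition cell_weight j x (c : nat) : R := twin (b ^ j)%:R x (c%:R / (b ^ j)%:R).

Lemma divn_dist L j a : (j <= L)%N ->
  (b ^ j)%:R * `|a%:R / (b ^ L)%:R - (a %/ b ^ (L - j))%:R / (b ^ j)%:R| <= 1 :> R.
Proof.
move=> jL; set D := _ - _; rewrite -[X in X * _](ger0_norm (ltW (bX0 j))) -normrM /D.
rewrite -{1}(subnK jL) expnD natrM {1}(divn_eq a (b ^ (L - j))) natrD natrM.
have -> : (b ^ j)%:R * (((a %/ b ^ (L - j))%:R * (b ^ (L - j))%:R + (a %% b ^ (L - j))%:R) /
   ((b ^ (L - j))%:R * (b ^ j)%:R) - (a %/ b ^ (L - j))%:R / (b ^ j)%:R) =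
   (a %% b ^ (L - j))%:R / (b ^ (L - j))%:R :> R.
  by have := bXU j; have := bXU (L - j); move: (b ^ j)%:R (b ^ (L - j))%:R => u w u0 w0; field; rewrite u0.
rewrite ger0_norm ?divr_ge0// ler_pdivrMr// mul1r ler_nat ltnW// ltn_pmod// expn_gt0 natb0//.
Qed.

Lemma theta_cell : exists C : R, 0 <= C /\ forall k j L a x, (b ^ j <= 2 ^ k)%N -> (j <= L)%N ->
  modulus (theta phi0 k (a%:R / (b ^ L)%:R) x) <= C * cell_weight j x (a %/ b ^ (L - j)).
Proof.
have [C [C0 P]] := theta_bound pc; exists (C * 4); split; first by rewrite mulr_ge0.
move=> k j L a x jk jL; apply: (le_trans (P k _ x)); rewrite -mulrA ler_wpM2l//.
apply: twin_le; last exact: divn_dist.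
by rewrite ltW//= -natrX ler_nat.
Qed.

Lemma avg_cell j L x : (j <= L)%N ->
  avg (b ^ L) (fun a => cell_weight j x (a %/ b ^ (L - j))) = comb (b ^ j) x.
Proof. by move=> jL; rewrite avg_divn. Qed.

Lemma cell_weight_ge0 j x c : 0 <= cell_weight j x c.
Proof. exact: twin_ge0. Qed.

(** This supplies the decay assumed in [discrepancy_bound]: [theta_cell] at the first level,
    [theta_lip] for the increments at finer ones. *)
Lemma theta_detail : exists C : R, 0 <= C /\ forall k L l a x, (level k <= l <= L)%N ->
  modulus (detail b L (level k) (fun a => theta phi0 k (a%:R / (b ^ L)%:R) x) l a) <=
  C * b%:R^-1 ^+ (l - level k) * cell_weight (level k) x (a %/ b ^ (L - level k)).
Proof.
have [C1 [C10 P1]] := theta_cell.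
have [C2 [C20 P2]] := theta_lip pc (ler0n R (b * b)).
exists (C1 + 4 * C2 * (b * b)%:R); split; first by rewrite addr_ge0// !mulr_ge0.
move=> k L l a x /andP[jl lL]; have /andP[lv1 lv2] := level_bounds k.
set j := level k in jl lv1 lv2 *.
have aE l' : (j <= l' <= L)%N -> ((a %/ b ^ (L - l') * b ^ (L - l')) %/ b ^ (L - j) = a %/ b ^ (L - j))%N.
  move=> /andP[jl' l'L]; have -> : (L - j = L - l' + (l' - j))%N by clear -jl' l'L; lia.
  by rewrite expnD !divnMA mulnK// expn_gt0 natb0.
have W0 := cell_weight_ge0 j x (a %/ b ^ (L - j)).
have b0R : 0 < b%:R :> R by rewrite ltr0n.
have g0 : 0 <= b%:R^-1 ^+ (l - j) :> R by rewrite exprn_ge0// invr_ge0.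
rewrite /detail ltnNge jl/=; case: eqP => [lj|/eqP lj].
  rewrite /coarse lj subnn expr0 mulr1; have := P1 k j L (a %/ b ^ (L - j) * b ^ (L - j))%N x lv1 (leq_trans jl lL).
  rewrite aE ?leqnn ?(leq_trans jl)// => /le_trans; apply; rewrite ler_wpM2r// lerDl !mulr_ge0//.
have jl1 : (j <= l.-1)%N by move: jl lj; clear; case: l => [|l'] /=; lia.
have l0 : (0 < l)%N by clear -jl lj; lia.
rewrite /coarse; set z := (a %/ b ^ (L - l) * b ^ (L - l))%N.
set z' := (a %/ b ^ (L - l.-1) * b ^ (L - l.-1))%N.
have zz' : (z' <= z < z' + b ^ (L - l.-1))%N.
  rewrite /z /z'; have -> : (L - l.-1 = L - l + 1)%N by clear -lL l0; lia.
  rewrite expnD expn1 divnMA.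
  have := leq_divM (a %/ b ^ (L - l)) b; have := ltn_ceil (a %/ b ^ (L - l)) natb0.
  have : (0 < b ^ (L - l))%N by rewrite expn_gt0 natb0.
  move: (b ^ (L - l))%N => Q; move: (a %/ Q)%N => A; move: (A %/ b)%N => B; clear; nia.
(* One factor b comes from 2^k < b^(j + 1), the other from truncation to l - 1 digits; so b^2 is the
   range given to [theta_lip]. *)
have dz : 2 ^+ k * `|z%:R / (b ^ L)%:R - z'%:R / (b ^ L)%:R| <= (b * b)%:R * b%:R^-1 ^+ (l - j) :> R.
  have /andP[h1 h2] := zz'.
  rewrite -mulrBl -natrB// ger0_norm ?divr_ge0// mulrA ler_pdivrMr//.
  apply: (@le_trans _ _ ((b ^ j.+1)%:R * (b ^ (L - l.-1))%:R)).
    rewrite -natrX -!natrM ler_nat leq_mul//; first exact: ltnW.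
    by rewrite leq_subLR ltnW.
  have -> : (L - l.-1 = (L - l).+1)%N by clear -lL l0; lia.
  have -> : (b ^ L)%:R = (b ^ (L - l))%:R * (b ^ (l - j))%:R * (b ^ j)%:R :> R.
    by rewrite -!natrM -!expnD -addnA (subnK jl) subnK.
  rewrite !expnS !natrM exprVn -natrX.
  apply: eq_ler; have := bXU (l - j); move: (b ^ (l - j))%:R => u u0; field; exact: u0.
have dzb : (b * b)%:R * b%:R^-1 ^+ (l - j) <= (b * b)%:R :> R.
  by rewrite ler_piMr// exprn_ile1// ?invr_ge0// invf_le1// ler1n.
apply: (le_trans (P2 k _ _ x (le_trans dz dzb))).
have tw : twin (2 ^+ k) x (z%:R / (b ^ L)%:R) <= 4 * cell_weight j x (a %/ b ^ (L - j)).
  rewrite -(aE l) ?jl//; apply: twin_le; last exact: (divn_dist z (leq_trans jl lL)).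
  by rewrite ltW//= -natrX ler_nat.
have d0 : 0 <= 2 ^+ k * `|z%:R / (b ^ L)%:R - z'%:R / (b ^ L)%:R| :> R by rewrite mulr_ge0 ?exprn_ge0.
apply: (@le_trans _ _ (C2 * ((b * b)%:R * b%:R^-1 ^+ (l - j)) * (4 * cell_weight j x (a %/ b ^ (L - j))))).
  by apply: ler_pM => //; [exact: mulr_ge0|exact: twin_ge0|exact: ler_wpM2l].
rewrite -subr_ge0 (_ : _ - _ = C1 * b%:R^-1 ^+ (l - j) * cell_weight j x (a %/ b ^ (L - j))) ?mulr_ge0//.
by ring.
Qed.

Lemma theta_tent_avg k x : exists C : R, 0 <= C /\ forall L,
  modulus (theta_tent phi0 k x - avg (b ^ L) (fun a => theta phi0 k (a%:R / (b ^ L)%:R) x)) <= C / (b ^ L)%:R.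
Proof.
have [C P] := theta_tent_approx pc k x; exists `|C|; split => // L.
have L0 : (0 < b ^ L)%N by rewrite expn_gt0 natb0.
have -> : avg (b ^ L) (fun a => theta phi0 k (a%:R / (b ^ L)%:R) x) =
  ((b ^ L)%:R^-1)%:C * \sum_(a < b ^ L) theta phi0 k (a%:R / (b ^ L)%:R) x.
  by rewrite /avg fmorphV rmorph_nat.
by apply: (le_trans (P _ L0)); rewrite ler_wpM2r ?invr_ge0// ler_norm.
Qed.

(** The grid mean of the cell bounds is the same comb at every resolution L, so it survives the
    limit. *)
Lemma theta_tent_bound : exists C : R, 0 <= C /\ forall k j x, (b ^ j <= 2 ^ k)%N ->
  modulus (theta_tent phi0 k x) <= C * comb (b ^ j) x.
Proof.
have [C [C0 P]] := theta_cell; exists C; split => // k j x jk.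
have [C' [_ P']] := theta_tent_avg k x.
apply: (@le_eps_expn _ _ C' j) => L jL; rewrite addrC.
rewrite -[X in modulus X](subrK (avg (b ^ L) (fun a => theta phi0 k (a%:R / (b ^ L)%:R) x))).
apply: (le_trans (modulusD _ _)); apply: lerD; first exact: P'.
apply: (le_trans (modulus_avg (fun a _ => P k j L a x jk jL))).
by rewrite /avg -mulr_sumr mulrCA -/(avg _ (fun a => cell_weight j x (a %/ b ^ (L - j)))) avg_cell.
Qed.

End levels.

(** * Blocks of the extended discrepancy *)

Section net_block.
Context {R : realType}.
Variables (phi0 : R -> R[i]) (b d : nat).
Hypothesis pc : cutoff phi0.
Hypothesis b1 : (1 < b)%N.

Let bX0 e : 0 < (b ^ e)%:R :> R.
Proof. by rewrite ltr0n expn_gt0 ltnW. Qed.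

(** All resolutions L >= s are asked for, since the grid of mesh b^-L is refined until its mean
    becomes the block of the tent. *)
Definition net_points m N (z : 'I_N -> 'I_d -> R) : Prop :=
  exists s, forall L, (s <= L)%N -> exists A : 'I_N -> 'I_d -> nat,
    (forall v i, (A v i < b ^ L)%N /\ z v i = (A v i)%:R / (b ^ L)%:R) /\
    net_uniform b L m A.

Definition block_value N (z : 'I_N -> 'I_d -> R) (k : 'I_d -> nat) (x : 'I_d -> R) : R[i] :=
  N%:R^-1 * (\sum_v \prod_i theta phi0 (k i) (z v i) (x i)) -
  \prod_i theta_tent phi0 (k i) (x i).

Definition twin_mean N (z : 'I_N -> 'I_d -> R) (k : 'I_d -> nat) (x : 'I_d -> R) : R :=
  N%:R^-1 * \sum_v \prod_i twin (2 ^+ k i) (x i) (z v i).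

Lemma prod_approx (I : Type) (s : seq I) (w : I -> R[i]) (u : I -> nat -> R[i]) :
  (forall i, exists C : R, 0 <= C /\ forall L, modulus (w i - u i L) <= C / (b ^ L)%:R) ->
  exists C : R, 0 <= C /\ forall L,
    modulus (\prod_(i <- s) w i - \prod_(i <- s) u i L) <= C / (b ^ L)%:R.
Proof.
move=> h; elim: s => [|i s [C [C0 IH]]].
  by exists 0; split => // L; rewrite !big_nil subrr modulus0 mul0r.
have [C' [C'0 P]] := h i; set W := \prod_(j <- s) w j in IH.
exists ((modulus (w i) + C') * C + C' * modulus W); split.
  by rewrite addr_ge0// mulr_ge0 ?addr_ge0 ?modulus_ge0.
move=> L; rewrite !big_cons -/W; have {}IH := IH L; have {}P := P L.
set U := \prod_(j <- s) u j L in IH *.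
(* The factor [u i L] is bounded uniformly in L, by [modulus (w i) + C']. *)
have -> : w i * W - u i L * U = u i L * (W - U) + (w i - u i L) * W by ring.
apply: (le_trans (modulusD _ _)); rewrite !modulusM mulrDl; apply: lerD; last first.
  by rewrite mulrAC ler_wpM2r ?modulus_ge0.
rewrite -mulrA; apply: ler_pM; rewrite ?modulus_ge0//.
have -> : u i L = w i - (w i - u i L) by ring.
apply: (le_trans (modulusB _ _)); rewrite lerD2l (le_trans P)//.
by rewrite ler_pdivrMr// ler_peMr// ler1n expn_gt0 ltnW.
Qed.

Lemma modulus_natV N : modulus (N%:R^-1 : R[i]) = N%:R^-1.
Proof.
have -> : (N%:R^-1 : R[i]) = (N%:R^-1 : R)%:C by rewrite fmorphV rmorph_nat.
by rewrite modulusC ger0_norm// invr_ge0.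
Qed.

(** The bound of [discrepancy_bound] does not depend on L, so letting L grow replaces the grid mean
    by the product of tent blocks. *)
Lemma block_value_low beta : b%:R^-1 <= beta -> beta < 1 ->
  exists C : R, 0 <= C /\ forall N m (z : 'I_N -> 'I_d -> R) (k : 'I_d -> nat) (x : 'I_d -> R),
    (0 < N)%N -> net_points m z -> (\sum_i level b (k i) <= m)%N ->
    modulus (block_value z k x) <=
      C * (b%:R^-1 / beta) ^+ (m - \sum_i level b (k i)) * \prod_i comb (b ^ level b (k i)) (x i).
Proof.
move=> bb b2; have [K [K0 P]] := theta_detail pc b1.
exists (2 * (K / (1 - beta)) ^+ d); split.
  by rewrite mulr_ge0// exprn_ge0// divr_ge0// subr_ge0 ltW.
move=> N m z k x N0 [s net] km.
have [C [_ appr]] := prod_approx (index_enum 'I_d) (fun i => theta_tent_avg pc b1 (k i) (x i)).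
apply: (@le_eps_expn _ _ b1 _ _ C (maxn s m)) => L; rewrite geq_max => /andP[sL mL].
have [A [AL NU]] := net L sL.
have W0 i c : 0 <= cell_weight b (level b (k i)) (x i) c by exact: cell_weight_ge0.
have := discrepancy_bound b1 mL (fun v i => (AL v i).1) NU km K0 W0 bb b2
  (fun i l a jl _ => P (k i) L l a (x i) jl).
have -> : \sum_v \prod_i theta phi0 (k i) ((A v i)%:R / (b ^ L)%:R) (x i) =
    \sum_v \prod_i theta phi0 (k i) (z v i) (x i).
  by apply: eq_bigr => v _; apply: eq_bigr => i _; rewrite (AL v i).2.
rewrite /block_value; have {}appr := appr L; move: appr.
set Z := \prod_i avg (b ^ L) _; set X := _^-1 * _; set Y := \prod_i theta_tent _ _ _.
move=> h1 h2.
have -> : X - Y = (X - Z) - (Y - Z) by rewrite opprB addrA subrK.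
by apply: (le_trans (modulusB _ _)); apply: lerD.
Qed.

(** Each bump is coarsened to its cell of level [j i], at the cost of a factor 4; the net averages
    products of such cell functions exactly. *)
Lemma twin_mean_le N m (z : 'I_N -> 'I_d -> R) (k j : 'I_d -> nat) (x : 'I_d -> R) :
  net_points m z -> (forall i, (b ^ j i <= 2 ^ k i)%N) -> (\sum_i j i <= m)%N ->
  twin_mean z k x <= 4 ^+ d * \prod_i comb (b ^ j i) (x i).
Proof.
move=> [s net] jk jm; pose L := maxn s m; have [A [AL NU]] := net L (leq_maxl _ _).
have jL i : (j i <= L)%N.
  by apply: leq_trans (leq_maxr _ _); apply: leq_trans jm; rewrite (bigD1 i)//= leq_addr.
have -> : \prod_i comb (b ^ j i) (x i) = \prod_i avg (b ^ j i) (cell_weight b (j i) (x i)) by [].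
rewrite -(NU _ _ (fun i => cell_weight b (j i) (x i)) jm) /twin_mean mulrCA ler_wpM2l ?invr_ge0//.
rewrite mulr_sumr; apply: ler_sum => v _; rewrite -[X in _ ^+ X]card_ord -prodr_const -big_split/=.
apply: ler_prod => i _; rewrite twin_ge0/= (AL v i).2.
apply: twin_le; last exact: divn_dist.
by rewrite ler0n/= -natrX ler_nat.
Qed.

Lemma block_value_high : exists C : R, 0 <= C /\
  forall N (z : 'I_N -> 'I_d -> R) (k : 'I_d -> nat) (x : 'I_d -> R),
    modulus (block_value z k x) <=
      C * (twin_mean z k x + \prod_i comb (b ^ level b (k i)) (x i)).
Proof.
have [C1 [C10 P1]] := theta_bound pc; have [C2 [C20 P2]] := theta_tent_bound pc b1.
exists (C1 ^+ d + C2 ^+ d); split; first by rewrite addr_ge0// exprn_ge0.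
move=> N z k x.
have p0 : 0 <= \prod_i comb (b ^ level b (k i)) (x i) by apply: prodr_ge0 => i _; exact: comb_ge0.
have t0 : 0 <= twin_mean z k x.
  by rewrite mulr_ge0 ?invr_ge0// sumr_ge0// => v _; apply: prodr_ge0 => i _; exact: twin_ge0.
have h1 : modulus (N%:R^-1 * (\sum_v \prod_i theta phi0 (k i) (z v i) (x i))) <= C1 ^+ d * twin_mean z k x.
  rewrite modulusM modulus_natV mulrCA ler_wpM2l ?invr_ge0//.
  apply: (le_trans (modulus_sum _ _ _)); rewrite mulr_sumr; apply: ler_sum => v _.
  rewrite modulus_prod -[X in _ ^+ X]card_ord -prodr_const -big_split/=.
  by apply: ler_prod => i _; rewrite modulus_ge0 P1.
have h2 : modulus (\prod_i theta_tent phi0 (k i) (x i)) <= C2 ^+ d * \prod_i comb (b ^ level b (k i)) (x i).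
  rewrite modulus_prod -[X in _ ^+ X]card_ord -prodr_const -big_split/=.
  apply: ler_prod => i _; rewrite modulus_ge0 P2//.
  by have /andP[] := level_bounds b1 (k i).
apply: (le_trans (modulusB _ _)); apply: (le_trans (lerD h1 h2)).
rewrite mulrDl !mulrDr; apply: lerD; rewrite ?lerDl ?lerDr mulr_ge0 ?exprn_ge0//.
Qed.

End net_block.

(** * Lebesgue norms of the blocks *)

(** Integrates the pointwise inequality f^p <= A^(p - 1) H. *)
Lemma Lnorm_le d (T : measurableType d) (R : realType) (mu : {measure set T -> \bar R})
    (f H : T -> R) (A B p : R) : 1 <= p -> measurable_fun setT f ->
  mu.-integrable setT (EFin \o H) -> (forall t, 0 <= f t <= H t) ->
  (forall t, H t <= A) -> 0 <= A -> Rintegral mu setT H <= B ->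
  (Lnorm mu p%:E (EFin \o f) <= ((A `^ (p - 1) * B) `^ p^-1)%:E)%E.
Proof.
move=> p1 mf iH fH HA A0 HB; rewrite unlock -poweR_EFin; apply: gt0_ler_poweR.
- by rewrite invr_ge0 (le_trans _ p1).
- by rewrite in_itv/= leey andbT; apply: integral_ge0 => x _; rewrite lee_fin powR_ge0.
- rewrite in_itv/= leey andbT lee_fin mulr_ge0 ?powR_ge0// (le_trans _ HB)//.
  by apply: Rintegral_ge0 => t _; have /andP[/le_trans] := fH t; apply.
apply: (@le_trans _ _ (\int[mu]_t ((A `^ (p - 1))%:E * (H t)%:E))%E).
  apply: ge0_le_integral => //.
  - by move=> t _; exact: poweR_ge0.
  - apply/measurable_EFinP; apply: (measurableT_comp (measurable_powR p)).
    exact: measurableT_comp.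
  - apply/measurable_EFinP; apply: measurable_funM => //; apply/measurable_EFinP.
    exact: measurable_int iH.
  - move=> t _; have /andP[f0 fHt] := fH t; rewrite /= lee_fin ger0_norm//.
    rewrite -(mulr_powRB1 f0 (lt_le_trans ltr01 p1)) mulrC; apply: ler_pM => //; rewrite ?powR_ge0//.
    by apply: ge0_ler_powR; rewrite ?subr_ge0 ?nnegrE// (le_trans fHt).
rewrite integralZl// EFinM; apply: lee_wpmul2l; first by rewrite lee_fin powR_ge0.
have /fineK <- : (\int[mu]_t (H t)%:E)%E \is a fin_num by exact: integrable_fin_num.
by rewrite lee_fin.
Qed.

(** Induction on the excess, lowering one positive entry at a time. *)
Lemma sub_levels d (l : 'I_d -> nat) m : (m <= \sum_i l i)%N ->
  exists j : 'I_d -> nat, (forall i, j i <= l i)%N /\ (\sum_i j i = m)%N.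
Proof.
move=> ml; have [e] : exists e, (\sum_i l i = m + e)%N by exists (\sum_i l i - m)%N; rewrite subnKC.
elim: e l {ml} => [|e IH] l E; first by exists l; rewrite E addn0.
have [i l0] : exists i, (0 < l i)%N.
  apply/existsP; rewrite -[[exists _, _]]negbK negb_exists; apply/negP => /forallP h.
  by move: E; rewrite big1 ?addnS// => i _; apply/eqP; rewrite -leqn0 leqNgt h.
pose l' k := if k == i then (l k).-1 else l k.
have [j [jl jm]] : exists j : 'I_d -> nat, (forall i, j i <= l' i)%N /\ (\sum_i j i = m)%N.
  apply: IH; move: E; rewrite (bigD1 i)//= [in X in _ -> X](bigD1 i)//= {1}/l' eqxx.
  rewrite [in X in _ -> X](eq_bigr l); first by move: l0; case: (l i) => // a _; rewrite /= addSn addnS => -[].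
  by move=> k /negbTE ki; rewrite /l' ki.
exists j; split => // k; apply: leq_trans (jl k) _.
by rewrite /l'; case: eqP => // _; exact: leq_pred.
Qed.

Section block_norm.
Context {R : realType}.
Variables (phi0 : R -> R[i]) (b d : nat) (p r : R).
Hypotheses (pc : cutoff phi0) (b1 : (1 < b)%N) (p1 : 1 <= p) (r0 : 0 < r) (rp : r < p^-1).
Local Notation mu := (@lebesgue_tuple R d).
Local Notation RR := (measurableTypeR R).
Local Notation B := (b%:R : R).

Let B0 : 0 < B. Proof. by rewrite ltr0n ltnW. Qed.
Let B1 : 1 < B. Proof. by rewrite ltr1n. Qed.
Let p0 : 0 < p. Proof. exact: lt_le_trans p1. Qed.
Let bn0 e : (0 < b ^ e)%N. Proof. by rewrite expn_gt0 ltnW. Qed.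
Let r1 : r < 1. Proof. by rewrite (lt_le_trans rp)// invf_le1. Qed.
Let pi0 : 0 < pi :> R := pi_gt0 R.

Let BD x y : B `^ x * B `^ y = B `^ (x + y).
Proof. by rewrite powRD// (gt_eqF B0) implybT. Qed.

Let natB e : (b ^ e)%:R = B `^ e%:R :> R.
Proof. by rewrite powR_mulrn ?natrX// ltW. Qed.

Let prod_natB (j : 'I_d -> nat) (c : R) :
  \prod_i (c / (b ^ j i)%:R) = c ^+ d * B `^ (- (\sum_i j i)%:R).
Proof.
rewrite big_split/= prodr_const card_ord; congr (_ * _).
by rewrite powRN -natB expn_sum natr_prod prodfV.
Qed.

Let prod_comb_le (j : 'I_d -> nat) (x : 'I_d -> R) :
  \prod_i comb (b ^ j i) (x i) <= (8 * pi) ^+ d * B `^ (- (\sum_i j i)%:R).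
Proof. by rewrite -prod_natB; apply: ler_prod => i _; rewrite comb_ge0 comb_le. Qed.

Let integral_prod_comb (j : 'I_d -> nat) :
  mu.-integrable setT (EFin \o (fun t => \prod_i comb (b ^ j i) (tnth t i))) /\
  Rintegral mu setT (fun t => \prod_i comb (b ^ j i) (tnth t i)) =
    (2 * pi) ^+ d * B `^ (- (\sum_i j i)%:R).
Proof.
have [i1 E] := Rintegral_tensor (fun i => (@Rintegral_comb R _ (bn0 (j i))).1).
split => //; rewrite E -prod_natB; apply: eq_bigr => i _.
exact: (@Rintegral_comb R _ (bn0 (j i))).2.
Qed.

Let integral_twin_mean N (z : 'I_N -> 'I_d -> R) (k : 'I_d -> nat) : (0 < N)%N ->
  mu.-integrable setT (EFin \o (fun t => twin_mean z k (tnth t))) /\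
  Rintegral mu setT (fun t => twin_mean z k (tnth t)) <=
    (2 * pi) ^+ d * B `^ (- (\sum_i level b (k i))%:R).
Proof.
move=> N0; have k2 i : 0 < 2 ^+ k i :> R by rewrite exprn_gt0.
have h v := Rintegral_tensor (fun i => integrable_twin (z v i) (k2 i)).
have [i1 E] := Rintegral_scale_sum (index_enum 'I_N) N%:R^-1 (fun v => (h v).1).
split => //; rewrite /twin_mean E -prod_natB.
rewrite [X in _ * X <= _](eq_bigr (fun=> \prod_i (2 * pi / 2 ^+ k i))); last first.
  by move=> v _; rewrite (h v).2; apply: eq_bigr => i _; rewrite Rintegral_twin.
rewrite sumr_const card_ord -[X in _ * X <= _]mulr_natl mulKf ?pnatr_eq0 -?lt0n//.
apply: ler_prod => i _; rewrite divr_ge0 ?mulr_ge0 ?exprn_ge0 ?(ltW pi0)//=.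
rewrite ler_pM2l ?mulr_gt0// lef_pV2 ?posrE ?ltr0n// -natrX ler_nat.
by have /andP[] := level_bounds b1 (k i).
Qed.

(** Each 2^(k_i) is below b^(level + 1); the d surplus factors b go into the constant. *)
Let scale_le (k : 'I_d -> nat) :
  2 `^ (r * (\sum_i k i)%:R) <= B `^ (r * d%:R) * B `^ (r * (\sum_i level b (k i))%:R).
Proof.
rewrite BD -mulrDr -natrD !(mulrC r) !powRrM.
apply: ge0_ler_powR; rewrite ?nnegrE ?powR_ge0 ?(ltW r0)//.
rewrite -natB powR_mulrn// -natrX ler_nat -[X in (X + _)%N]card_ord -sum1_card -big_split/=.
rewrite !expn_sum; apply: leq_prod => i _; rewrite add1n ltnW//.
by have /andP[] := level_bounds b1 (k i).
Qed.

Let B_lt1 s : s < 0 -> B `^ s < 1.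
Proof.
move=> s0; rewrite lt_neqAle powR_eq1 (gt_eqF B1) (lt_gtF B0) (lt_eqF s0)/=.
by have := ler_powR (ltW B1) (ltW s0); rewrite powRr0.
Qed.

Let powR_root A : 0 <= A -> (A `^ (p - 1) * A) `^ p^-1 = A.
Proof.
move=> A0; rewrite mulrC mulr_powRB1// -powRrM mulfV ?gt_eqF//.
exact: powRr1.
Qed.

Lemma block_Lnorm : exists C rho : R, [/\ 0 <= C, 0 < rho, rho < 1 &
  forall N m (z : 'I_N -> 'I_d -> R) (k : 'I_d -> nat), (0 < N)%N -> net_points b m z ->
    let f (t : d.-tuple RR) := modulus (block_value phi0 z k (tnth t)) in
    let J := (\sum_i level b (k i))%N in
    measurable_fun setT f ->
    ((2 `^ (r * (\sum_i k i)%:R))%:E * Lnorm mu p%:E (EFin \o f) <=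
       (C * B `^ (m%:R * (r - 1)) * rho ^+ ((J - m) + (m - J)))%:E)%E].
Proof.
(* Here beta is b^(-r/2). Multiplied by b^((r - 1) J), the estimate leaves (b^-r / beta)^(m - J)
   beside b^(m (r - 1)), so any beta strictly between b^-r and 1 would do. *)
have [C1 [C10 P1]] : exists C : R, 0 <= C /\ forall N m (z : 'I_N -> 'I_d -> R) k x,
    (0 < N)%N -> net_points b m z -> (\sum_i level b (k i) <= m)%N ->
    modulus (block_value phi0 z k x) <= C * (B^-1 / B `^ (- (r / 2))) ^+
      (m - \sum_i level b (k i)) * \prod_i comb (b ^ level b (k i)) (x i).
  apply: block_value_low => //; last by apply: B_lt1; rewrite oppr_lt0 divr_gt0.
  by rewrite -(powR_inv1 (ltW B0)); apply: ler_powR; [exact: ltW|move: r1; lra].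
have [C2 [C20 P2]] := block_value_high d pc b1.
pose D := (8 * pi) ^+ d : R; have D0 : 0 <= D by rewrite exprn_ge0// mulr_ge0// ltW.
pose E := C2 * ((4 ^+ d + 1) * D).
have E0 : 0 <= E by rewrite mulr_ge0// mulr_ge0// addr_ge0// exprn_ge0.
(* [rho1] governs J <= m and is below 1 by 0 < r; [rho2] governs J > m and is below 1 by r < 1/p. *)
pose rho1 := B `^ (- (r / 2)); pose rho2 := B `^ (r - p^-1).
exists (B `^ (r * d%:R) * (C1 * D + E)), (Num.max rho1 rho2); split.
- by rewrite mulr_ge0 ?powR_ge0// addr_ge0// mulr_ge0.
- by rewrite lt_max powR_gt0.
- by rewrite gt_max !B_lt1//; [rewrite subr_lt0|rewrite oppr_lt0 divr_gt0].
move=> N m z k N0 net f J mf; have K0 : 0 <= B `^ (r * d%:R) by exact: powR_ge0.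
have f0 t : 0 <= f t by exact: modulus_ge0.
have D2 : (2 * pi) ^+ d <= D.
  by apply: lerXn2r; rewrite ?nnegrE; move: pi0; lra.
suff [X [X0 fX XE]] : exists X, [/\ 0 <= X, (Lnorm mu p%:E (EFin \o f) <= X%:E)%E &
    B `^ (r * J%:R) * X <= (C1 * D + E) * B `^ (m%:R * (r - 1)) * Num.max rho1 rho2 ^+ (J - m + (m - J))].
  apply: (@le_trans _ _ ((2 `^ (r * (\sum_i k i)%:R))%:E * X%:E)%E).
    by apply: lee_wpmul2l => //; rewrite lee_fin powR_ge0.
  rewrite -EFinM lee_fin; apply: (le_trans (ler_wpM2r X0 (scale_le k))).
  by rewrite -!mulrA ler_wpM2l// !mulrA.
have final (c c' y s s' : R) e : 0 <= c <= c' -> 0 <= y -> 0 <= s <= s' ->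
    c * (y * s ^+ e) <= c' * y * s' ^+ e.
  move=> /andP[c0 cc'] y0 /andP[s0 ss']; rewrite -[leRHS]mulrA; apply: ler_pM => //.
    by rewrite mulr_ge0 ?exprn_ge0.
  by rewrite ler_wpM2l// lerXn2r// nnegrE (le_trans s0).
case: (leqP J m) => Jm.
  pose G := (B^-1 / B `^ (- (r / 2))) ^+ (m - J).
  have G0 : 0 <= G by rewrite exprn_ge0// divr_ge0 ?powR_ge0// invr_ge0 ltW.
  (* Bounds both the sup norm and the integral of the majorant, which are of the same order for
     combs, so interpolation loses nothing. *)
  pose A := C1 * G * (D * B `^ (- J%:R)).
  have A0 : 0 <= A by rewrite !mulr_ge0 ?powR_ge0.
  exists A; split => //.
    have [i1 i2] := integral_prod_comb (fun i => level b (k i)).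
    rewrite -[in leRHS](powR_root A0).
    apply: (@Lnorm_le _ _ _ mu f (fun t => C1 * G * \prod_i comb (b ^ level b (k i)) (tnth t i)) A A p p1 mf) => //.
    + exact: (integrableZl measurableT (C1 * G) i1).
    + by move=> t; rewrite f0 P1.
    + by move=> t; rewrite ler_wpM2l ?mulr_ge0// prod_comb_le.
    + rewrite RintegralZl// i2 ler_wpM2l ?mulr_ge0// ler_wpM2r ?powR_ge0//.
  have GE : B `^ (r * J%:R) * A = C1 * D * (B `^ (m%:R * (r - 1)) * rho1 ^+ (m - J)).
    rewrite /A /G -(powR_inv1 (ltW B0)) -powRB ?(gt_eqF B0) ?implybT//.
    rewrite -!powR_mulrn ?powR_ge0// -!powRrM.
    have -> : B `^ (r * J%:R) * (C1 * B `^ ((-1 - - (r / 2)) * (m - J)%:R) * (D * B `^ (- J%:R))) =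
      C1 * D * (B `^ (r * J%:R) * B `^ ((-1 - - (r / 2)) * (m - J)%:R) * B `^ (- J%:R)) by ring.
    rewrite !BD natrB//; congr (_ * _ `^ _); by field.
  have -> : (J - m + (m - J) = m - J)%N by rewrite (eqP Jm).
  rewrite GE; apply: final; rewrite ?mulr_ge0 ?powR_ge0 ?lerDl//.
  by rewrite le_max lexx.
(* Interpolates the sup bound E b^-m with the integral bound E b^-J. *)
pose X := E * B `^ (- m%:R * (1 - p^-1) - J%:R * p^-1).
exists X; split; first by rewrite mulr_ge0 ?powR_ge0.
  have [i1 i2] := integral_prod_comb (fun i => level b (k i)).
  have [i3 i4] := integral_twin_mean z k N0.
  have XE : X = ((E * B `^ (- m%:R)) `^ (p - 1) * (E * B `^ (- J%:R))) `^ p^-1.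
    rewrite (@powRM _ E _ (p - 1))// ?powR_ge0// mulrACA (@powRM _ (_ * E)) ?mulr_ge0 ?powR_ge0// powR_root//.
    congr (_ * _); rewrite -powRrM BD -powRrM; congr (_ `^ _).
    by field; rewrite gt_eqF.
  rewrite XE.
  have ip := integrableD measurableT i3 i1.
  have [j [jl jm]] := sub_levels (ltnW Jm).
  have lk i : (b ^ level b (k i) <= 2 ^ k i)%N by have /andP[] := level_bounds b1 (k i).
  have jk i : (b ^ j i <= 2 ^ k i)%N by apply: leq_trans (lk i); rewrite leq_exp2l.
  apply: (@Lnorm_le _ _ _ mu f (fun t => C2 * (twin_mean z k (tnth t) +
     \prod_i comb (b ^ level b (k i)) (tnth t i))) _ _ p p1 mf) => //.
  + exact: (integrableZl measurableT C2 ip).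
  + by move=> t; rewrite f0 P2.
  + move=> t; rewrite /E -mulrA ler_wpM2l// (mulrDl _ _ D) (mulrDl (_ * D)) mul1r; apply: lerD.
      have := twin_mean_le b1 (tnth t) net jk (eq_leq jm).
      move=> /le_trans; apply; rewrite -mulrA ler_wpM2l ?exprn_ge0//.
      by rewrite -jm; exact: prod_comb_le.
    apply: (le_trans (prod_comb_le _ _)); rewrite ler_wpM2l//.
    by apply: ler_powR; rewrite ?(ltW B1)// lerN2 ler_nat ltnW.
  + by rewrite mulr_ge0 ?powR_ge0.
  + rewrite RintegralZl// RintegralD// i2 /E -mulrA ler_wpM2l// (mulrDl _ _ D) (mulrDl (_ * D)) mul1r.
    apply: lerD; last by rewrite ler_wpM2r ?powR_ge0.
    apply: (le_trans i4); rewrite ler_wpM2r ?powR_ge0// (le_trans D2)// ler_peMl//.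
    by rewrite exprn_ege1// ler1n.
have -> : (J - m + (m - J) = J - m)%N by rewrite (eqP (ltnW Jm)) addn0.
have XE : B `^ (r * J%:R) * X = E * (B `^ (m%:R * (r - 1)) * rho2 ^+ (J - m)).
  rewrite /X -powR_mulrn ?powR_ge0// -powRrM mulrCA !BD (natrB _ (ltnW Jm)).
  congr (E * _); congr (B `^ _); ring.
rewrite XE; apply: final; rewrite ?powR_ge0 ?lerDr ?mulr_ge0//.
by rewrite le_max lexx orbT.
Qed.

End block_norm.

(** * Summation over the blocks *)

Definition absdiff (m n : nat) : nat := ((m - n) + (n - m))%N.

Section geometric.
Context {R : realType}.
Variable t : R.
Hypotheses (t0 : 0 < t) (t1 : t < 1).

Let geo n : \sum_(l < n) t ^+ l <= (1 - t)^-1.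
Proof.
have h1 : 0 < 1 - t by rewrite subr_gt0.
have E := subrX1 t n; rewrite -[leRHS]mul1r ler_pdivlMr// mulrC.
have -> : (1 - t) * \sum_(l < n) t ^+ l = 1 - t ^+ n by rewrite -opprB mulNr -E opprB.
by rewrite lerBlDr lerDl exprn_ge0// ltW.
Qed.

Lemma sum_ffun_cons (T : finType) d (F : {ffun 'I_d.+1 -> T} -> R) :
  \sum_f F f = \sum_x \sum_(g : {ffun 'I_d -> T})
    F [ffun i => if unlift ord0 i is Some i' then g i' else x].
Proof.
pose cons (z : T * {ffun 'I_d -> T}) : {ffun 'I_d.+1 -> T} :=
  [ffun i => if unlift ord0 i is Some i' then z.2 i' else z.1].
rewrite pair_big/= (reindex cons)//.
exists (fun f : {ffun 'I_d.+1 -> T} => (f ord0, [ffun i => f (lift ord0 i)] : {ffun 'I_d -> T})) => [[x g] _|f _].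
  rewrite /cons; congr pair; first by rewrite ffunE unlift_none.
  by apply/ffunP => i; rewrite !ffunE liftK.
by apply/ffunP => i; rewrite ffunE; case: unliftP => [j ->|->]; rewrite ?ffunE.
Qed.

Let geo_peak m K : \sum_(x < K) t ^+ absdiff x m <= (1 - t)^-1 + \sum_(l < m.+1) t ^+ l.
Proof.
have tX e : 0 <= t ^+ e by rewrite exprn_ge0// ltW.
have s0 n : 0 <= \sum_(l < n) t ^+ l by rewrite sumr_ge0.
elim: m K => [|m IH] K.
  rewrite (eq_bigr (fun x : 'I_K => t ^+ x)); last by move=> x _; rewrite /absdiff subn0 sub0n addn0.
  by rewrite (le_trans (geo K))// lerDl.
case: K => [|K]; first by rewrite big_ord0 addr_ge0// invr_ge0 subr_ge0 ltW.
rewrite big_ord_recl [X in _ <= _ + X]big_ord_recr/= addrA [leRHS]addrC {1}/absdiff sub0n subn0 add0n.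
rewrite lerD2l; apply: le_trans (IH K); apply: ler_sum => x _.
by rewrite /absdiff /bump/= add1n !subSS.
Qed.

Let geo_trunc m K : \sum_(x < K) t ^+ (x - m) <= m%:R + (1 - t)^-1.
Proof.
elim: m K => [|m IH] K.
  by rewrite add0r; under eq_bigr do rewrite subn0; exact: geo.
case: K => [|K]; first by rewrite big_ord0 addr_ge0// invr_ge0 subr_ge0 ltW.
rewrite big_ord_recl/= sub0n expr0 -natr1 addrAC [leRHS]addrC lerD2l.
exact: le_trans (IH K).
Qed.

(** Fixing the first coordinate x leaves the sum for m - x times t^(x - m); summing over x with
    [geo_trunc] costs m + 1/(1 - t), one power of m + 1 per added dimension. The first dimension
    costs none, by [geo_peak]. *)
Lemma sum_geometric_box d : exists C : R, 0 <= C /\ forall m K,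
  \sum_(j : {ffun 'I_d.+1 -> 'I_K}) t ^+ absdiff (\sum_i j i) m <= C * m.+1%:R ^+ d.
Proof.
have h1 : 0 < 1 - t by rewrite subr_gt0.
have tX e : 0 <= t ^+ e by rewrite exprn_ge0// ltW.
have E d' K (x : 'I_K) (g : {ffun 'I_d' -> 'I_K}) :
  (\sum_i [ffun i => if unlift ord0 i is Some i' then g i' else x] i = x + \sum_i g i)%N.
  rewrite big_ord_recl ffunE unlift_none; congr addn.
  by apply: eq_bigr => i _; rewrite ffunE liftK.
elim: d => [|d [C [C0 IH]]].
  exists ((1 - t)^-1 + (1 - t)^-1); split; first by rewrite addr_ge0// invr_ge0 ltW.
  move=> m K; rewrite expr0 mulr1 sum_ffun_cons.
  have h := le_trans (geo_peak m K) (lerD (lexx _) (geo m.+1)); apply: le_trans h.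
  apply: ler_sum => x _; rewrite (eq_bigr (fun=> t ^+ absdiff x m)).
    by rewrite sumr_const card_ffun !card_ord.
  by move=> g _; rewrite E big_ord0 addn0.
exists (C * (1 + (1 - t)^-1)); split.
  by rewrite mulr_ge0// addr_ge0// invr_ge0 ltW.
move=> m K; rewrite sum_ffun_cons.
apply: (@le_trans _ _ (\sum_(x < K) (C * m.+1%:R ^+ d) * t ^+ (x - m))).
  apply: ler_sum => x _; under eq_bigr do rewrite E.
  rewrite (eq_bigr (fun g : {ffun 'I_d.+1 -> 'I_K} => t ^+ absdiff (\sum_i g i) (m - x) * t ^+ (x - m))).
    rewrite -mulr_suml ler_wpM2r//; apply: (le_trans (IH _ _)); rewrite ler_wpM2l//.
    by rewrite lerXn2r ?nnegrE// ler_nat ltnS leq_subr.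
  (* With truncated subtraction, |x + S - m| = |S - (m - x)| + (x - m) whether or not x exceeds
     m. *)
  by move=> g _; rewrite -exprD; congr (_ ^+ _); rewrite /absdiff; lia.
rewrite -mulr_sumr exprSr mulrACA ler_wpM2l ?mulr_ge0 ?exprn_ge0//.
apply: (le_trans (geo_trunc m K)); rewrite mulrDl mul1r -natr1 mulrDr mulr1.
have := ler0n R m; have : 0 <= (1 - t)^-1 by rewrite invr_ge0 ltW.
by move: (1 - t)^-1 m%:R => u w u0 w0; have := mulr_ge0 u0 w0; lra.
Qed.

End geometric.

(** * From dyadic indices to base-b levels *)

Section level_box.
Context {R : realType}.
Variables (b d : nat).
Hypothesis b1 : (1 < b)%N.

Lemma level_le k : (level b k <= k)%N.
Proof.
have /andP[h _] := level_bounds b1 k; rewrite -(leq_exp2l _ _ (ltnSn 1)).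
by apply: leq_trans h; case: (level b k) => // l; rewrite leq_exp2r.
Qed.

(* A level contains fewer than [b] consecutive indices, as [b < 2 ^ b]. *)
Lemma level_mod_inj k k' : level b k = level b k' -> (k %% b = k' %% b)%N -> k = k'.
Proof.
wlog: k k' / (k <= k')%N => [h e1 e2|].
  by case: (leqP k k') => [kk|/ltnW kk]; [exact: h|apply/esym/h].
move=> kk e1 /eqP; rewrite eq_sym eqn_mod_dvd// => bk; apply/eqP.
rewrite eqn_leq kk /= leqNgt; apply/negP => kk'.
have /andP[h1 _] := level_bounds b1 k; have /andP[_ h2] := level_bounds b1 k'.
have bk' : (b <= k' - k)%N by apply: dvdn_leq => //; rewrite subn_gt0.
move: h2; rewrite -e1 expnS ltnNge -(subnK kk) expnD leq_mul//.
by rewrite (leq_trans (ltnW (ltn_expl b (ltnSn 1))))// leq_exp2l.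
Qed.

(** By [level_mod_inj] an index is determined by its level and its residue mod b, so each vector of
    levels has at most b^d preimages. *)
Lemma sum_level_box (g : nat -> R) K : (forall e, 0 <= g e) ->
  \sum_(k : {ffun 'I_d -> 'I_K}) g (\sum_i level b (k i))%N <=
  (b ^ d)%:R * \sum_(j : {ffun 'I_d -> 'I_K}) g (\sum_i j i)%N.
Proof.
move=> g0.
pose lev (k : 'I_K) : 'I_K := Ordinal (leq_ltn_trans (level_le k) (ltn_ord k)).
pose res (k : 'I_K) : 'I_b := Ordinal (ltn_pmod k (ltnW b1)).
pose phi (k : {ffun 'I_d -> 'I_K}) : {ffun 'I_d -> 'I_K} * {ffun 'I_d -> 'I_b} :=
  ([ffun i => lev (k i)], [ffun i => res (k i)]).
have phi_inj : injective phi.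
  move=> k k' [/ffunP e1 /ffunP e2]; apply/ffunP => i; apply/val_inj.
  move: (e1 i) (e2 i); rewrite !ffunE => /(congr1 val)/= f1 /(congr1 val)/= f2.
  exact: level_mod_inj.
rewrite (eq_bigr (fun k => g (\sum_i (phi k).1 i)%N)); last first.
  by move=> k _; congr g; apply: eq_bigr => i _; rewrite ffunE.
rewrite -(big_imset (fun z : {ffun 'I_d -> 'I_K} * {ffun 'I_d -> 'I_b} => g (\sum_i z.1 i)%N) (in2W phi_inj)).
apply: (@le_trans _ _ (\sum_(z : {ffun 'I_d -> 'I_K} * {ffun 'I_d -> 'I_b}) g (\sum_i z.1 i)%N)).
  by rewrite big_mkcond; apply: ler_sum => z _; case: ifP.
rewrite -(pair_bigA _ (fun (j : {ffun 'I_d -> 'I_K}) (u : {ffun 'I_d -> 'I_b}) => g (\sum_i j i)%N))/=.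
rewrite mulr_sumr; apply: ler_sum => j _.
by rewrite sumr_const card_ffun !card_ord mulr_natl.
Qed.

Lemma esum_level_le (a : {ffun 'I_d -> nat} -> \bar R) (g : nat -> R) (A M : R) :
  0 <= A -> (forall e, 0 <= g e) ->
  (forall k, (a k <= (A * g (\sum_i level b (k i))%N)%:E)%E) ->
  (forall K, \sum_(j : {ffun 'I_d -> 'I_K}) g (\sum_i j i)%N <= M) ->
  (esum setT a <= (A * ((b ^ d)%:R * M))%:E)%E.
Proof.
move=> A0 g0 ag gM; apply: ge_ereal_sup => _ [X [finX _] <-].
pose h (k : {ffun 'I_d -> nat}) := A * g (\sum_i level b (k i))%N.
apply: (@le_trans _ _ (\sum_(k \in X) (h k)%:E)%E); first by apply: lee_fsum => // k _; exact: ag.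
rewrite fsbig_finite//= sumEFin lee_fin.
have us : uniq (finmap.enum_fset (fset_set X)) by exact: finmap.fset_uniq.
(* [K] exceeds every entry occurring in the finite index set, which therefore lies in a box. *)
move: us; move: (finmap.enum_fset _) => /= s us; pose K := (\max_(k <- s) \max_i k i).+1.
pose emb (k : {ffun 'I_d -> 'I_K}) : {ffun 'I_d -> nat} := [ffun i => k i : nat].
have emb_inj : injective emb.
  move=> k k' /ffunP e; apply/ffunP => i; apply/val_inj.
  by move: (e i); rewrite !ffunE.
have sK k i : k \in s -> (k i < K)%N.
  move=> ks; rewrite /K ltnS; apply: (@leq_trans (\max_i k i)); first exact: leq_bigmax.
  by rewrite (big_rem k)//= leq_maxl.
have ps : perm_eq s [seq emb k | k <- enum {ffun 'I_d -> 'I_K} & emb k \in s].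
  apply: uniq_perm; first exact: us.
    by rewrite map_inj_uniq// filter_uniq// enum_uniq.
  move=> k; apply/idP/mapP => [ks|[k']]; last by rewrite mem_filter => /andP[+ _] ->.
  pose k' : {ffun 'I_d -> 'I_K} := [ffun i => Ordinal (sK k i ks)].
  have E : k = emb k' by apply/ffunP => i; rewrite !ffunE.
  by exists k' => //; rewrite mem_filter -E ks mem_enum.
rewrite (perm_big _ ps)/= big_map big_filter big_enum_cond/=.
apply: (@le_trans _ _ (\sum_(k : {ffun 'I_d -> 'I_K}) h (emb k))).
  by rewrite big_mkcond; apply: ler_sum => k _; case: ifP => // _; rewrite mulr_ge0.
rewrite -mulr_sumr ler_wpM2l//.
rewrite (eq_bigr (fun k : {ffun 'I_d -> 'I_K} => g (\sum_i level b (k i))%N)); last first.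
  by move=> k _; congr g; apply: eq_bigr => i _; rewrite ffunE.
by apply: (le_trans (sum_level_box K g0)); rewrite ler_wpM2l.
Qed.

End level_box.

(** * Extension of the discrepancy to the whole space *)

Section integrable_rows.
Context {R : realType} {d : nat}.
Implicit Types f : 'rV[R]_d -> R[i].

Lemma cintegrableZ (a : R[i]) f : cintegrable f -> cintegrable (fun x => a * f x).
Proof. by move=> fi; apply/cintegrableE; exact: cintegZ fi. Qed.

Lemma cintegrableD f g : cintegrable f -> cintegrable g -> cintegrable (fun x => f x + g x).
Proof. by move=> fi gi; apply/cintegrableE; exact: cintegD fi gi. Qed.

Lemma cintegrable_sum (I : Type) (s : seq I) (f : I -> 'rV[R]_d -> R[i]) :
  (forall i, cintegrable (f i)) -> cintegrable (fun x => \sum_(i <- s) f i x).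
Proof. by move=> fi; apply/cintegrableE; exact: cinteg_sum. Qed.

End integrable_rows.

Section extension.
Context {R : realType}.
Variables (phi0 : R -> R[i]) (d N : nat).
Hypothesis pc : cutoff phi0.
Local Notation mu1 := (@lebesgue_measure R).
Local Notation RR := (measurableTypeR R).

Lemma cintegrable_dyadic_tensor (k : {ffun 'I_d -> nat}) : cintegrable (dyadic_tensor phi0 k).
Proof. exact: (@cintegrable_tensor R d (fun i => dyadic phi0 (k i)) (fun i => cinteg_dyadic pc (k i))). Qed.

Lemma block_tensor (k : {ffun 'I_d -> nat}) (g : 'I_d -> RR -> R[i]) :
  (forall i, cinteg mu1 (g i)) ->
  cintegrable (fun x => dyadic_tensor phi0 k x * gfourier (-1) (tensor g) x) /\
  gfourier 1 (fun x => dyadic_tensor phi0 k x * gfourier (-1) (tensor g) x) =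
    tensor (fun i => block1 phi0 (k i) (g i)).
Proof.
move=> gi; have E : (fun x => dyadic_tensor phi0 k x * gfourier (-1) (tensor g) x) =
    tensor (fun i xi => dyadic phi0 (k i) xi * fourier1 (-1) (g i) xi).
  by apply/funext => x; rewrite gfourier_tensor// /tensor /dyadic_tensor -big_split.
have hi i : cinteg mu1 (fun xi : RR => dyadic phi0 (k i) xi * fourier1 (-1) (g i) xi).
  by have [] := block1E pc (k i) 0 (gi i).
by rewrite E; split; [exact: cintegrable_tensor|rewrite gfourier_tensor].
Qed.

Variable z : 'I_N -> 'I_d -> R.

(** Scalars, including the sign, are explicit factors, so that linearity of the transform applies
    directly. *)
Definition extension (x : 'rV[R]_d) : R[i] :=
  N%:R^-1 * (\sum_v tensor (fun i => chi (z v i)) x) +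
  (-1) * tensor (fun=> fun y : RR => (tent y)%:C) x.

Let chi_integ v (i : 'I_d) : cinteg mu1 (chi (z v i)) := cinteg_chi (z v i).

Let tent_integ (i : 'I_d) : cinteg mu1 (fun y : RR => (tent y)%:C).
Proof. by apply: cinteg_real; exact: integrable_tent. Qed.

Lemma cintegrable_extension : cintegrable extension.
Proof.
apply: cintegrableD; apply: cintegrableZ; last exact: cintegrable_tensor.
by apply: cintegrable_sum => v; exact: cintegrable_tensor.
Qed.

Lemma block_extension (k : {ffun 'I_d -> nat}) (x : 'rV[R]_d) :
  inv_fourier (fun x => dyadic_tensor phi0 k x * fourier extension x) x =
  block_value phi0 z k (x 0).
Proof.
rewrite inv_fourierE fourierE.
have h1 v := block_tensor k (chi_integ v); have h2 := block_tensor k tent_integ.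
have i1 v := cintegrable_tensor (chi_integ v).
have i2 := cintegrable_tensor tent_integ.
have i3 : cintegrable (fun x : 'rV[R]_d => \sum_v tensor (fun i => chi (z v i)) x).
  exact: cintegrable_sum.
have i4 : cintegrable (fun x : 'rV[R]_d => N%:R^-1 * (\sum_v tensor (fun i => chi (z v i)) x)).
  exact: cintegrableZ.
have i5 : cintegrable (fun x : 'rV[R]_d => (-1) * tensor (fun=> fun y : RR => (tent y)%:C) x : R[i]).
  exact: cintegrableZ.
rewrite /extension gfourierD// !gfourierZ// gfourier_sum//.
rewrite (_ : (fun x => _) = fun x => N%:R^-1 * (\sum_v dyadic_tensor phi0 k x *
    gfourier (-1) (tensor (fun i => chi (z v i))) x) +
   (-1) * (dyadic_tensor phi0 k x * gfourier (-1) (tensor (fun=> fun y : RR => (tent y)%:C)) x)); last first.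
  apply/funext => y; rewrite -mulr_sumr; ring.
have j3 : cintegrable (fun x => \sum_v dyadic_tensor phi0 k x *
    gfourier (-1) (tensor (fun i => chi (z v i))) x).
  by apply: cintegrable_sum => v; exact: (h1 v).1.
rewrite gfourierD; last 2 first.
- exact: cintegrableZ.
- exact: cintegrableZ h2.1.
rewrite !gfourierZ//; last exact: h2.1.
rewrite gfourier_sum; last by move=> v; exact: (h1 v).1.
rewrite h2.2 mulN1r /block_value; congr (_ * _ - _).
by apply: eq_bigr => v _; rewrite (h1 v).2.
Qed.

(** The infimum in [dist_Lnorm] is bounded by the single representative from
    [dyadic_block_regular]. *)
Lemma dist_Lnorm_block p (k : {ffun 'I_d -> nat}) :
  measurable_fun setT (fun t : d.-tuple RR => modulus (block_value phi0 z k (tnth t))) /\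
  (dist_Lnorm p (dyadic_block phi0 k (regular extension)) <=
    Lnorm (lebesgue_tuple d) p (EFin \o (fun t => modulus (block_value phi0 z k (tnth t)))))%E.
Proof.
have rep := dyadic_block_regular (cintegrable_dyadic_tensor k) cintegrable_extension.
have E (t : d.-tuple RR) : inv_fourier (fun x => dyadic_tensor phi0 k x * fourier extension x)
    (row_of_tuple t) = block_value phi0 z k (tnth t).
  by rewrite block_extension; congr block_value; apply/funext => i; rewrite mxE.
split.
  have := measurable_modulus ((cmeasurableE _).1 rep.1).
  rewrite (_ : _ \o _ = fun t => modulus (block_value phi0 z k (tnth t)))//.
  by apply/funext => t; rewrite /= E.
apply: ereal_inf_lbound; eexists; first exact: rep.
by congr Lnorm; apply/funext => t; rewrite /= E.
Qed.

Lemma extension_cube (P : 'I_N -> 'rV[R]_d) (x : 'rV[R]_d) :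
  (forall v i, P v 0 i = z v i) -> (forall v i, 0 <= z v i) -> unit_cube x ->
  extension x = (discrepancy P x)%:C.
Proof.
move=> Pz z0 xc; rewrite /extension /discrepancy mulN1r raddfB/= rmorphM fmorphV rmorph_nat raddf_sum rmorph_prod.
congr (_ * _ - _); last first.
  by apply: eq_bigr => i _; rewrite tent_unit.
apply: eq_bigr => v _; rewrite /tensor -rmorph_prod; congr _%:C.
rewrite (eq_bigr (fun i => (0 <= P v 0 i < x 0 i)%R%:R)); last first.
  move=> i _; rewrite indE in_itv/= Pz z0/=; congr (nat_of_bool _)%:R.
  have /andP[_ x1] := xc i; case: (z v i < x 0 i) => //=.
  by rewrite (le_trans (ltW x1))// lerDr.
case: (boolP [forall i, _]) => [/forallP h|].
  by rewrite big1// => i _; rewrite h.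
rewrite negb_forall => /existsP[i /negbTE h].
by rewrite (bigD1 i)//= h mul0r.
Qed.

(** Test functions vanish off the cube, so the integral over R^d only meets the points covered by
    [extension_cube]. *)
Lemma restricts_extension (P : 'I_N -> 'rV[R]_d) :
  (forall v i, P v 0 i = z v i) -> (forall v i, 0 <= z v i) ->
  restricts_to (regular extension) (cube_distribution_of (discrepancy P)).
Proof.
move=> Pz z0 f [_ _ fc].
have f0 x : ~ unit_cube x -> f x = 0.
  move=> xc; apply/eqP; apply/negPn/negP => fx; apply: xc.
  by apply: interior_subset; apply: fc; apply: subset_closure.
rewrite /regular /cube_distribution_of /cintegral preimage_setT.
have E (h : R[i] -> R) : h 0 = 0 ->
  Rintegral (lebesgue_tuple d) setT (fun t => h (extension (row_of_tuple t) * f (row_of_tuple t))) =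
  Rintegral (lebesgue_tuple d) (row_of_tuple @^-1` (@unit_cube R d))
    (fun t => h ((discrepancy P (row_of_tuple t))%:C * f (row_of_tuple t))).
  move=> h0; rewrite [RHS]Rintegral_mkcond; apply: eq_Rintegral => t _.
  rewrite patchE; case: ifPn => [|]; rewrite ?inE ?notin_setE => tc.
    by rewrite (extension_cube Pz z0 tc).
  by rewrite f0// mulr0 h0.
by congr Complex; exact: E.
Qed.

End extension.

(** * The Besov norm *)

Lemma net_points_digital (R : realType) b d s n v (M : 'I_d -> 'M['F_b]_(s, n)) :
  prime b -> order_digital_net 1 v M ->
  net_points b (n - v) (fun m i => (digital_net M m 0 i : R)).
Proof.
move=> pb net; exists s => L sL; exists (net_digits M L); split.
  by move=> m i; split; [exact: (net_digits_lt pb)|exact: (digital_netE pb)].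
exact: (net_uniform_digits pb net).
Qed.

Lemma digital_net_ge0 (R : realType) b d s n (M : 'I_d -> 'M['F_b]_(s, n)) m i :
  0 <= digital_net M m 0 i :> R.
Proof. by rewrite mxE sumr_ge0// => k _; rewrite divr_ge0// exprn_ge0. Qed.

(** For finite q the q-th powers are again geometric, with ratio rho^q; the 1/q-th power of the
    count (m + 1)^d in dimension d + 1 is the last factor. *)
Lemma besov_norm_level_le (R : realType) (b d : nat) (rho : R) (q : \bar R) :
  (1 < b)%N -> 0 < rho -> rho < 1 -> (1 <= q)%E ->
  exists K : R, 0 <= K /\ forall phi0 (p : \bar R) r u m X, 0 <= X ->
    (forall k : {ffun 'I_d.+1 -> nat},
      ((2 `^ (r * (\sum_i k i)%:R))%:E * dist_Lnorm p (dyadic_block phi0 k u) <=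
        (X * rho ^+ absdiff (\sum_i level b (k i)) m)%:E)%E) ->
    (besov_norm phi0 p q r u <= (X * K * m.+1%:R `^ (d%:R * recip q))%:E)%E.
Proof.
move=> b1 rho0 rho1; case: q => [q| |] //= q1; last first.
  (* For q = +oo nothing is counted: [recip] is 0 and every block is at most [X]. *)
  exists 1; split=> // phi0 p r u m X X0 h; rewrite mulr0 powRr0 !mulr1.
  apply: ge_ereal_sup => _ [k _ <-]; apply: (le_trans (h k)); rewrite lee_fin ler_piMr//.
  by rewrite exprn_ile1// ltW.
have q0 : 0 < q by rewrite (lt_le_trans ltr01)// -lee_fin.
have t0 : 0 < rho `^ q by rewrite powR_gt0.
have t1 : rho `^ q < 1.
  have : rho `^ q < 1 `^ q by apply: gt0_ltr_powR; rewrite ?nnegrE// ltW.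
  by rewrite powR1.
have [C [C0 P]] := sum_geometric_box t0 t1 d.
pose c := (b ^ d.+1)%:R * C : R; have c0 : 0 <= c by rewrite mulr_ge0.
exists (c `^ q^-1); split; first exact: powR_ge0.
move=> phi0 p r u m X X0 h.
have dist0 k : (0 <= dist_Lnorm p (dyadic_block phi0 k u))%E.
  by apply: le_ereal_inf_tmp => _ [g _ <-]; exact: Lnorm_ge0.
have X'0 : 0 <= X `^ q by exact: powR_ge0.
have M0 : 0 <= c * m.+1%:R ^+ d by rewrite mulr_ge0// exprn_ge0.
have es : (esum [set: {ffun 'I_d.+1 -> nat}] (fun k => (2 `^ (r * (\sum_i k i)%:R * q))%:E *
     dist_Lnorm p (dyadic_block phi0 k u) `^ q) <= (X `^ q * (c * m.+1%:R ^+ d))%:E)%E.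
  rewrite /c -[(_ * C) * _]mulrA.
  apply: (@esum_level_le _ _ _ b1 _ (fun e => (rho `^ q) ^+ absdiff e m)) => //.
  - by move=> e; rewrite exprn_ge0// ltW.
  - move=> k.
    have -> : ((2 `^ (r * (\sum_i k i)%:R * q))%:E * dist_Lnorm p (dyadic_block phi0 k u) `^ q =
       ((2 `^ (r * (\sum_i k i)%:R))%:E * dist_Lnorm p (dyadic_block phi0 k u)) `^ q)%E.
      by rewrite poweRM// ?lee_fin ?powR_ge0// poweR_EFin -powRrM.
    have -> : X `^ q * (rho `^ q) ^+ absdiff (\sum_i level b (k i)) m =
       (X * rho ^+ absdiff (\sum_i level b (k i)) m) `^ q.
      rewrite powRM ?exprn_ge0 ?(ltW rho0)//; congr (_ * _).
      by rewrite -(powR_mulrn _ (powR_ge0 rho q)) -(powR_mulrn _ (ltW rho0)) powRAC.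
    rewrite -[leRHS]poweR_EFin; apply: gt0_ler_poweR; rewrite ?(ltW q0)// ?in_itv/= ?leey ?andbT.
    - by rewrite mule_ge0// lee_fin powR_ge0.
    - by rewrite lee_fin mulr_ge0// exprn_ge0// ltW.
apply: (@le_trans _ _ ((X `^ q * (c * m.+1%:R ^+ d)) `^ q^-1)%:E).
  rewrite -[leRHS]poweR_EFin; apply: gt0_ler_poweR; rewrite ?invr_ge0 ?(ltW q0)// ?in_itv/= ?leey ?andbT//.
    by apply: esum_ge0 => k _; rewrite mule_ge0 ?poweR_ge0// lee_fin powR_ge0.
  by rewrite lee_fin mulr_ge0.
rewrite lee_fin powRM// -powRrM mulfV ?gt_eqF// powRr1// powRM ?exprn_ge0// mulrA.
by rewrite -powR_mulrn// -powRrM.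
Qed.

Theorem theorem1p2 (R : realType) (phi0 : R -> R[i]) (d b v : nat)
    (p : R) (q : \bar R) (r : R) :
  cutoff phi0 -> (1 <= d)%N -> prime b ->
  1 <= p -> (1 <= q)%E -> 0 < r -> r < 1 / p ->
  exists C : R, 0 < C /\
    forall (n s : nat) (M : 'I_d -> 'M['F_b]_(s, n)),
      (0 < n)%N -> order_digital_net 1 v M ->
      (besov_cube_norm phi0 p%:E q r
         (cube_distribution_of (discrepancy (digital_net M)))
       <= (C * b%:R `^ (n%:R * (r - 1)) * n%:R `^ ((d%:R - 1) * recip q))%:E)%E.
Proof.
case: d => [//|d] pc _ pb p1 q1 r0; rewrite div1r => rp.
have b1 := prime_gt1 pb.
have [C [rho [C0 rho0 rho1 P]]] := block_Lnorm d.+1 pc b1 p1 r0 rp.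
have [K [K0 Q]] := besov_norm_level_le d b1 rho0 rho1 q1.
have recip0 : 0 <= recip q by case: q q1 {Q} => //= q q1; rewrite invr_ge0 (le_trans ler01)// -lee_fin.
(* b^(v (1 - r)) replaces m = n - v by n in the exponent, and the power of 2 comes from m + 1 <=
   2n. *)
pose C' := C * b%:R `^ (v%:R * (1 - r)) * K * 2 `^ (d%:R * recip q).
have C'0 : 0 <= C' by rewrite !mulr_ge0 ?powR_ge0.
have bR : 0 < b%:R :> R by rewrite ltr0n prime_gt0.
(* [C'] is only known to be nonnegative. *)
exists (C' + 1); split; first by rewrite ltr_wpDl.
move=> n s M n0 net; have [_ _ vn _] := net; rewrite mul1n in vn.
pose z m i : R := digital_net M m 0 i.
have zz := @net_points_digital R _ _ _ _ _ _ pb net.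
have N0 : (0 < b ^ n)%N by rewrite expn_gt0 prime_gt0.
pose m := (n - v)%N; pose X := C * b%:R `^ (m%:R * (r - 1)).
have X0 : 0 <= X by rewrite mulr_ge0 ?powR_ge0.
pose u := regular (extension z).
have bn : (besov_norm phi0 p%:E q r u <= (X * K * m.+1%:R `^ (d%:R * recip q))%:E)%E.
  apply: Q => // k; have [mf dl] := dist_Lnorm_block pc z p%:E k.
  apply: le_trans (P _ m z k N0 zz mf).
  by apply: lee_wpmul2l; rewrite // lee_fin powR_ge0.
have Xn : X * K * m.+1%:R `^ (d%:R * recip q) <=
    (C' + 1) * b%:R `^ (n%:R * (r - 1)) * n%:R `^ ((d.+1%:R - 1) * recip q).
  have -> : d.+1%:R - 1 = d%:R :> R by rewrite -natr1 addrK.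
  have mn : m.+1%:R `^ (d%:R * recip q) <= 2 `^ (d%:R * recip q) * n%:R `^ (d%:R * recip q) :> R.
    rewrite -powRM//; apply: ge0_ler_powR; rewrite ?nnegrE ?mulr_ge0//.
    by rewrite -natrM ler_nat mul2n -addnn -(addn1 m) leq_add// leq_subr.
  have XE : X = C * b%:R `^ (v%:R * (1 - r)) * b%:R `^ (n%:R * (r - 1)).
    rewrite /X /m natrB// -mulrA -powRD; last by rewrite (gt_eqF bR) implybT.
    congr (C * _); congr (_ `^ _); ring.
  rewrite mulrDl [leRHS]mulrDl; apply: ler_wpDr; first by rewrite !mulr_ge0 ?powR_ge0.
  have E0 : 0 <= C * b%:R `^ (v%:R * (1 - r)) * K * b%:R `^ (n%:R * (r - 1)).
    by rewrite !mulr_ge0 ?powR_ge0.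
  have := ler_wpM2l E0 mn; rewrite XE /C'.
  move: (b%:R `^ _) (b%:R `^ _) (2 `^ _) (n%:R `^ _) (m.+1%:R `^ _) => x1 x2 x3 x4 x5 h.
  by apply: le_trans (le_trans h _); apply: eq_ler; ring.
apply: le_trans (le_trans bn _); last by rewrite lee_fin.
apply: ereal_inf_lbound; exists u => //; split; last first.
  by apply: restricts_extension => // m' i; exact: digital_net_ge0.
split; first exact/tempered_regular/cintegrable_extension.
exact: le_lt_trans bn (ltry _).
Qed.
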